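(* Let $$q(x)=-\frac{2}{x^2+1}+\frac{8x^2}{(x^2+1)^2}=\frac{6x^2-2}{(x^2+1)^2},\quad x\ge 0,$$ let $A_N(q)$ be the operator in $L^2((0,\infty))$ given by $$A_N(q)f=-f''+qf,\quad f\in\operatorname{dom}(A_N(q))=\{g\in H^2((0,\infty)): g'(0)=0\},$$ and let $V\neq 0$ be a nonnegative function such that $V\in L^2((0,\infty))$. Then, for every $\alpha\in\mathbb{R}$, the operator $$(A_N(q)+\alpha V)f=-f''+qf+\alpha Vf,\quad f\in\operatorname{dom}(A_N(q)+\alpha V)=\operatorname{dom}(A_N(q)),$$ is self-adjoint in $L^2((0,\infty))$; the operator $V(A_N(q)-zI)^{-1}$ is compact in $L^2((0,\infty))$ for every $z\in\rho(A_N(q))$; $$\sigma_{ess}(A_N(q)+\alpha V)=\sigma_{ess}(A_N(q))=[0,\infty)\quad\text{for every }\alpha\in\mathbb{R};$$ and $$\sigma(A_N(q)+\alpha V)\cap(-\infty,0)\neq\emptyset\quad\text{for any }\alpha<0.$$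
   Context: $H^2((0,\infty))$ is the $L^2$-based Sobolev space of order $2$. $V\neq0$ means that $V$ is not zero almost everywhere; $V$ also denotes the corresponding maximal multiplication operator in $L^2((0,\infty))$. $\sigma(\cdot)$, $\sigma_{ess}(\cdot)$ and $\rho(\cdot)$ denote spectrum, essential spectrum and resolvent set, and $I$ is the identity on $L^2((0,\infty))$. *)

(* Defs.v *)
From HB Require Import structures.
From mathcomp Require Import all_boot all_order all_algebra sesquilinear.
From mathcomp Require Import generic_quotient ring_quotient.
From mathcomp Require Import complex.
From mathcomp Require Import ring lra.
From mathcomp Require Import all_classical all_reals all_analysis measurable_realfun.

Set Implicit Arguments.
Unset Strict Implicit.
Unset Printing Implicit Defensive.

Import Order.TTheory GRing.Theory Num.Theory.
Import numFieldNormedType.Exports.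

Local Open Scope classical_set_scope.
Local Open Scope ring_scope.
Local Open Scope complex_scope.
Local Open Scope quotient_scope.

Notation halfline := (`]0, +oo[%classic).

#[global] Instance ae_lebesgue_filter (R : realType) :
  Filter (almost_everywhere (@lebesgue_measure R)).
Proof. exact: ae_filter_ringOfSetsType. Qed.

Section SquareIntegrable.
Context {R : realType}.
Let mu := @lebesgue_measure R.
Let D : set R := halfline.

Definition square_integrable (f : R -> R) : Prop :=
  measurable_fun (halfline : set R) f /\
  (@lebesgue_measure R).-integrable halfline (fun x => ((f x) ^+ 2)%:E).

Let mD : measurable D. Proof. exact: measurable_itv. Qed.

Lemma square_integrable0 : square_integrable (cst 0).
Proof.
split; first exact: measurable_cst.
rewrite (_ : (fun x : R => _) = cst 0%E); first exact: integrable0.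
by apply/funext => x /=; rewrite expr0n.
Qed.

Lemma square_integrableM (f g : R -> R) :
  square_integrable f -> square_integrable g ->
  mu.-integrable D (fun x => (f x * g x)%:E).
Proof.
move=> [mf sf] [mg sg].
apply: (@le_integrable _ _ _ mu D mD _
  (fun x => ((f x) ^+ 2)%:E + ((g x) ^+ 2)%:E)%E) => //.
- by apply/measurable_EFinP; exact: measurable_funM.
- move=> x _; rewrite -EFinD /= lee_fin.
  rewrite [leRHS]ger0_norm ?addr_ge0 ?sqr_ge0// normrM.
  rewrite -[f x ^+ 2]real_normK ?num_real// -[g x ^+ 2]real_normK ?num_real//.
  have := sqr_ge0 (`|f x| - `|g x|); rewrite sqrrB.
  have : 0 <= `|f x| * `|g x| by rewrite mulr_ge0.
  lra.
- exact: integrableD.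
Qed.

Lemma square_integrableD (f g : R -> R) :
  square_integrable f -> square_integrable g -> square_integrable (f \+ g).
Proof.
move=> sf sg; have := square_integrableM sf sg.
case: (sf) (sg) => [mf if2] [mg ig2] ifg.
split; first exact: measurable_funD.
rewrite (_ : (fun x : R => _) = (fun x => (f x ^+ 2)%:E +
  ((f x * g x)%:E + ((f x * g x)%:E + (g x ^+ 2)%:E)))%E); last first.
  by apply/funext => x /=; rewrite -!EFinD; congr (_%:E); ring.
by do 3! apply: integrableD => //.
Qed.

Lemma square_integrableZ (a : R) (f : R -> R) :
  square_integrable f -> square_integrable (fun x => a * f x).
Proof.
move=> [mf if2]; split; first exact: measurable_funM.
rewrite (_ : (fun x : R => _) = (fun x => (a ^+ 2)%:E * (f x ^+ 2)%:E)%E).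
  exact: integrableZl.
by apply/funext => x /=; rewrite exprMn EFinM.
Qed.

End SquareIntegrable.

Section SquareIntegrableComplex.
Context {R : realType}.
Let mu := @lebesgue_measure R.

Definition csquare_integrable (f : R -> R[i]) : Prop :=
  square_integrable (fun x => complex.Re (f x)) /\
  square_integrable (fun x => complex.Im (f x)).

Definition csqint : {pred R -> R[i]} := mem [set f | csquare_integrable f].

Lemma csqint_submod_closed : submod_closed csqint.
Proof.
split; first by rewrite inE; split; exact: square_integrable0.
move=> a f g; rewrite !inE => -[rf imf] [rg img]; split.
  rewrite (_ : (fun x => _) = (fun x => complex.Re a * complex.Re (f x)) \+
    ((fun x => - complex.Im a * complex.Im (f x)) \+
      (fun x => complex.Re (g x)))).
    by apply: square_integrableD; [exact: square_integrableZ|];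
      apply: square_integrableD => //; exact: square_integrableZ.
  apply/funext => x; rewrite /= !fctE /=.
  by case: a (f x) (g x) => [a b] [c d] [p q] /=; ring.
rewrite (_ : (fun x => _) = (fun x => complex.Re a * complex.Im (f x)) \+
  ((fun x => complex.Im a * complex.Re (f x)) \+
    (fun x => complex.Im (g x)))).
  by apply: square_integrableD; [exact: square_integrableZ|];
    apply: square_integrableD => //; exact: square_integrableZ.
apply/funext => x; rewrite /= !fctE /=.
by case: a (f x) (g x) => [a b] [c d] [p q] /=; ring.
Qed.

HB.instance Definition _ := GRing.isSubmodClosed.Build _ _ csqint
  csqint_submod_closed.

End SquareIntegrableComplex.


(* Square-integrable functions (0, +oo) -> C; their values outside (0, +oo) are
   junk. Measurability is Borel measurability, which is harmless as every
   Lebesgue measurable function is a.e. equal to a Borel one. L2 below is the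
   quotient by a.e. equality on (0, +oo), with representatives as a coercion to
   functions. *)
Record L2fun (R : realType) := MkL2fun {
  L2fun_val :> R -> R[i] ; L2fun_valP : L2fun_val \in csqint }.

HB.instance Definition _ (R : realType) := [isSub for @L2fun_val R].
HB.instance Definition _ (R : realType) := [Choice of L2fun R by <:].
HB.instance Definition _ (R : realType) :=
  [SubChoice_isSubLmodule of L2fun R by <:].

Section L2.
Context (R : realType).
Let mu := @lebesgue_measure R.
Let D : set R := halfline.
Let mD : measurable D. Proof. exact: measurable_itv. Qed.

Definition L2null : {pred L2fun R} :=
  mem [set f : L2fun R | f = cst 0 %[ae (@lebesgue_measure R) in halfline]].

Lemma L2null_zmod_closed : zmod_closed L2null.
Proof.
split; first by rewrite inE; exact: aeW.
move=> f g; rewrite !inE => f0 g0; rewrite /mkset.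
near=> x => xD; rewrite /= !fctE (near f0 x)// (near g0 x)//= subr0 //.
Unshelve. all: by end_near. Qed.

HB.instance Definition _ := GRing.isZmodClosed.Build _ L2null
  L2null_zmod_closed.

Definition L2 : Type := {ideal_quot (L2null : zmodClosed (L2fun R))}.
HB.instance Definition _ := GRing.Zmodule.on L2.
HB.instance Definition _ := EqQuotient.on L2.

Definition L2_to_fun (u : L2) : R -> R[i] := repr u.
Coercion L2_to_fun : L2 >-> Funclass.

Lemma eq_L2P (f g : L2fun R) :
  \pi_L2 f = \pi_L2 g <-> f = g %[ae mu in D].
Proof.
rewrite (rwP eqP) -Quotient.idealrBE inE; split => fg; rewrite /mkset;
  near=> x => xD.
- by apply/eqP; rewrite -subr_eq0; apply/eqP; exact: (near fg x).
- by rewrite /= !fctE (near fg x)//= subrr.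
Unshelve. all: by end_near. Qed.

Lemma L2_reprE (f : L2fun R) : (\pi_L2 f : L2) = f %[ae mu in D].
Proof. by apply/eq_L2P; rewrite reprK. Qed.

Definition L2scale (a : R[i]) (u : L2) : L2 := \pi_L2 (a *: repr u).

Lemma pi_L2scale a (f : L2fun R) : L2scale a (\pi_L2 f) = \pi_L2 (a *: f).
Proof.
apply/eq_L2P; have := L2_reprE f; rewrite /L2_to_fun => ff.
near=> x => xD; rewrite /= !fctE (near ff x)//.
Unshelve. all: by end_near. Qed.

Let pi_L2D (f g : L2fun R) : \pi_L2 f + \pi_L2 g = \pi_L2 (f + g).
Proof. exact/esym/Quotient.pi_add. Qed.

Lemma L2scaleA a b u : L2scale a (L2scale b u) = L2scale (a * b) u.
Proof. by elim/quotW: u => f; rewrite (pi_L2scale b) !pi_L2scale scalerA. Qed.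

Lemma L2scale1 : left_id 1 L2scale.
Proof. by elim/quotW=> f; rewrite pi_L2scale scale1r. Qed.

Lemma L2scaleDr : right_distributive L2scale +%R.
Proof.
move=> a; elim/quotW=> f; elim/quotW=> g.
by rewrite pi_L2D !pi_L2scale pi_L2D scalerDr.
Qed.

Lemma L2scaleDl u : {morph L2scale^~ u : a b / a + b}.
Proof.
by elim/quotW: u => f a b; rewrite !pi_L2scale pi_L2D scalerDl.
Qed.

HB.instance Definition _ := GRing.Zmodule_isLmodule.Build R[i] L2
  L2scaleA L2scale1 L2scaleDr L2scaleDl.

End L2.

Definition cintegral (R : realType) (f : R -> R[i]) : R[i] :=
  (\int[@lebesgue_measure R]_(x in halfline) complex.Re (f x)) +i*
  (\int[@lebesgue_measure R]_(x in halfline) complex.Im (f x)).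

Section L2dot.
Context (R : realType).
Let mu := @lebesgue_measure R.
Let D : set R := halfline.
Let mD : measurable D. Proof. exact: measurable_itv. Qed.

Definition L2dot (u v : L2 R) : R[i] := cintegral (fun x => u x * (v x)^*).

Let cint (f : R -> R[i]) : Prop :=
  mu.-integrable D (fun x : R => (complex.Re (f x))%:E) /\
  mu.-integrable D (fun x : R => (complex.Im (f x))%:E).

Lemma eq_cintegral (f g : R -> R[i]) : f =1 g -> cintegral f = cintegral g.
Proof. by move=> /funext ->. Qed.

Lemma ae_eq_cintegral (f g : R -> R[i]) : cint f -> cint g ->
  f = g %[ae mu in D] -> cintegral f = cintegral g.
Proof.
move=> [f1 f2] [g1 g2] fg; congr (_ +i* _); congr fine.
- apply: (@ae_eq_integral _ _ _ mu D _ _ mD (measurable_int mu f1)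
    (measurable_int mu g1)).
  by rewrite /ae_eq; near=> x => xD; rewrite (near fg x).
- apply: (@ae_eq_integral _ _ _ mu D _ _ mD (measurable_int mu f2)
    (measurable_int mu g2)).
  by rewrite /ae_eq; near=> x => xD; rewrite (near fg x).
Unshelve. all: by end_near. Qed.

Lemma cintegralD (f g : R -> R[i]) : cint f -> cint g ->
  cintegral (fun x => f x + g x) = cintegral f + cintegral g.
Proof.
move=> [f1 f2] [g1 g2]; rewrite /cintegral; simpc; rewrite -!RintegralD//.
by congr (_ +i* _); apply: eq_Rintegral => x _; case: (f x) (g x) => [? ?] [].
Qed.

Lemma cintegralZ (a : R[i]) (f : R -> R[i]) : cint f ->
  cintegral (fun x => a * f x) = a * cintegral f.
Proof.
move=> [f1 f2]; case: a => a b; rewrite /cintegral; simpc.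
have iZ (c : R) (h : R -> R) : mu.-integrable D (EFin \o h) ->
    mu.-integrable D (EFin \o (fun x => c * h x)).
  by move=> ih; apply: (@integrableZl _ _ _ mu D mD c (EFin \o h)).
rewrite -!RintegralZl// -RintegralB ?iZ// -RintegralD ?iZ//.
by congr (_ +i* _); apply: eq_Rintegral => x _; case: (f x).
Qed.

Lemma cintegral_conj (f : R -> R[i]) : cint f ->
  cintegral (fun x => (f x)^*) = (cintegral f)^*.
Proof.
move=> [f1 f2]; rewrite /cintegral; simpc; congr (_ +i* _).
  by apply: eq_Rintegral => x _; case: (f x).
rewrite -mulN1r -RintegralZl//.
by apply: eq_Rintegral => x _; case: (f x) => p q /=; rewrite mulN1r.
Qed.

Lemma cintM (f g : L2fun R) : cint (fun x => f x * (g x)^*).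
Proof.
case: f g => [f /= +] [g /= +]; rewrite !inE => -[f1 f2] [g1 g2].
split.
- rewrite (_ : (fun _ => _) = (fun x =>
    (complex.Re (f x) * complex.Re (g x))%:E +
    (complex.Im (f x) * complex.Im (g x))%:E)%E).
    by apply: integrableD => //; exact: square_integrableM.
  apply/funext => x; case: (f x) (g x) => [a b] [c d] /=.
  by rewrite -EFinD mulrN opprK.
- rewrite (_ : (fun _ => _) = (fun x =>
    (complex.Im (f x) * complex.Re (g x))%:E -
    (complex.Re (f x) * complex.Im (g x))%:E)%E).
    by apply: integrableB => //; exact: square_integrableM.
  apply/funext => x; case: (f x) (g x) => [a b] [c d] /=.
  by rewrite -EFinB mulrN addrC.
Qed.

Lemma L2dotE (f g : L2fun R) :
  L2dot (\pi_(L2 R) f) (\pi_(L2 R) g) = cintegral (fun x => f x * (g x)^*).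
Proof.
apply: ae_eq_cintegral; [exact: cintM|exact: cintM|].
have ff := L2_reprE f; have gg := L2_reprE g.
near=> x => xD; rewrite (near ff x)// (near gg x)//.
Unshelve. all: by end_near. Qed.

Lemma L2dotC (u v : L2 R) : L2dot u v = (L2dot v u)^*.
Proof.
rewrite /L2dot -cintegral_conj; last exact: cintM.
by apply: eq_cintegral => x; rewrite rmorphM /= conjcK mulrC.
Qed.

Lemma L2dot_linearl (v : L2 R) a :
  {morph L2dot^~ v : u w / a *: u + w >-> a * u + w}.
Proof.
elim/quotW: v => h; elim/quotW=> f; elim/quotW=> g.
rewrite [a *: _]pi_L2scale -[_ + _]Quotient.pi_add !L2dotE.
rewrite -cintegralZ; last exact: cintM.
rewrite -cintegralD; [|by have := cintM (a *: f) h;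
    under eq_fun do rewrite /= -mulrA|exact: cintM].
by apply: eq_cintegral => x; rewrite /= !fctE mulrDl -mulrA.
Qed.

Lemma L2dot_bilinear :
  bilinear_for *%R (@conjc R \; *%R) (L2dot : L2 R -> L2 R -> R[i]).
Proof.
split=> [v a u w|u a v w] /=; first exact: L2dot_linearl.
rewrite L2dotC L2dot_linearl rmorphD rmorphM /=.
by congr (_ * _ + _); exact/esym/L2dotC.
Qed.

HB.instance Definition _ := bilinear_isBilinear.Build R[i] (L2 R) (L2 R) R[i]
  *%R (@conjc R \; *%R) L2dot L2dot_bilinear.

Lemma L2dot_hermitian (u v : L2 R) :
  L2dot u v = (-1) ^+ false * (L2dot v u)^*.
Proof. by rewrite expr0 mul1r; exact: L2dotC. Qed.

HB.instance Definition _ :=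
  isHermitianSesquilinear.Build R[i] (L2 R) false (@conjc R) L2dot
    L2dot_hermitian.

Lemma pi_L20 : \pi_(L2 R) 0 = 0.
Proof.
apply: (addrI (\pi_(L2 R) 0)); rewrite addr0.
by apply: etrans (esym (Quotient.pi_add _ _ _)) _; rewrite addr0.
Qed.

Lemma L2dot_gt0 (u : L2 R) : u != 0 -> 0 < L2dot u u.
Proof.
elim/quotW: u => f f0; rewrite L2dotE /cintegral.
rewrite (@eq_Rintegral _ _ _ _ _ (fun=> 0) (fun x => complex.Im _)); last first.
  by move=> x _; case: (f x) => a b /=; rewrite mulrN mulrC addNr.
rewrite /Rintegral integral0 ltcE /= eqxx /= lt_neqAle; apply/andP; split.
  apply: contra f0 => /eqP i0; rewrite -pi_L20; apply/eqP/eq_L2P.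
  have [if1 _] := cintM f f.
  have : (\int[mu]_(x in D) `|(complex.Re (f x * (f x)^*)%C)%:E| = 0)%E.
    transitivity (\int[mu]_(x in D) (complex.Re (f x * (f x)^*)%C)%:E)%E.
      apply: eq_integral => x _; rewrite gee0_abs// lee_fin.
      by case: (f x) => a b /=; rewrite mulrN opprK addr_ge0// -expr2 sqr_ge0.
    rewrite -[LHS](fineK (@integrable_fin_num _ _ _ mu D mD _ if1)).
    by congr (_%:E); exact: esym i0.
  move/(ae_eq_integral_abs mu mD (measurable_int mu if1)) => ff.
  near=> x => xD; have : (complex.Re (f x * (f x)^*))%:E = 0%E by apply: (near ff x).
  case=> /eqP; rewrite /=; case: (f x) => a b /=.
  rewrite mulrN opprK -!expr2 paddr_eq0 ?sqr_ge0// !sqrf_eq0.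
  by case/andP => /eqP -> /eqP ->.
apply: fine_ge0; apply: integral_ge0 => x _; rewrite lee_fin.
by case: (f x) => a b /=; rewrite mulrN opprK addr_ge0// -expr2 sqr_ge0.
Unshelve. all: by end_near. Qed.

HB.instance Definition _ := isDotProduct.Build R[i] (L2 R) L2dot L2dot_gt0.

End L2dot.

(* An operator in a Hilbert space H is represented by its graph, a subset of
   H * H. Domains are thus part of the data: sums and products of operators are
   defined on their natural domains. *)
Section Operators.
Context (R : realType) (H : lmodType R[i]) (dot : {dot H for @conjc R}).
Implicit Types (S T K : set (H * H)) (z : R[i]).

Definition hnorm (u : H) : R := Num.sqrt (complex.Re (dot u u)).

Definition op_dom T : set H := [set u | exists v, T (u, v)].

Definition linear_operator T : Prop :=
  [/\ T 0, forall (a : R[i]) p q, T p -> T q -> T (a *: p + q) &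
      forall u v w, T (u, v) -> T (u, w) -> v = w].

Definition op_id : set (H * H) := [set p | p.2 = p.1].
Definition op_add S T : set (H * H) :=
  [set p | exists v w, [/\ S (p.1, v), T (p.1, w) & p.2 = v + w]].
Definition op_scale (a : R[i]) T : set (H * H) :=
  [set p | exists2 v, T (p.1, v) & p.2 = a *: v].
Definition op_comp S T : set (H * H) :=
  [set p | exists2 v, T (p.1, v) & S (v, p.2)].
Definition op_inv T : set (H * H) := [set p | T (p.2, p.1)].

Definition densely_defined T : Prop :=
  forall (u : H) (e : R), 0 < e -> exists2 v, op_dom T v & hnorm (u - v) < e.

Definition op_adjoint T : set (H * H) :=
  [set p | forall u v, T (u, v) -> dot v p.1 = dot u p.2].

Definition self_adjoint T : Prop := densely_defined T /\ op_adjoint T = T.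

Definition bounded_operator T : Prop :=
  [/\ linear_operator T, op_dom T = setT &
      exists c : R, forall u v, T (u, v) -> hnorm v <= c * hnorm u].

Definition compact_operator K : Prop :=
  [/\ linear_operator K, op_dom K = setT &
      forall u v : nat -> H, (forall n, K (u n, v n)) ->
        (exists c : R, forall n, hnorm (u n) <= c) ->
        exists (phi : nat -> nat) (l : H), {homo phi : m n / (m < n)%N} /\
          hnorm (v (phi n) - l) @[n --> \oo] --> (0 : R)].

Definition resolvent T z : set (H * H) :=
  op_inv (op_add T (op_scale (- z) op_id)).

Definition resolvent_set T : set R[i] :=
  [set z | bounded_operator (resolvent T z)].

Definition spectrum T : set R[i] := ~` resolvent_set T.

Definition eigenspace T z : set H := [set u | T (u, z *: u)].

Definition finite_dimensional (U : set H) : Prop :=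
  exists s : seq H, forall u, U u ->
    exists c : 'I_(size s) -> R[i], u = \sum_(i < size s) c i *: s`_i.

(* Isolated points of the spectrum which are eigenvalues of finite multiplicity.
   For a self-adjoint T (the only case used) geometric and algebraic
   multiplicities coincide. *)
Definition discrete_spectrum T : set R[i] :=
  [set z | [/\ spectrum T z,
      exists2 e : R, 0 < e &
        forall w, spectrum T w -> `|w - z| < e%:C -> w = z,
      exists2 u, eigenspace T z u & u != 0 &
      finite_dimensional (eigenspace T z)]].

Definition essential_spectrum T : set R[i] :=
  spectrum T `\` discrete_spectrum T.

End Operators.

Section NeumannSchrodinger.
Context (R : realType).

(* C_c^oo((0, +oo)), each function being extended by zero to the real line. *)
Definition test_function (phi : R -> R) : Prop :=
  (forall n x, derivable (derive1n n phi) x 1) /\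
  exists a b : R, 0 < a /\ forall x, x \notin `[a, b] -> phi x = 0.

Definition weak_derivative (u v : L2 R) : Prop :=
  forall phi, test_function phi ->
    cintegral (fun x => u x * (derive1 phi x)%:C) =
    - cintegral (fun x => v x * (phi x)%:C).

Definition sobolev2 : set (L2 R) :=
  [set u | exists u1 u2, weak_derivative u u1 /\ weak_derivative u1 u2].

(* The value at 0 of (the continuous representative on [0, +oo) of) u. *)
Definition trace0 (u : L2 R) (c : R[i]) : Prop :=
  exists f : R -> R[i],
    [/\ {within `[0, +oo[, continuous (fun x => complex.Re (f x))},
        {within `[0, +oo[, continuous (fun x => complex.Im (f x))},
        f = u %[ae (@lebesgue_measure R) in halfline] & f 0 = c].

Definition neumann_domain : set (L2 R) :=
  [set u | sobolev2 u /\ exists2 u1, weak_derivative u u1 & trace0 u1 0].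

Definition neumann_operator (q : R -> R) : set (L2 R * L2 R) :=
  [set p : L2 R * L2 R | neumann_domain p.1 /\ exists u1 u2,
    [/\ weak_derivative p.1 u1, weak_derivative u1 u2 &
        p.2 = (fun x => - u2 x + (q x)%:C * p.1 x)
          %[ae (@lebesgue_measure R) in halfline]]].

(* The maximal multiplication operator: as p.2 is in L2, its domain is
   {u in L2 | V u in L2}. *)
Definition multiplication_operator (V : R -> R) : set (L2 R * L2 R) :=
  [set p : L2 R * L2 R | p.2 = (fun x => (V x)%:C * p.1 x)
    %[ae (@lebesgue_measure R) in halfline]].

Definition potential (x : R) : R :=
  - (2 / (x ^+ 2 + 1)) + 8 * x ^+ 2 / (x ^+ 2 + 1) ^+ 2.

Lemma potentialE x : potential x = (6 * x ^+ 2 - 2) / (x ^+ 2 + 1) ^+ 2.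
Proof.
rewrite /potential; field.
by rewrite gt_eqF// ltr_wpDl// sqr_ge0.
Qed.

End NeumannSchrodinger.

(* Main.v *)
(** The function psi = 1 / (x^2 + 1) satisfies psi'' = q psi and psi'(0) = 0. With
    w = psi' / psi one has q = w' + w^2, hence A_N(q) = L^* L for the closed
    operator L f = f' - w f on H^1: by von Neumann's theorem A_N(q) is self-adjoint
    and nonnegative, and psi is in its kernel. A bound on the graph norm of u
    bounds u uniformly and in C^(1/2), so a subsequence converges locally uniformly
    (Arzela-Ascoli) and V u converges in L^2 by dominated convergence: V is
    A_N(q)-compact with relative bound 0. Outside [0, +oo) the spectrum of the
    perturbed operator is therefore discrete, while rescalings of psi - psi^2
    modulated by exp (i k x) are singular sequences for k^2. For alpha < 0 the
    quadratic form takes the negative value alpha * int V psi^2 at psi. *)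

Require Import Defs.
From HB Require Import structures.
From mathcomp Require Import all_boot all_order all_algebra sesquilinear.
From mathcomp Require Import generic_quotient ring_quotient.
From mathcomp Require Import complex ring lra.
From mathcomp Require Import all_classical all_reals all_analysis measurable_realfun.

Set Implicit Arguments.
Unset Strict Implicit.
Unset Printing Implicit Defensive.

Import Order.TTheory GRing.Theory Num.Theory.
Import numFieldNormedType.Exports.

Local Open Scope classical_set_scope.
Local Open Scope ring_scope.
Local Open Scope complex_scope.

(** * Inner products *)

(** Operators are graphs, and one projection lemma on closed relations carries the functional
    analysis: minimizing the distance from [(f, 0)] to the graph of L gives u with L^* L u + u = f,
    and other relations give orthogonal projections onto ranges and closures of domains. The
    delicate point is the boundary value. Test functions vanish near 0, so pairing with them yields
    only the differential equation of g = L u; the condition g(0) = 0 comes from pairing with psi,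
    which is in the kernel of L and has psi(0) = 1. As w(0) = 0, the conditions g(0) = 0 and u'(0) =
    0 agree. The singular sequences are not normalized: with the bump stretched by 1/s their norms
    grow at least like s^(-1/2), while their images under A_N(q) - k^2 and under V stay bounded, the
    latter because the functions are bounded by 1 and V is square-integrable. Hence one sequence
    serves every alpha. Since [0, +oo) has no isolated point, its inclusion in the spectrum already
    makes it essential. *)

Section InnerProduct.
Context (R : realType) (H : lmodType R[i]) (dot : {dot H for @conjc R}).
Implicit Types (u v w : H) (a b : R).

Local Notation rdot u v := (complex.Re (dot u v)).
Local Notation hnorm := (hnorm dot).

Lemma dotC u v : dot u v = (dot v u)^*.
Proof. by rewrite (@hermC _ _ _ _ dot) expr0 mul1r. Qed.

Lemma dotZl (c : R[i]) u v : dot (c *: u) v = c * dot u v.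
Proof. exact: (linearZl_LR dot). Qed.

Lemma dotZr (c : R[i]) u v : dot u (c *: v) = c^* * dot u v.
Proof. by rewrite dotC dotZl rmorphM/= -dotC. Qed.

Lemma dotZr_real a u v : dot u (a%:C *: v) = a%:C * dot u v.
Proof. by rewrite dotZr; congr (_ * _); exact: conjc_real. Qed.

Lemma dotZr_conj (c : R[i]) u v : dot u (c^* *: v) = c * dot u v.
Proof. by rewrite dotZr; congr (_ * _); exact: conjcK. Qed.

Lemma dotDl u v w : dot (u + v) w = dot u w + dot v w.
Proof. exact: (linearDl dot). Qed.

Lemma dotDr u v w : dot w (u + v) = dot w u + dot w v.
Proof. by rewrite dotC dotDl rmorphD /= -!dotC. Qed.

Lemma dot0l u : dot 0 u = 0.
Proof. exact: (linear0l dot). Qed.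

Lemma dot0r u : dot u 0 = 0.
Proof. by rewrite dotC dot0l conjc0. Qed.

Lemma dotNl u v : dot (- u) v = - dot u v.
Proof. exact: (linearNl dot). Qed.

Lemma dotNr u v : dot u (- v) = - dot u v.
Proof. by rewrite dotC dotNl rmorphN/= -dotC. Qed.

Lemma dot_gt0 u : u != 0 -> 0 < dot u u.
Proof. by move=> u0; have := @neq0_dnorm_gt0 _ _ _ dot u u0. Qed.

Lemma rdotC u v : rdot u v = rdot v u.
Proof. by rewrite dotC; case: (dot v u). Qed.

Lemma rdotZl a u v : rdot (a%:C *: u) v = a * rdot u v.
Proof. by rewrite dotZl; case: (dot u v) => p q /=; rewrite mul0r subr0. Qed.

Lemma rdotZr a u v : rdot u (a%:C *: v) = a * rdot u v.
Proof. by rewrite rdotC rdotZl rdotC. Qed.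

Lemma rdotDl u v w : rdot (u + v) w = rdot u w + rdot v w.
Proof. by rewrite dotDl raddfD. Qed.

Lemma rdotDr u v w : rdot w (u + v) = rdot w u + rdot w v.
Proof. by rewrite dotDr raddfD. Qed.

Lemma rdotNl u v : rdot (- u) v = - rdot u v.
Proof. by rewrite dotNl raddfN. Qed.

Lemma rdotNr u v : rdot u (- v) = - rdot u v.
Proof. by rewrite dotNr raddfN. Qed.

Lemma rdotBl u v w : rdot (u - v) w = rdot u w - rdot v w.
Proof. by rewrite rdotDl rdotNl. Qed.

Lemma rdotBr u v w : rdot w (u - v) = rdot w u - rdot w v.
Proof. by rewrite rdotDr rdotNr. Qed.

Definition rdotE := (rdotBl, rdotBr, rdotDl, rdotDr, rdotNl, rdotNr, rdotZl, rdotZr).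

Lemma Im_dot u v : complex.Im (dot u v) = - rdot ('i *: u) v.
Proof. by rewrite dotZl; case: (dot u v) => p q /=; ring. Qed.

(** The imaginary part of an inner product is minus a real part after [u] is multiplied by ['i].
    Complex identities that are stable under this multiplication are therefore proved on real parts
    only. *)
Lemma dot_ext u v u' v' : rdot u v = rdot u' v' ->
  rdot ('i *: u) v = rdot ('i *: u') v' -> dot u v = dot u' v'.
Proof.
move=> h1 /(congr1 -%R); rewrite -!Im_dot => h2.
by apply/eqP; rewrite eq_complex h1 h2 !eqxx.
Qed.

Lemma rdot_ge0 u : 0 <= rdot u u.
Proof.
have [->|/dot_gt0] := eqVneq u 0; first by rewrite dot0l.
by rewrite ltcE => /andP[_] /ltW.
Qed.

Lemma dotuu u : dot u u = (rdot u u)%:C.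
Proof.
apply/eqP; rewrite eq_complex /= eqxx /=.
by have := dotC u u; case: (dot u u) => p q [] /= h; apply/eqP; lra.
Qed.

Lemma hnorm_ge0 u : 0 <= hnorm u.
Proof. exact: sqrtr_ge0. Qed.

Lemma sqr_hnorm u : hnorm u ^+ 2 = rdot u u.
Proof. by rewrite sqr_sqrtr// rdot_ge0. Qed.

Lemma hnorm0 : hnorm 0 = 0.
Proof. by rewrite /hnorm dot0l sqrtr0. Qed.

Lemma hnorm_eq0 u : hnorm u = 0 -> u = 0.
Proof.
move=> h; apply/eqP; apply: contra_eqT (h) => /dot_gt0.
by rewrite dotuu ltcR -sqr_hnorm h expr0n ltxx.
Qed.

Lemma hnorm_gt0 u : u != 0 -> 0 < hnorm u.
Proof.
move=> u0; rewrite lt_neqAle hnorm_ge0 andbT eq_sym.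
by apply: contraNN u0 => /eqP h; apply/eqP; exact: hnorm_eq0.
Qed.

Lemma CauchySchwarz_rdot u v : rdot u v <= hnorm u * hnorm v.
Proof.
have [->|v0] := eqVneq v 0; first by rewrite dot0r hnorm0 mulr0.
have nv := hnorm_gt0 v0; have nu := hnorm_ge0 u.
have [->|u0] := eqVneq u 0; first by rewrite dot0l hnorm0 mul0r.
have nu0 := hnorm_gt0 u0.
(* Expanded, this square is 2 |u| |v| (|u| |v| - Re <u, v>). *)
have := rdot_ge0 ((hnorm v)%:C *: u - (hnorm u)%:C *: v).
rewrite !rdotE -!sqr_hnorm (rdotC v u) => h.
have : 0 <= 2 * (hnorm u * hnorm v) * (hnorm u * hnorm v - rdot u v).
  by apply: le_trans h _; rewrite le_eqVlt; apply/orP; left; apply/eqP; ring.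
by rewrite pmulr_rge0 ?subr_ge0// mulr_gt0// mulr_gt0.
Qed.

Lemma hnorm_opp u : hnorm (- u) = hnorm u.
Proof. by rewrite /hnorm dotNl dotNr opprK. Qed.

Lemma abs_rdot_le u v : `|rdot u v| <= hnorm u * hnorm v.
Proof.
rewrite ler_norml CauchySchwarz_rdot andbT lerNl -rdotNl.
by rewrite (le_trans (CauchySchwarz_rdot _ _))// hnorm_opp.
Qed.

Lemma le_hnormD u v : hnorm (u + v) <= hnorm u + hnorm v.
Proof.
rewrite -(@ler_pXn2r _ 2)// ?nnegrE ?addr_ge0 ?hnorm_ge0//.
rewrite sqr_hnorm !rdotE sqrrD -!sqr_hnorm (rdotC v).
by have := CauchySchwarz_rdot u v; lra.
Qed.

Lemma le_hnormB u v : hnorm (u - v) <= hnorm u + hnorm v.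
Proof. by rewrite -(hnorm_opp v) le_hnormD. Qed.

Lemma hnormBC u v : hnorm (u - v) = hnorm (v - u).
Proof. by rewrite -hnorm_opp opprB. Qed.

Lemma ler_hnormB u v : hnorm u - hnorm v <= hnorm (u - v).
Proof. by rewrite lerBlDr -{1}(subrK v u) le_hnormD. Qed.

Lemma hnormZ (c : R[i]) u : hnorm (c *: u) = Normc.normc c * hnorm u.
Proof.
apply/eqP; rewrite -(@eqrXn2 _ 2)// ?mulr_ge0 ?hnorm_ge0//; last first.
  by case: c => a b /=; exact: sqrtr_ge0.
rewrite exprMn !sqr_hnorm dotZl dotZr dotuu; case: c => a b /=; apply/eqP.
by rewrite sqr_sqrtr ?addr_ge0 ?sqr_ge0//; ring.
Qed.

Lemma normc_real a : Normc.normc a%:C = `|a|.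
Proof. by rewrite /= expr0n/= addr0 sqrtr_sqr. Qed.

Lemma hnormZr a u : hnorm (a%:C *: u) = `|a| * hnorm u.
Proof. by rewrite hnormZ normc_real. Qed.

Definition hcvg (u : nat -> H) (l : H) := hnorm (u n - l) @[n --> \oo] --> (0 : R).

Definition hcauchy (u : nat -> H) := forall e : R, 0 < e -> exists N,
  forall m n, (N <= m)%N -> (N <= n)%N -> hnorm (u m - u n) < e.

Definition hcomplete := forall u : nat -> H, hcauchy u -> exists l, hcvg u l.

Lemma hcvgP (u : nat -> H) l : hcvg u l <->
  forall e : R, 0 < e -> exists N, forall n, (N <= n)%N -> hnorm (u n - l) < e.
Proof.
split=> [/cvgrPdist_lt h e e0|h].
  have [N _ hN] := h e e0; exists N => n /hN /=.
  by rewrite sub0r normrN ger0_norm ?hnorm_ge0.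
apply/cvgrPdist_lt => e /h[N hN]; exists N => // n /hN /=.
by rewrite sub0r normrN ger0_norm ?hnorm_ge0.
Qed.

Lemma hcvg_squeeze (u : nat -> H) l (r : nat -> R) :
  (forall n, hnorm (u n - l) <= r n) -> r @ \oo --> 0 -> hcvg u l.
Proof.
move=> ur r0; apply: (squeeze_cvgr _ (@cvg_cst _ _ _ _ _) r0).
by apply: nearW => n; rewrite hnorm_ge0 ur.
Qed.

Lemma hcvg_cauchy (u : nat -> H) l : hcvg u l -> hcauchy u.
Proof.
move=> /hcvgP h e e0; have e2 : 0 < e / 2 by rewrite divr_gt0.
have [N hN] := h _ e2.
exists N => m n /hN hm /hN hn.
rewrite (_ : u m - u n = (u m - l) - (u n - l)); last first.
  by rewrite opprB addrA subrK.
by rewrite (le_lt_trans (le_hnormB _ _))// (splitr e) ltrD.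
Qed.

Lemma hcvg_cst u : hcvg (fun=> u) u.
Proof. by rewrite /hcvg subrr hnorm0; exact: cvg_cst. Qed.

Lemma hcvgD (u v : nat -> H) l k : hcvg u l -> hcvg v k -> hcvg (fun n => u n + v n) (l + k).
Proof.
move=> ul vk; apply: (@hcvg_squeeze _ _ (fun n => hnorm (u n - l) + hnorm (v n - k))).
  by move=> n; rewrite opprD addrACA le_hnormD.
by rewrite -[X in _ --> X](addr0 0); exact: cvgD.
Qed.

Lemma hcvgZ (c : R[i]) (u : nat -> H) l : hcvg u l -> hcvg (fun n => c *: u n) (c *: l).
Proof.
move=> ul; apply: (@hcvg_squeeze _ _ (fun n => Normc.normc c * hnorm (u n - l))).
  by move=> n; rewrite -scalerBr hnormZ.
by rewrite -[X in _ --> X](mulr0 (Normc.normc c)); apply: cvgM => //; exact: cvg_cst.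
Qed.

Lemma hcvgN (u : nat -> H) l : hcvg u l -> hcvg (fun n => - u n) (- l).
Proof.
move=> /(hcvgZ (-1)); rewrite scaleN1r; congr hcvg.
by apply/funext => n; rewrite scaleN1r.
Qed.

Lemma hcvgB (u v : nat -> H) l k : hcvg u l -> hcvg v k -> hcvg (fun n => u n - v n) (l - k).
Proof. by move=> ul /hcvgN; exact: hcvgD. Qed.

Lemma hcvg_norm (u : nat -> H) l : hcvg u l -> hnorm (u n) @[n --> \oo] --> hnorm l.
Proof.
move=> /hcvgP h; apply/cvgrPdist_lt => e /h[N hN]; exists N => // n /hN /=.
apply: le_lt_trans.
by rewrite ler_norml lerNl opprB ler_hnormB/= hnormBC ler_hnormB.
Qed.

Lemma hcvg_rdotr (u : nat -> H) l v : hcvg u l -> rdot (u n) v @[n --> \oo] --> rdot l v.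
Proof.
move=> ul; apply/subr_cvg0; apply/norm_cvg0P.
have h0 : hnorm (u n - l) * hnorm v @[n --> \oo] --> (0 : R).
  by rewrite -[X in _ --> X](mul0r (hnorm v)); apply: cvgM => //; exact: cvg_cst.
apply: (squeeze_cvgr _ (@cvg_cst _ _ _ _ _) h0).
by apply: nearW => n; rewrite normr_ge0 -rdotBl abs_rdot_le.
Qed.

(** Identities of this shape define adjoints and, later, weak derivatives; both are closed by this
    passage to the limit. *)
Lemma hcvg_dotl_eq (u u' : nat -> H) (l l' v w : H) : hcvg u l -> hcvg u' l' ->
  (forall n, dot (u n) v = dot (u' n) w) -> dot l v = dot l' w.
Proof.
have main (x y : H) x' y' s t : hcvg s x -> hcvg t x' ->
    (forall n, rdot (s n) y = rdot (t n) y') -> rdot x y = rdot x' y'.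
  move=> /(@hcvg_rdotr _ _ y) + /(@hcvg_rdotr _ _ y') + h.
  rewrite (_ : (fun n => rdot (s n) y) = fun n => rdot (t n) y'); last exact/funext.
  exact: cvg_unique.
move=> ul ul' h; apply: dot_ext; first by apply: main ul ul' _ => n; rewrite h.
by apply: main (hcvgZ 'i ul) (hcvgZ 'i ul') _ => n; rewrite !dotZl h.
Qed.

Lemma hcvg_uniq (u : nat -> H) l l' : hcvg u l -> hcvg u l' -> l = l'.
Proof.
move=> ul ul'; apply/eqP; rewrite -subr_eq0; apply/eqP/hnorm_eq0.
have := hcvg_norm (hcvgB ul ul').
rewrite (_ : (fun n => _) = fun=> 0); last first.
  by apply/funext => n; rewrite subrr hnorm0.
by move=> /(cvg_unique _ (@cvg_cst _ _ _ _ _)) <-.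
Qed.

Lemma hcvg_sub (u : nat -> H) l (phi : nat -> nat) : {homo phi : m n / (m < n)%N} ->
  hcvg u l -> hcvg (u \o phi) l.
Proof.
move=> hphi /hcvgP h; apply/hcvgP => e /h[N hN]; exists N => n Nn; apply: hN.
apply: leq_trans Nn _; elim: n => // n ih.
by apply: leq_ltn_trans ih _; exact: hphi.
Qed.

End InnerProduct.

(** * Closed relations and resolvents *)

Section Minimizer.
Context (R : realType) (H : lmodType R[i]) (dot : {dot H for @conjc R}).
Local Notation rdot u v := (complex.Re (dot u v)).
Local Notation hnorm := (hnorm dot).
Local Notation hcvg := (hcvg dot).

Definition closed_relation (G : set (H * H)) := forall (u v : nat -> H) l k,
  (forall n, G (u n, v n)) -> hcvg u l -> hcvg v k -> G (l, k).

Lemma lt_hnorm_sqr (u : H) (e : R) : 0 < e -> rdot u u < e ^+ 2 -> hnorm u < e.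
Proof.
move=> e0; rewrite -[hnorm u < e](@ltr_pXn2r _ 2)// ?nnegrE ?hnorm_ge0 ?(ltW e0)//.
by rewrite sqr_hnorm.
Qed.

Lemma le_hnorm_sqr (u : H) (e : R) : 0 <= e -> rdot u u <= e ^+ 2 -> hnorm u <= e.
Proof.
move=> e0; rewrite -[hnorm u <= e](@ler_pXn2r _ 2)// ?nnegrE ?hnorm_ge0//.
by rewrite sqr_hnorm.
Qed.

Lemma exists_invS_lt (e : R) : 0 < e -> exists N, forall n, (N <= n)%N -> n.+1%:R^-1 < e.
Proof.
move=> e0; have := @cvg_harmonic R => /cvgrPdist_lt/(_ e e0)[N _ hN].
exists N => n /hN /=; rewrite sub0r normrN ger0_norm//.
Qed.

Lemma quadratic_ge0_lin0 (c d : R) : 0 <= d ->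
  (forall t, 0 <= 2 * t * c + t ^+ 2 * d) -> c = 0.
Proof.
move=> d0 h; apply/eqP; rewrite -sqrf_eq0 eq_le sqr_ge0 andbT.
have d1 : d + 1 != 0 by rewrite gt_eqF// ltr_wpDl.
(* The minimum of the quadratic is at - c / d, but [d] may be 0; with [d + 1] the value is still
   negative unless [c] is 0. *)
have := h (- c / (d + 1)).
rewrite (_ : _ + _ = - (c ^+ 2 * (d + 2) / (d + 1) ^+ 2)); last by field.
rewrite oppr_ge0 pmulr_lle0; last by rewrite invr_gt0 exprn_gt0// ltr_wpDl.
by rewrite pmulr_lle0// ltr_wpDl.
Qed.

(* The distance from (f, 0) to G in H * H is attained. *)
Lemma closed_relation_minimizer (G : set (H * H)) (f : H) :
  hcomplete dot -> closed_relation G -> G 0 ->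
  (forall (c : R[i]) p q, G p -> G q -> G (c *: p + q)) ->
  exists u g, G (u, g) /\ forall v h, G (v, h) -> dot (u - f) v + dot g h = 0.
Proof.
move=> complH clG G0 GZD.
pose J (p : H * H) := rdot (p.1 - f) (p.1 - f) + rdot p.2 p.2.
have J0 p : 0 <= J p by rewrite addr_ge0 ?rdot_ge0.
pose S := [set J p | p in G].
have hS : has_inf S by split; [exists (J 0), 0|exists 0 => _ [p _ <-]].
pose m := inf S.
have mJ p : G p -> m <= J p by move=> Gp; apply: ge_inf; [exact: hS.2|exists p].
have [p hp] : {p : nat -> H * H & forall n, G (p n) /\ J (p n) < m + n.+1%:R^-1}.
  apply: (@boolp.choice _ _ (fun n q => G q /\ J q < m + n.+1%:R^-1)) => n.
  have /inf_adherent/(_ hS)[_ [p Gp <-] hp] : 0 < n.+1%:R^-1 :> R by [].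
  by exists p.
have Gp n : G (p n) by have [] := hp n.
(* Parallelogram identity: the midpoint of [p i] and [p j] lies in [G], so [J] is at least [m]
   there, and two almost minimal points must be close. *)
have para i j : rdot ((p i).1 - (p j).1) ((p i).1 - (p j).1) +
    rdot ((p i).2 - (p j).2) ((p i).2 - (p j).2) <=
    2 * i.+1%:R^-1 + 2 * j.+1%:R^-1.
  have /mJ : G (2^-1%:C *: (p i + p j)).
    have := GZD 2^-1%:C (p i + p j) 0; rewrite addr0; apply => //.
    by have := GZD 1 (p i) (p j); rewrite scale1r; apply.
  have [_] := hp i; have [_] := hp j; rewrite /J /=.
  move: (p i) (p j) => [a a'] [b b'] /=.
  rewrite (_ : 2^-1%:C *: (a + b) - f = 2^-1%:C *: ((a - f) + (b - f))); last first.
    rewrite addrACA [RHS]scalerDr -opprD -mulr2n -(scaler_nat 2 f) scalerN scalerA.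
    rewrite (_ : 2^-1%:C * 2 = 1) ?scale1r//.
    by apply/eqP; rewrite eq_complex /=; apply/andP; split; apply/eqP; field.
  rewrite (_ : a - b = (a - f) - (b - f)); last by rewrite opprB addrA subrK.
  move: (a - f) (b - f) => {}a {}b; rewrite !rdotE.
  rewrite (rdotC _ b a) (rdotC _ b' a').
  move: (i.+1%:R^-1) (j.+1%:R^-1) => x y; lra.
have small e : 0 < e -> exists N, forall i j, (N <= i)%N -> (N <= j)%N ->
    2 * i.+1%:R^-1 + 2 * j.+1%:R^-1 < e ^+ 2 :> R.
  move=> e0; have e4 : 0 < e ^+ 2 / 4 by rewrite divr_gt0// exprn_gt0.
  have [N hN] := exists_invS_lt e4; exists N => i j /hN hi /hN hj.
  by move: hi hj; move: (i.+1%:R^-1) (j.+1%:R^-1) => x y; lra.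
have [u hu] : exists l, hcvg (fun n => (p n).1) l.
  apply: complH => e e0; have [N hN] := small _ e0; exists N => i j Ni Nj.
  apply: lt_hnorm_sqr => //; apply: le_lt_trans (hN _ _ Ni Nj).
  by apply: le_trans (para i j); rewrite lerDl rdot_ge0.
have [g hg] : exists l, hcvg (fun n => (p n).2) l.
  apply: complH => e e0; have [N hN] := small _ e0; exists N => i j Ni Nj.
  apply: lt_hnorm_sqr => //; apply: le_lt_trans (hN _ _ Ni Nj).
  by apply: le_trans (para i j); rewrite lerDr rdot_ge0.
have Gug : G (u, g).
  by apply: clG hu hg => n; have := Gp n; case: (p n).
exists u, g; split => //.
have Jm : J (u, g) <= m.
  have cJ : J (p n) @[n --> \oo] --> J (u, g).
    rewrite /J /= -!sqr_hnorm.
    under eq_fun do rewrite -!sqr_hnorm.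
    apply: cvgD; rewrite !expr2; apply: cvgM; apply: hcvg_norm => //.
      by apply: hcvgB => //; exact: hcvg_cst.
    by apply: hcvgB => //; exact: hcvg_cst.
  have cm : m + n.+1%:R^-1 @[n --> \oo] --> m.
    by rewrite -[X in _ --> X]addr0; apply: cvgD; [exact: cvg_cst|exact: cvg_harmonic].
  rewrite -(cvg_lim _ cJ)// -(cvg_lim _ cm)//.
  apply: ler_lim; [by apply/cvg_ex; exists (J (u, g))|by apply/cvg_ex; exists m|].
  by apply: nearW => n; apply/ltW; have [] := hp n.
(* First variation of [J] along [t (v, h)] with [t] real. The imaginary part of the orthogonality
   relation comes from applying this to ['i *: (v, h)]. *)
have main v h : G (v, h) -> rdot (u - f) v + rdot g h = 0.
  move=> Gvh; apply: (@quadratic_ge0_lin0 _ (rdot v v + rdot h h)).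
    by rewrite addr_ge0 ?rdot_ge0.
  move=> t; have /mJ : G (t%:C *: (v, h) + (u, g)) by exact: GZD.
  move: Jm; rewrite /J /= -addrA.
  move: (u - f) => w; rewrite !rdotE (rdotC _ v w) (rdotC _ h g); lra.
move=> v h Gvh.
have Givh : G ('i *: (v, h)).
  by have := GZD 'i (v, h) 0 Gvh G0; rewrite addr0.
have := main _ _ Gvh; have := main _ _ Givh.
rewrite !dotZr -!(raddfD (@complex.Re R)) /= -mulrDr.
case: (dot _ _ + dot _ _) => x y /= h1 h2; apply/eqP.
by rewrite eq_complex /=; apply/andP; split; apply/eqP; lra.
Qed.

End Minimizer.

(** * Surjectivity, resolvents and self-adjointness *)

Section OperatorTheory.
Context (R : realType) (H : lmodType R[i]) (dot : {dot H for @conjc R}).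
Hypothesis complH : hcomplete dot.
Local Notation hnorm := (hnorm dot).
Local Notation hcvg := (hcvg dot).
Implicit Types (T : set (H * H)) (z : R[i]) (u v w f g : H).

Definition symmetric_operator T := forall u v u' v',
  T (u, v) -> T (u', v') -> dot v u' = dot u v'.

Lemma linopD T u v u' v' : linear_operator T -> T (u, v) -> T (u', v') ->
  T (u + u', v + v').
Proof. by move=> [_ TZD _] h h'; have := TZD 1 _ _ h h'; rewrite scale1r. Qed.

Lemma linopZ T c u v : linear_operator T -> T (u, v) -> T (c *: u, c *: v).
Proof. by move=> [T0 TZD _] h; have := TZD c _ _ h T0; rewrite addr0. Qed.

Lemma linopB T u v u' v' : linear_operator T -> T (u, v) -> T (u', v') ->
  T (u - u', v - v').
Proof.
by move=> lT h /(linopZ (-1) lT); rewrite !scaleN1r; exact: linopD.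
Qed.

Lemma closed_adjoint T : closed_relation dot (op_adjoint dot T).
Proof.
move=> u v l k huv ul vk a b Tab /=.
rewrite dotC [RHS]dotC; congr conjc.
apply: hcvg_dotl_eq ul vk _ => n; rewrite dotC [RHS]dotC; congr conjc.
exact: huv.
Qed.

Lemma subr_shift z u v u' v' :
  (v - v') - z *: (u - u') = (v - z *: u) - (v' - z *: u').
Proof.
by rewrite scalerBr !opprB addrACA [RHS]addrACA; congr (_ + _); rewrite addrC.
Qed.

Lemma resolventE T z f u :
  resolvent T z (f, u) <-> exists2 v, T (u, v) & f = v - z *: u.
Proof.
split=> [[v [w [Tuv [x xu wx] fvw]]]|[v Tuv ->]].
  by exists v => //; move: xu wx fvw; rewrite /op_id/= => -> -> ->; rewrite scaleNr.
exists v, (- z *: u); split => //=; last by rewrite scaleNr.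
by exists u.
Qed.

Lemma resolvent_setI T z (c : R) : linear_operator T ->
  (forall u v, T (u, v) -> hnorm u <= c * hnorm (v - z *: u)) ->
  (forall f, exists u v, T (u, v) /\ v - z *: u = f) -> resolvent_set dot T z.
Proof.
move=> lT bT oT; split.
- split.
  + by apply/resolventE; exists 0; [case: lT|rewrite scaler0 subrr].
  + move=> a [f u] [g w] /resolventE[v Tuv ->] /resolventE[v' Tuv' ->].
    apply/resolventE; exists (a *: v + v'); first by apply: linopD => //; exact: linopZ.
    by rewrite /= scalerBr scalerDr addrACA -opprD !scalerA mulrC.
  + move=> f u w /resolventE[v Tuv ->] /resolventE[v' Tuv' /esym/eqP].
    rewrite -subr_eq0 => /eqP h.
    have /bT := linopB lT Tuv' Tuv.
    rewrite subr_shift h.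
    rewrite hnorm0 mulr0 => hle; apply/eqP; rewrite eq_sym -subr_eq0; apply/eqP.
    by apply: (@hnorm_eq0 _ _ dot); apply/le_anti; rewrite hle hnorm_ge0.
- apply/seteqP; split => // f _; have [u [v [Tuv <-]]] := oT f.
  by exists u; apply/resolventE; exists v.
- by exists c => f u /resolventE[v Tuv ->]; exact: bT.
Qed.

Lemma resolvent_setE T z : resolvent_set dot T z -> exists2 c : R, 0 < c &
  forall u v, T (u, v) -> hnorm u <= c * hnorm (v - z *: u).
Proof.
move=> [_ _ [c hc]]; exists (`|c| + 1); first by rewrite ltr_wpDl.
move=> u v Tuv; apply: le_trans (hc (v - z *: u) u _) _.
  by apply/resolventE; exists v.
by rewrite ler_wpM2r ?hnorm_ge0// (le_trans (ler_norm _))// lerDl.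
Qed.

Lemma resolvent_set_onto T z f : resolvent_set dot T z ->
  exists u v, T (u, v) /\ v - z *: u = f.
Proof.
move=> [_ dT _]; have : op_dom (resolvent T z) f by rewrite dT.
by move=> [u /resolventE[v Tuv ->]]; exists u, v.
Qed.

(** The lower bound makes the range of T - z closed. Projecting [f] onto it leaves a residual
    orthogonal to the range, which is 0 by the last hypothesis. The projection is the minimizer
    lemma for the relation [G] that pairs each point of the range with 0. *)
Lemma bounded_below_onto T z (c : R) : linear_operator T -> closed_relation dot T ->
  (forall u v, T (u, v) -> hnorm u <= c * hnorm (v - z *: u)) ->
  (forall g, (forall u v, T (u, v) -> dot (v - z *: u) g = 0) -> g = 0) ->
  forall f, exists u v, T (u, v) /\ v - z *: u = f.
Proof.
move=> lT cT bT dT f.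
pose G := [set p : H * H | p.2 = 0 /\ exists u v, T (u, v) /\ p.1 = v - z *: u].
have [||c' [p p'] [q q'] /=|w [w' [[/= -> [u [v [Tuv ->]]]] hG]]] :=
    closed_relation_minimizer f complH (G := G).
- move=> s s' l l' Gn sl sl'.
  have {}Gn n : s' n = 0 /\ exists uv, T uv /\ s n = uv.2 - z *: uv.1.
    by have [/= -> [u [v Tuv]]] := Gn n; split=> //; exists (u, v).
  have -> : l' = 0.
    apply: hcvg_uniq sl' _; rewrite (_ : s' = fun=> 0); first exact: hcvg_cst.
    by apply/funext => n; have [] := Gn n.
  split => //=.
  have [t ht] := boolp.choice (fun n => (Gn n).2).
  pose c1 : R := `|c| + 1; have c10 : 0 < c1 by rewrite ltr_wpDl.
  have [u tu] : exists u, hcvg (fun n => (t n).1) u.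
    apply: complH => e e0; have ec : 0 < e / c1 by rewrite divr_gt0.
    have [N hN] := hcvg_cauchy sl ec.
    exists N => m n Nm Nn; have [Tm sm] := ht m; have [Tn sn] := ht n.
    have /bT : T ((t m).1 - (t n).1, (t m).2 - (t n).2).
      by apply: linopB => //; rewrite -surjective_pairing.
    rewrite subr_shift -sm -sn.
    move=> h; apply: le_lt_trans h _.
    have := hN _ _ Nm Nn; rewrite ltr_pdivlMr// [_ * c1]mulrC => h.
    apply: le_lt_trans h; rewrite ler_wpM2r ?hnorm_ge0//.
    by rewrite (le_trans (ler_norm _))// lerDl.
  exists u, (l + z *: u); split; last by rewrite addrK.
  apply: (cT (fun n => (t n).1) (fun n => s n + z *: (t n).1)).
  + move=> n; have [Tn ->] := ht n; rewrite subrK; by rewrite -surjective_pairing.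
  + exact: tu.
  + by apply: hcvgD => //; exact: hcvgZ.
- by split => //; exists 0, 0; split; [case: lT|rewrite /= scaler0 subrr].
- move=> [/= -> [u [v [Tuv ->]]]] [/= -> [u' [v' [Tuv' ->]]]].
  split => /=; first by rewrite scaler0 addr0.
  exists (c' *: u + u'), (c' *: v + v'); split.
    by apply: linopD => //; exact: linopZ.
  by rewrite scalerBr scalerDr addrACA -opprD !scalerA mulrC.
exists u, v; split => //; apply/eqP; rewrite -subr_eq0; apply/eqP/dT.
move=> u' v' Tuv'; rewrite dotC; have := hG (v' - z *: u') 0.
rewrite dot0l addr0 => ->; first exact: conjc0.
by split => //; exists u', v'.
Qed.

Lemma dot_eq0 g : (forall f, dot f g = 0) -> g = 0.
Proof. by move=> /(_ g) h; apply: (@hnorm_eq0 _ _ dot); rewrite /hnorm h sqrtr0. Qed.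

(** If (g, h) is in the adjoint, solve (T + M) u = h + M g: then g - u is orthogonal to the range of
    T + M, which is everything. For density, project [f] onto the closure [cl] of the domain and
    write the residual as (T + M) u; as it is orthogonal to the domain, u is orthogonal to the range
    of T + M, so u and the residual vanish. *)
Lemma symmetric_onto_self_adjoint T (M : R) : linear_operator T ->
  symmetric_operator T ->
  (forall f, exists u v, T (u, v) /\ v + M%:C *: u = f) -> self_adjoint dot T.
Proof.
move=> lT sT oT; split; last first.
  apply/seteqP; split => [[g h] gh|[g h] Tgh u v Tuv /=]; last exact: sT Tuv Tgh.
  have [u [v [Tuv uv]]] := oT (h + M%:C *: g).
  have gu : g = u.
    apply/eqP; rewrite -subr_eq0; apply/eqP/dot_eq0 => f.
    have [u' [v' [Tuv' <-]]] := oT f.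
    rewrite dotDr dotNr !dotDl !dotZl (gh _ _ Tuv') (sT _ _ _ _ Tuv' Tuv) /=.
    have := congr1 (dot u') uv; rewrite !dotDr !dotZr_real => hh.
    by rewrite -hh subrr.
  by move: uv; rewrite gu => /addIr <-.
move=> f e e0.
pose cl := [set w | forall e : R, 0 < e -> exists2 v, op_dom T v & hnorm (w - v) < e].
have clZD (c : R[i]) p q : cl p -> cl q -> cl (c *: p + q).
  move=> clp clq d d0; have c1 : 0 < Normc.normc c + 1.
    by rewrite ltr_wpDl//; case: c => ? ?; exact: sqrtr_ge0.
  have [|v [v' Tv] hv] := clp (d / 2 / (Normc.normc c + 1)).
    by rewrite !divr_gt0.
  have [|w [w' Tw] hw] := clq (d / 2); first by rewrite divr_gt0.
  exists (c *: v + w); first by exists (c *: v' + w'); apply: linopD => //; exact: linopZ.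
  rewrite opprD addrACA -scalerBr (le_lt_trans (le_hnormD _ _ _))// [ltRHS]splitr.
  rewrite ler_ltD// hnormZ; move: hv; rewrite ltr_pdivlMr// mulrC => /ltW.
  by apply: le_trans; rewrite ler_wpM2r ?hnorm_ge0// lerDl.
pose G := [set p : H * H | p.2 = 0 /\ cl p.1].
have [||c [p p'] [q q'] /=|w [w' [[/= -> clw] hG]]] :=
    closed_relation_minimizer f complH (G := G).
- move=> s s' l l' Gn sl sl'.
  have -> : l' = 0.
    apply: hcvg_uniq sl' _; rewrite (_ : s' = fun=> 0); first exact: hcvg_cst.
    by apply/funext => n; have [] := Gn n.
  split => //= d d0; have d2 : 0 < d / 2 by rewrite divr_gt0.
  have [N hN] := (hcvgP _ _ _).1 sl _ d2.
  have [_ /= /(_ _ d2)[v Tv hv]] := Gn N; exists v => //.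
  rewrite -(subrKA (s N)) (le_lt_trans (le_hnormD _ _ _))// [ltRHS]splitr ltrD//.
  by rewrite hnormBC hN.
- split => // d d0; exists 0; first by exists 0; case: lT.
  by rewrite subrr hnorm0.
- move=> [/= -> clp] [/= -> clq].
  by split => /=; [rewrite scaler0 addr0|exact: clZD].
suff wf : w = f by rewrite -wf; exact: clw.
have Tcl u v : T (u, v) -> cl u.
  by move=> Tuv d d0; exists u; [exists v|rewrite subrr hnorm0].
have ort u v : T (u, v) -> dot (w - f) u = 0.
  move=> Tuv; have := hG u 0; rewrite dot0l addr0 => -> //.
  by split => //; exact: Tcl Tuv.
have [u [v [Tuv uv]]] := oT (w - f).
have u0 : u = 0.
  apply: dot_eq0 => g; have [u' [v' [Tuv' <-]]] := oT g.
  rewrite dotDl dotZl (sT _ _ _ _ Tuv' Tuv).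
  have := ort _ _ Tuv'; rewrite -uv => h.
  by rewrite -dotZr_real -dotDr dotC h conjc0.
move: uv; rewrite u0 scaler0 addr0 => v_eq.
apply/eqP; rewrite -subr_eq0 -v_eq; apply/eqP.
by have [T0 _ Tf] := lT; apply: Tf T0; rewrite -[X in T (X, _)]u0.
Qed.

End OperatorTheory.

(** * Relatively compact perturbations *)

Section Perturbation.
Context (R : realType) (H : lmodType R[i]) (dot : {dot H for @conjc R}).
Hypothesis complH : hcomplete dot.
Local Notation rdot u v := (complex.Re (dot u v)).
Local Notation hnorm := (hnorm dot).
Local Notation hcvg := (hcvg dot).
Implicit Types (T : set (H * H)) (z : R[i]) (u v w f g : H).

Lemma symmetric_rdot T u v u' v' : symmetric_operator dot T ->
  T (u, v) -> T (u', v') -> rdot v u' = rdot u v'.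
Proof. by move=> sT Tuv Tuv'; rewrite (sT _ _ _ _ Tuv Tuv'). Qed.

Lemma symmetric_dot_real T u v : symmetric_operator dot T -> T (u, v) ->
  dot v u = (rdot v u)%:C.
Proof.
move=> sT Tuv; have := sT _ _ _ _ Tuv Tuv; rewrite [RHS]dotC.
case: (dot v u) => a b [] /= h; apply/eqP; rewrite eq_complex/= eqxx/=.
by apply/eqP; lra.
Qed.

Lemma symmetric_sqr_shift T z u v : symmetric_operator dot T -> T (u, v) ->
  rdot (v - z *: u) (v - z *: u) = rdot v v - 2 * complex.Re z * rdot v u
    + (complex.Re z ^+ 2 + complex.Im z ^+ 2) * rdot u u.
Proof.
move=> sT Tuv; rewrite rdotBl 2!rdotBr.
rewrite (rdotC _ (z *: u) v) dotZl !dotZr (symmetric_dot_real sT Tuv).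
by case: z => a b; rewrite (dotuu _ u) /=; ring.
Qed.

(** By symmetry |v - z u|^2 = |v - (Re z) u|^2 + (Im z)^2 |u|^2. *)
Lemma symmetric_le_Im T z u v : symmetric_operator dot T -> T (u, v) ->
  `|complex.Im z| * hnorm u <= hnorm (v - z *: u).
Proof.
move=> sT Tuv; rewrite -[_ <= hnorm _](@ler_pXn2r _ 2)// ?nnegrE ?mulr_ge0 ?hnorm_ge0//.
rewrite exprMn real_normK ?num_real// !sqr_hnorm (symmetric_sqr_shift z sT Tuv).
have := rdot_ge0 dot (v - (complex.Re z)%:C *: u).
by rewrite (symmetric_sqr_shift _ sT Tuv)/=; lra.
Qed.

Lemma symmetric_eigenvalue_real T z u : symmetric_operator dot T ->
  T (u, z *: u) -> u != 0 -> complex.Im z = 0.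
Proof.
move=> sT Tu u0; have := symmetric_le_Im z sT Tu.
rewrite subrr hnorm0 pmulr_lle0; last exact: hnorm_gt0.
by rewrite normr_le0 => /eqP.
Qed.

Lemma self_adjoint_closed T : self_adjoint dot T -> closed_relation dot T.
Proof. by move=> [_ <-]; exact: closed_adjoint. Qed.

Lemma self_adjoint_onto T z (c : R) : linear_operator T -> self_adjoint dot T ->
  (forall u v, T (u, v) -> hnorm u <= c * hnorm (v - z *: u)) ->
  (forall g, T (g, z^* *: g) -> g = 0) ->
  forall f, exists u v, T (u, v) /\ v - z *: u = f.
Proof.
move=> lT saT bT kT; apply: bounded_below_onto bT _ => //.
  exact: self_adjoint_closed.
move=> g gT; apply: kT; have [_ <-] := saT => u v Tuv /=.
have := gT _ _ Tuv; rewrite dotDl dotNl dotZl => /eqP; rewrite subr_eq0 => /eqP ->.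
by rewrite dotZr_conj.
Qed.

Lemma not_ge0cE z : ~~ (0 <= z) -> complex.Im z != 0 \/ complex.Re z < 0.
Proof. by rewrite lecE negb_and -ltNge => /orP[|]; [left|right]. Qed.

(** Off the real axis the constant is 1 / |Im z|. For Re z < 0 it is - 1 / Re z, because the cross
    term - 2 (Re z) <v, u> in |v - z u|^2 is nonnegative. *)
Lemma nonneg_bounded_below T z : symmetric_operator dot T ->
  (forall u v, T (u, v) -> 0 <= rdot v u) -> ~~ (0 <= z) ->
  exists2 c : R, 0 < c &
    forall u v, T (u, v) -> hnorm u <= c * hnorm (v - z *: u).
Proof.
move=> sT T0 /not_ge0cE[z0|z0].
  exists `|complex.Im z|^-1; first by rewrite invr_gt0 normr_gt0.
  move=> u v Tuv; rewrite mulrC ler_pdivlMr ?normr_gt0// mulrC.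
  exact: symmetric_le_Im Tuv.
exists (- complex.Re z)^-1; first by rewrite invr_gt0 oppr_gt0.
move=> u v Tuv; rewrite mulrC ler_pdivlMr ?oppr_gt0// mulrC.
rewrite -[_ <= hnorm _](@ler_pXn2r _ 2)// ?nnegrE ?mulr_ge0 ?hnorm_ge0 ?oppr_ge0 ?(ltW z0)//.
rewrite exprMn sqrrN !sqr_hnorm (symmetric_sqr_shift z sT Tuv).
have h1 := T0 _ _ Tuv; have h2 := rdot_ge0 dot v; have h3 := rdot_ge0 dot u.
have : 0 <= - complex.Re z * rdot v u by rewrite mulr_ge0// oppr_ge0 ltW.
have : 0 <= complex.Im z ^+ 2 * rdot u u by rewrite mulr_ge0// sqr_ge0.
lra.
Qed.

Lemma linear_op_comp (S T : set (H * H)) :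
  linear_operator S -> linear_operator T -> linear_operator (op_comp S T).
Proof.
move=> lS lT; split.
- by exists 0; [case: lT|case: lS].
- move=> a [u v] [u' v'] [x /= Tx Sx] [x' /= Tx' Sx'].
  by exists (a *: x + x'); apply: linopD => //; exact: linopZ.
- move=> u v w [x /= Tx Sx] [x' /= Tx' Sx'].
  by case: lT lS => _ _ fT [_ _ fS]; move: Sx'; rewrite (fT _ _ _ Tx' Tx) => /(fS _ _ _ Sx).
Qed.

(** Each vector of [s] cuts out a subspace of codimension at most one, so induction on [s] yields at
    most one generator per vector. Contrapositively, an infinite-dimensional [E] contains nonzero
    vectors orthogonal to any finite list. *)
Lemma finite_dimensional_of_ortho (E : set H) (s : seq H) :
  (forall (c : R[i]) u v, E u -> E v -> E (c *: u + v)) ->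
  (forall u, E u -> {in s, forall x, dot u x = 0} -> u = 0) -> finite_dimensional E.
Proof.
elim: s E => [|x s ih] E EZD Es.
  exists [::] => u Eu; exists (fun=> 0); rewrite big_ord0.
  by apply: Es Eu _ => ?; rewrite inE.
pose E' := [set u | E u /\ dot u x = 0].
have [t ht] : finite_dimensional E'.
  apply: ih => [c u v [Eu ux] [Ev vx]|u [Eu ux] us].
    by split; [exact: EZD|rewrite dotDl dotZl ux vx mulr0 addr0].
  by apply: Es => // y; rewrite inE => /predU1P[->|/us].
have [[e [Ee ex]]|ne] := pselect (exists e, E e /\ dot e x != 0); last first.
  exists t => u Eu; apply: ht; split => //; apply: contrapT => /eqP ux.
  by apply: ne; exists u.
exists (e :: t) => u Eu; set a := dot u x / dot e x.
have [|c hc] := ht (- a *: e + u).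
  split; first exact: EZD.
  by rewrite dotDl dotZl /a mulNr divfK// addNr.
exists (fun i => if unlift ord0 i is Some j then c j else a).
rewrite big_ord_recl /= unlift_none.
under eq_bigr => i _ do rewrite liftK.
by rewrite -hc addrA scaleNr subrr add0r.
Qed.

(** [V_bnd] controls |V u|^2 by the quadratic form of [A] and not by |A u|^2. This is what makes the
    [A]-bound of [V] zero and bounds the form of A + alpha V from below. [A_onto], the surjectivity
    of A + 1, yields the self-adjointness of [A]. *)
Variables A V : set (H * H).
Hypothesis lA : linear_operator A.
Hypothesis sA : symmetric_operator dot A.
Hypothesis A_ge0 : forall u v, A (u, v) -> 0 <= rdot v u.
Hypothesis A_onto : forall f, exists u v, A (u, v) /\ v + 1%:C *: u = f.
Hypothesis lV : linear_operator V.
Hypothesis sV : symmetric_operator dot V.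
Hypothesis domV : forall u v, A (u, v) -> exists w, V (u, w).
Variable K : R.
Hypothesis K_gt0 : 0 < K.
Hypothesis V_bnd : forall u v w, A (u, v) -> V (u, w) ->
  rdot w w <= K * (rdot u u + rdot v u).
Hypothesis V_cpt : forall u v w : nat -> H,
  (forall n, A (u n, v n)) -> (forall n, V (u n, w n)) ->
  (exists c, forall n, hnorm (u n) <= c /\ hnorm (v n) <= c) ->
  exists (phi : nat -> nat) l, {homo phi : m n / (m < n)%N} /\ hcvg (w \o phi) l.

Lemma A_self_adjoint : self_adjoint dot A.
Proof. exact: symmetric_onto_self_adjoint A_onto. Qed.

Lemma A_shift_onto z f : ~~ (0 <= z) -> exists u v, A (u, v) /\ v - z *: u = f.
Proof.
move=> z0; have [c _ hc] := nonneg_bounded_below sA A_ge0 z0.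
apply: self_adjoint_onto hc _ _ => //; first exact: A_self_adjoint.
move=> g Ag; apply: contrapT => /eqP g0; move/negP: z0; apply.
(* An eigenvector for the conjugate of [z] makes [z] real, and then nonnegative because the form of
   [A] is. *)
have z0' := symmetric_eigenvalue_real sA Ag g0.
have : 0 <= rdot (z^* *: g) g by exact: A_ge0.
rewrite lecE dotZl dotuu; move: z0'; case: z Ag => a b Ag /= b0.
rewrite mulr0 subr0 => h; apply/andP; split.
  by apply/eqP; lra.
by move: h; rewrite pmulr_lge0// -sqr_hnorm exprn_gt0// hnorm_gt0.
Qed.

(** The bounded resolvent turns a bounded sequence into one bounded in the graph norm of [A], to
    which [V_cpt] applies. *)
Lemma compact_op_comp_resolvent z : resolvent_set dot A z ->
  compact_operator dot (op_comp V (resolvent A z)).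
Proof.
move=> rz; have [c c0 hc] := resolvent_setE rz; split.
- by apply: linear_op_comp => //; case: rz.
- apply/seteqP; split => // f _; have [u [v [Auv uv]]] := resolvent_set_onto f rz.
  have [w Vuw] := domV Auv; exists w, u => //.
  by apply/resolventE; exists v.
- move=> f w hfw [b hb].
  have {hfw} /boolp.choice[t ht] : forall n, exists p : H * H,
      A p /\ f n = p.2 - z *: p.1 /\ V (p.1, w n).
    move=> n; have [u /resolventE[v Auv fuv] Vuw] := hfw n.
    by exists (u, v).
  have bu n : hnorm (t n).1 <= c * b.
    have [At [fn _]] := ht n.
    have /hc : A ((t n).1, (t n).2) by rewrite -surjective_pairing.
    rewrite -fn => /le_trans; apply; exact: ler_wpM2l (ltW c0) _ _ (hb n).
  have := @V_cpt (fun n => (t n).1) (fun n => (t n).2) w; apply.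
  + by move=> n; have [At _] := ht n; rewrite -surjective_pairing.
  + by move=> n; have [_ []] := ht n.
  + exists (c * b + (b + Normc.normc z * (c * b))) => n.
    have nz : 0 <= Normc.normc z by case: z {rz hc ht} => ? ?; exact: sqrtr_ge0.
    have b0 : 0 <= b by rewrite (le_trans _ (hb n))// hnorm_ge0.
    have cb0 : 0 <= c * b by rewrite mulr_ge0// ltW.
    split; first by rewrite (le_trans (bu n))// lerDl addr_ge0// mulr_ge0.
    have [_ [fn _]] := ht n.
    rewrite -[(t n).2](subrK (z *: (t n).1)) -fn.
    rewrite (le_trans (le_hnormD _ _ _))// ler_wpDl// lerD// hnormZ.
    exact: ler_wpM2l.
Qed.

(** * The operator A + alpha V and its spectrum *)

Section Perturbed.
Variable alpha : R.
Let T := op_add A (op_scale alpha%:C V).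

Lemma perturbedE u y : T (u, y) <->
  exists v w, [/\ A (u, v), V (u, w) & y = v + alpha%:C *: w].
Proof.
split=> [[v [w [Auv [x /= Vux ->] /= ->]]]|[v [w [Auv Vuw ->]]]].
  by exists v, x.
by exists v, (alpha%:C *: w); split => //; exists w.
Qed.

Lemma dom_perturbed : op_dom T = op_dom A.
Proof.
apply/seteqP; split => [u [y /perturbedE[v [w [Auv _ _]]]]|u [v Auv]].
  by exists v.
have [w Vuw] := domV Auv.
by exists (v + alpha%:C *: w); apply/perturbedE; exists v, w.
Qed.

Lemma linear_perturbed : linear_operator T.
Proof.
split.
- by apply/perturbedE; exists 0, 0; split; [case: lA|case: lV|rewrite scaler0 addr0].
- move=> c [u y] [u' y'] /perturbedE[v [w [Auv Vuw ->]]].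
  move=> /perturbedE[v' [w' [Auv' Vuw' ->]]]; apply/perturbedE.
  exists (c *: v + v'), (c *: w + w'); split.
  + by apply: linopD => //; exact: linopZ.
  + by apply: linopD => //; exact: linopZ.
  + by rewrite /= !scalerDr addrACA !scalerA [c * _]mulrC.
- move=> u y y' /perturbedE[v [w [Auv Vuw ->]]].
  move=> /perturbedE[v' [w' [Auv' Vuw' ->]]].
  by case: lA lV => _ _ fA [_ _ fV]; rewrite (fA _ _ _ Auv Auv') (fV _ _ _ Vuw Vuw').
Qed.

Lemma symmetric_perturbed : symmetric_operator dot T.
Proof.
move=> u y u' y' /perturbedE[v [w [Auv Vuw ->]]] /perturbedE[v' [w' [Auv' Vuw' ->]]].
by rewrite dotDl dotDr dotZl dotZr_real (sA Auv Auv') (sV Vuw Vuw').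
Qed.

(* V has A-bound zero. *)
Lemma relative_bound : exists2 M : R, 0 < M & forall u v w, A (u, v) -> V (u, w) ->
  hnorm (alpha%:C *: w) <= hnorm (v - (- M)%:C *: u) / 2.
Proof.
have L0 : 0 <= 4 * alpha ^+ 2 * K.
  by rewrite mulr_ge0 ?(ltW K_gt0)// mulr_ge0// sqr_ge0.
have M0 : 0 < 4 * alpha ^+ 2 * K + 1 by rewrite ltr_wpDl.
(* With this [M], alpha^2 |w|^2 is at most (M - 1) (|u|^2 + <v, u>) / 4, and the terms M^2 |u|^2 + 2
   M <v, u> of |v + M u|^2 absorb it because M >= 1. *)
exists (4 * alpha ^+ 2 * K + 1) => // u v w Auv Vuw; set M := _ + 1.
rewrite -[_ <= _ / 2](@ler_pXn2r _ 2)// ?nnegrE ?divr_ge0 ?hnorm_ge0//.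
rewrite exprMn !sqr_hnorm (symmetric_sqr_shift _ sA Auv) rdotZl rdotZr/=.
have := V_bnd Auv Vuw; have := A_ge0 Auv.
have := rdot_ge0 dot u; have := rdot_ge0 dot v.
move: (rdot _ _) (rdot _ _) (rdot v u) (rdot w w) => a b r d b0 a0 r0 dK.
have h1 : alpha ^+ 2 * d <= alpha ^+ 2 * (K * (a + r)).
  by rewrite ler_wpM2l// sqr_ge0.
have h2 : 0 <= M * (a + r) by rewrite mulr_ge0 ?addr_ge0// ltW.
have h3 : 0 <= (M - 1) * (M * a).
  by rewrite /M addrK mulr_ge0// mulr_ge0// ltW.
have h4 : alpha ^+ 2 * (K * (a + r)) = (M - 1) * (a + r) / 4 by rewrite /M; field.
have h5 : 0 <= M * r by rewrite mulr_ge0// ltW.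
rewrite h4 in h1; clearbody M; clear h4.
lra.
Qed.

(** The perturbation costs at most half of |(A + M) u|, so (A + alpha V + M) u controls (A + M) u
    with the factor 2. Closedness, surjectivity and compactness are carried over from [A] to the
    perturbed operator by this estimate. *)
Lemma perturbed_control : exists2 M : R, 0 < M & forall u v w, A (u, v) -> V (u, w) ->
  hnorm (alpha%:C *: w) <= hnorm (v - (- M)%:C *: u) / 2 /\
  hnorm (v - (- M)%:C *: u) <= 2 * hnorm (v + alpha%:C *: w - (- M)%:C *: u).
Proof.
have [M M0 hM] := relative_bound; exists M => // u v w Auv Vuw.
have h := hM _ _ _ Auv Vuw; split => //.
have := le_hnormB dot (v + alpha%:C *: w - (- M)%:C *: u) (alpha%:C *: w).
rewrite (_ : _ - alpha%:C *: w = v - (- M)%:C *: u); last by rewrite addrAC addrK.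
lra.
Qed.

(** The control estimate, applied to differences, makes (A + M) u_n a Cauchy sequence; then [A] is
    closed, and alpha V u_n converges by the same estimate applied to u_n - l. *)
Lemma closed_perturbed : closed_relation dot T.
Proof.
have [M M0 hM] := perturbed_control.
move=> u y l k uy ul yk.
have /boolp.choice[t ht] : forall n, exists p : H * H,
    [/\ A (u n, p.1), V (u n, p.2) & y n = p.1 + alpha%:C *: p.2].
  by move=> n; have /perturbedE[v [w [Auv Vuw ->]]] := uy n; exists (v, w).
have cz : hcvg (fun n => y n - (- M)%:C *: u n) (k - (- M)%:C *: l).
  by apply: hcvgB => //; exact: hcvgZ.
have [x tx] : exists x, hcvg (fun n => (t n).1 - (- M)%:C *: u n) x.
  apply: complH => e e0; have e2 : 0 < e / 2 by rewrite divr_gt0.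
  have [N hN] := hcvg_cauchy cz e2; exists N => m n Nm Nn.
  have [Am Vm ym] := ht m; have [An Vn yn] := ht n.
  have [_] := hM _ _ _ (linopB lA Am An) (linopB lV Vm Vn).
  rewrite [alpha%:C *: _]scalerBr addrACA -opprD -ym -yn !subr_shift => /le_lt_trans; apply.
  by have := hN _ _ Nm Nn; rewrite ltr_pdivlMr// mulrC.
pose v := x + (- M)%:C *: l.
have tv : hcvg (fun n => (t n).1) v.
  have := hcvgD tx (hcvgZ (- M)%:C ul).
  by under [X in hcvg X]eq_fun do rewrite subrK.
have Alv : A (l, v).
  apply: (self_adjoint_closed A_self_adjoint) ul tv => n.
  by have [] := ht n.
have [w Vlw] := domV Alv.
apply/perturbedE; exists v, w; split => //.
have tw : hcvg (fun n => alpha%:C *: (t n).2) (alpha%:C *: w).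
  apply: (@hcvg_squeeze _ _ _ _ _
    (fun n => hnorm ((t n).1 - (- M)%:C *: u n - x) / 2)).
    move=> n; rewrite -scalerBr; have [An Vn _] := ht n.
    have [+ _] := hM _ _ _ (linopB lA An Alv) (linopB lV Vn Vlw).
    by rewrite subr_shift /v addrK.
  by rewrite -[X in _ --> X](mul0r 2^-1); apply: cvgM => //; exact: cvg_cst.
apply: hcvg_uniq yk _; have := hcvgD tv tw.
by rewrite (_ : (fun n => _) = y)//; apply/funext => n; have [_ _ ->] := ht n.
Qed.

Lemma perturbed_self_adjoint : self_adjoint dot T.
Proof.
have [M M0 hM] := perturbed_control.
have M_neg : ~~ (0 <= (- M)%:C) by rewrite lecR oppr_ge0 -ltNge.
have [c c0 hc] := nonneg_bounded_below sA A_ge0 M_neg.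
apply: (@symmetric_onto_self_adjoint _ _ _ complH _ M).
- exact: linear_perturbed.
- exact: symmetric_perturbed.
move=> f; have [||g gT|u [y [Tuy uy]]] :=
    @bounded_below_onto _ _ _ complH T (- M)%:C (c * 2) linear_perturbed _ _ _ f.
- exact: closed_perturbed.
- move=> u y /perturbedE[v [w [Auv Vuw ->]]].
  apply: le_trans (hc _ _ Auv) _; rewrite -mulrA ler_wpM2l ?(ltW c0)//.
  by have [] := hM _ _ _ Auv Vuw.
(* Let [g] be orthogonal to the range of T + M and solve (A + M) u = g. Then 0 = |g|^2 + Re <alpha V
   u, g> with |alpha V u| <= |g| / 2, which forces g = 0. *)
- have [u [v [Auv uv]]] := A_shift_onto g M_neg.
  have [w Vuw] := domV Auv; have [+ _] := hM _ _ _ Auv Vuw; rewrite uv => h1.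
  have : T (u, v + alpha%:C *: w) by apply/perturbedE; exists v, w.
  move=> /gT; rewrite addrAC uv dotDl => /(congr1 (@complex.Re R)).
  rewrite raddfD /= -sqr_hnorm => h2.
  have := abs_rdot_le dot (alpha%:C *: w) g; rewrite ler_norml => /andP[h3 _].
  apply: (@hnorm_eq0 _ _ dot); apply/eqP; rewrite -sqrf_eq0 eq_le sqr_ge0 andbT.
  have : hnorm (alpha%:C *: w) * hnorm g <= hnorm g / 2 * hnorm g.
    by rewrite ler_wpM2r ?hnorm_ge0.
  move: (hnorm (alpha%:C *: w) * _) h3 => q h3 h4; nra.
exists u, y; split => //; rewrite -uy; congr (_ + _).
by rewrite rmorphN scaleNr opprK.
Qed.

Lemma normc_ge0 (c : R[i]) : 0 <= Normc.normc c.
Proof. by case: c => a b; exact: sqrtr_ge0. Qed.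

Lemma normalize (u : H) : u != 0 -> hnorm ((hnorm u)^-1%:C *: u) = 1.
Proof.
move=> u0; have n0 := hnorm_gt0 dot u0.
by rewrite hnormZr ger0_norm ?invr_ge0 ?(ltW n0)// mulVf// gt_eqF.
Qed.

(** Along a subsequence V u_n converges, hence so does (A - z) u_n = (T - z) u_n - alpha V u_n. As A
    - z is bounded below off [0, +oo), the u_n form a Cauchy sequence. The three finiteness
    properties of the spectrum off [0, +oo) all rest on this. *)
Lemma perturbed_precompact z (u y : nat -> H) : ~~ (0 <= z) ->
  (forall n, T (u n, y n)) ->
  (exists c, forall n, hnorm (u n) <= c /\ hnorm (y n) <= c) ->
  hcvg (fun n => y n - z *: u n) 0 ->
  exists (phi : nat -> nat) l, {homo phi : m n / (m < n)%N} /\ hcvg (u \o phi) l.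
Proof.
move=> z0 Tuy [b hb] yz.
have [M M0 hM] := perturbed_control.
have [c c0 hc] := nonneg_bounded_below sA A_ge0 z0.
have /boolp.choice[t ht] : forall n, exists p : H * H,
    [/\ A (u n, p.1), V (u n, p.2) & y n = p.1 + alpha%:C *: p.2].
  by move=> n; have /perturbedE[v [w [Auv Vuw ->]]] := Tuy n; exists (v, w).
have [|||phi [l [hphi wl]]] := @V_cpt u (fun n => (t n).1) (fun n => (t n).2).
- by move=> n; have [] := ht n.
- by move=> n; have [] := ht n.
- exists (2 * (b + M * b) + M * b) => n.
  have b0 : 0 <= b by rewrite (le_trans (hnorm_ge0 dot (u n)))//; have [] := hb n.
  have Mb0 : 0 <= M * b by rewrite mulr_ge0// ltW.
  have [hu hy] := hb n; split; first by lra.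
  have [An Vn yn] := ht n; have [_] := hM _ _ _ An Vn; rewrite -yn.
  have hMu : hnorm ((- M)%:C *: u n) <= M * b.
    by rewrite hnormZr normrN gtr0_norm// ler_pM2l.
  have := le_hnormB dot (y n) ((- M)%:C *: u n).
  have := le_hnormD dot ((t n).1 - (- M)%:C *: u n) ((- M)%:C *: u n).
  by rewrite subrK; lra.
exists phi.
have cx : hcvg (fun n => (t (phi n)).1 - z *: u (phi n)) (0 - alpha%:C *: l).
  have := hcvgB (hcvg_sub hphi yz) (hcvgZ alpha%:C wl).
  congr hcvg; apply/funext => n /=; have [_ _ ->] := ht (phi n).
  by rewrite addrAC addrK.
have [x ux] : exists x, hcvg (u \o phi) x.
  apply: complH => e e0; have ec : 0 < e / c by rewrite divr_gt0.
  have [N hN] := hcvg_cauchy cx ec; exists N => m n Nm Nn /=.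
  have [Am _ _] := ht (phi m); have [An _ _] := ht (phi n).
  have := hc _ _ (linopB lA Am An); rewrite subr_shift => /le_lt_trans; apply.
  by have := hN _ _ Nm Nn; rewrite ltr_pdivlMr// mulrC.
by exists x.
Qed.

(** If T - z were not bounded below, unit vectors u_n with (T - z) u_n -> 0 would accumulate at a
    unit eigenvector. So without eigenvectors T - z is bounded below, and self-adjointness makes it
    onto: [z] is then in the resolvent set. *)
Lemma eigenvalue_of_spectrum z : ~~ (0 <= z) -> spectrum dot T z ->
  complex.Im z = 0 /\ exists2 u, hnorm u = 1 & T (u, z *: u).
Proof.
move=> z0 sz; have lT := linear_perturbed; have sT := symmetric_perturbed.
suff [u u0 Tu] : exists2 u, u != 0 & T (u, z *: u).
  split; first exact: symmetric_eigenvalue_real sT Tu u0.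
  exists ((hnorm u)^-1%:C *: u); first exact: normalize.
  by rewrite scalerA mulrC -scalerA; exact: linopZ.
apply: contrapT => neig.
have keig u : T (u, z *: u) -> u = 0.
  by move=> Tu; apply: contrapT => /eqP u0; apply: neig; exists u.
have saT := perturbed_self_adjoint.
have [c hc] : exists c, forall u v, T (u, v) -> hnorm u <= c * hnorm (v - z *: u).
  apply: contrapT => nc.
  have /boolp.choice[t ht] : forall n : nat, exists p : H * H,
      [/\ T p, hnorm p.1 = 1 & hnorm (p.2 - z *: p.1) <= n.+1%:R^-1].
    move=> n; apply: contrapT => np; apply: nc; exists n.+1%:R => u v Tuv.
    have [->|u0] := eqVneq u 0; first by rewrite hnorm0 mulr_ge0// hnorm_ge0.
    have n0 := hnorm_gt0 dot u0.
    rewrite leNgt; apply/negP => huv; apply: np.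
    exists ((hnorm u)^-1%:C *: u, (hnorm u)^-1%:C *: v); split => /=.
    + exact: linopZ.
    + exact: normalize.
    + rewrite scalerA mulrC -scalerA -scalerBr hnormZr ger0_norm ?invr_ge0 ?(ltW n0)//.
      rewrite mulrC ler_pdivrMr// mulrC ler_pdivlMr//.
      by rewrite mulrC ltW.
  have cz : hcvg (fun n => (t n).2 - z *: (t n).1) 0.
    apply: hcvg_squeeze (@cvg_harmonic R) => n.
    by rewrite subr0; have [] := ht n.
  have [|||phi [l [hphi ul]]] :=
    @perturbed_precompact z (fun n => (t n).1) (fun n => (t n).2) z0.
  - by move=> n; have [+ _ _] := ht n; rewrite -surjective_pairing.
  - exists (1 + Normc.normc z) => n; have [_ t1 tz] := ht n.
    rewrite t1 lerDl normc_ge0; split => //.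
    rewrite -[(t n).2](subrK (z *: (t n).1)).
    rewrite (le_trans (le_hnormD _ _ _))// lerD//; last by rewrite hnormZ t1 mulr1.
    by rewrite (le_trans tz)// invf_le1// ler1n.
  - exact: cz.
  have nl : hnorm l = 1.
    have := hcvg_norm ul; rewrite (_ : (fun n => _) = fun=> 1).
      by move=> /(cvg_unique _ (@cvg_cst _ _ _ _ _)) <-.
    by apply/funext => n /=; have [] := ht (phi n).
  have Tl : T (l, z *: l).
    apply: (closed_perturbed (v := fun n => (t (phi n)).2)) (ul) _; last first.
      have := hcvgD (hcvg_sub hphi cz) (hcvgZ z ul); rewrite add0r.
      by under [X in hcvg X]eq_fun do rewrite /= subrK.
    by move=> n /=; have [+ _ _] := ht (phi n); rewrite -surjective_pairing.
  by have := keig _ Tl => l0; move: nl; rewrite l0 hnorm0 => /eqP; rewrite eq_sym oner_eq0.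
apply: sz; apply: resolvent_setI (hc) _ => //.
apply: self_adjoint_onto (hc) _ => // g Tg.
have [//|g0] := eqVneq g 0.
(* A nonzero [g] in the kernel for the conjugate of [z] makes [z] real, so [g] is an eigenvector for
   [z] itself. *)
have zr : z^*%R = z.
  have := symmetric_eigenvalue_real sT Tg g0; case: (z) => a b /= b0.
  by congr Complex; rewrite b0; lra.
by move: Tg; rewrite zr => /keig.
Qed.

(** Otherwise the eigenspace contains an orthonormal sequence, which would have a convergent
    subsequence although its terms are at mutual distance sqrt 2. *)
Lemma finite_dimensional_perturbed_eigenspace z : ~~ (0 <= z) ->
  finite_dimensional (Defs.eigenspace T z).
Proof.
move=> z0; have lT := linear_perturbed; apply: contrapT => nfin.
pose E := Defs.eigenspace T z.
have EZD (c : R[i]) u v : E u -> E v -> E (c *: u + v).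
  rewrite /E /Defs.eigenspace /= => Tu Tv.
  rewrite scalerDr scalerA mulrC -scalerA.
  by apply: linopD => //; exact: linopZ.
have step (s : seq H) : exists u, [/\ E u, hnorm u = 1 & {in s, forall x, dot u x = 0}].
  apply: contrapT => ne; apply: nfin.
  apply: (finite_dimensional_of_ortho EZD (s := s)) => u Eu us.
  apply: contrapT => /eqP u0; apply: ne.
  exists ((hnorm u)^-1%:C *: u); split; last 2 first.
  - exact: normalize.
  - by move=> x xs; rewrite dotZl us// mulr0.
  - have := EZD (hnorm u)^-1%:C u 0 Eu; rewrite addr0; apply.
    by rewrite /E /Defs.eigenspace /= scaler0; case: lT.
have [next hnext] := boolp.choice step.
(* [L n] lists the first [n] chosen vectors; [next] returns a unit eigenvector orthogonal to all
   members of the list. *)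
pose fix L n := if n is n.+1 then next (L n) :: L n else [::].
pose u n := next (L n).
have uL m n : (m < n)%N -> u m \in L n.
  elim: n => // n ih; rewrite ltnS leq_eqVlt => /predU1P[->|/ih h] /=.
    by rewrite inE eqxx.
  by rewrite inE h orbT.
have Eu n : T (u n, z *: u n) by have [] := hnext (L n).
have nu n : hnorm (u n) = 1 by have [] := hnext (L n).
have ou m n : (m < n)%N -> dot (u n) (u m) = 0.
  by move=> mn; have [_ _] := hnext (L n); apply; exact: uL.
have [||phi [l [hphi ul]]] := @perturbed_precompact z u (fun n => z *: u n) z0 Eu.
- exists (1 + Normc.normc z) => n; rewrite hnormZ nu mulr1.
  by rewrite lerDl lerDr ler01 normc_ge0.
- by under [X in hcvg X]eq_fun do rewrite subrr; exact: hcvg_cst.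
have [N hN] := hcvg_cauchy ul ltr01.
have := hN _ _ (leqnSn N) (leqnn N) => /=.
have /ou o : (phi N < phi N.+1)%N by apply: hphi.
rewrite -(@ltr_pXn2r _ 2)// ?nnegrE ?hnorm_ge0// sqr_hnorm rdotBl !rdotBr.
rewrite (rdotC _ (u (phi N))) o /= -!sqr_hnorm !nu !expr1n; lra.
Qed.

(** For isolation: spectral points w_n -> z other than [z] would be eigenvalues with unit
    eigenvectors u_n, a subsequence of which converges to an eigenvector l for [z]. Eigenvectors for
    distinct eigenvalues are orthogonal, so <u_n, l> = 0, and |l| = 1 is contradicted. *)
Lemma discrete_perturbed_spectrum z : ~~ (0 <= z) -> spectrum dot T z ->
  discrete_spectrum dot T z.
Proof.
move=> z0 sz; have [zi [u0 nu0 Tu0]] := eigenvalue_of_spectrum z0 sz.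
have u0n0 : u0 != 0.
  by apply: contra_eqN nu0 => /eqP ->; rewrite hnorm0 eq_sym oner_eq0.
have sT := symmetric_perturbed.
split => //; last exact: finite_dimensional_perturbed_eigenspace.
2: by exists u0.
have zneg : complex.Re z < 0 by case: (not_ge0cE z0) => //; rewrite zi eqxx.
apply: contrapT => niso.
have /boolp.choice[t ht] : forall n : nat, exists p : R[i] * H,
    [/\ hnorm p.2 = 1, T (p.2, p.1 *: p.2), p.1 != z, complex.Im p.1 = 0 &
      `|complex.Re p.1 - complex.Re z| <= n.+1%:R^-1].
  (* The second bound keeps [w] to the left of 0, where every spectral point is already known to be
     an eigenvalue. *)
  move=> n; pose e := Num.min n.+1%:R^-1 (- complex.Re z).
  have e0 : 0 < e by rewrite lt_min invr_gt0 ltr0n/= oppr_gt0.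
  apply: contrapT => nw; apply: niso; exists e => // w sw wz.
  have rwz : `|complex.Re w - complex.Re z| < e.
    have := normc_ge_Re (w - z); rewrite raddfB => /le_lt_trans/(_ wz).
    by rewrite ltcR.
  have w0 : ~~ (0 <= w).
    rewrite lecE negb_and; apply/orP; right; rewrite -ltNge.
    move: rwz; rewrite lt_min => /andP[_]; rewrite ltr_norml => /andP[_].
    by rewrite ltrBlDr addNr.
  have [wi [u nu Tu]] := eigenvalue_of_spectrum w0 sw.
  apply: contrapT => /eqP wnz; apply: nw; exists (w, u); split => //=.
  by move: rwz; rewrite lt_min => /andP[/ltW].
have tz n : (t n).1 - z = (complex.Re (t n).1 - complex.Re z)%:C.
  have [_ _ _ ti _] := ht n; move: ti zi; case: (t n).1 (z) => [a b] [c d] /= -> ->.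
  by apply/eqP; rewrite eq_complex/= subrr !eqxx.
have nt n : hnorm (t n).2 = 1 by have [] := ht n.
have [|||phi [l [hphi ul]]] := @perturbed_precompact z (fun n => (t n).2)
    (fun n => (t n).1 *: (t n).2) z0.
- by move=> n; have [] := ht n.
- exists (1 + Normc.normc z) => n; rewrite nt lerDl normc_ge0; split => //.
  rewrite -[(t n).1](subrK z) scalerDl (le_trans (le_hnormD _ _ _))// lerD//.
    rewrite tz hnormZr nt mulr1; have [_ _ _ _ h] := ht n.
    by rewrite (le_trans h)// invf_le1// ler1n.
  by rewrite hnormZ nt mulr1.
- apply: hcvg_squeeze (@cvg_harmonic R) => n.
  by rewrite subr0 -scalerBl tz hnormZr nt mulr1; have [] := ht n.
have nl : hnorm l = 1.
  have := hcvg_norm ul; rewrite (_ : (fun n => _) = fun=> 1).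
    by move=> /(cvg_unique _ (@cvg_cst _ _ _ _ _)) <-.
  by apply/funext => n /=.
have Tl : T (l, z *: l).
  apply: (closed_perturbed (v := fun n => (t (phi n)).1 *: (t (phi n)).2)) (ul) _; last first.
    have : hcvg (fun n => (t (phi n)).1 *: (t (phi n)).2 - z *: (t (phi n)).2) 0.
      apply: hcvg_squeeze (@cvg_harmonic R) => n.
      rewrite subr0 -scalerBl tz hnormZr nt mulr1.
      have [_ _ _ _ h] := ht (phi n); apply: le_trans h _.
      rewrite lef_pV2 ?posrE// ler_nat ltnS.
      elim: n => // n ih; exact: leq_ltn_trans ih (hphi _ _ _).
    move=> /hcvgD/(_ (hcvgZ z ul)); rewrite add0r.
    by under [X in hcvg X]eq_fun do rewrite /= subrK.
  by move=> n /=; have [] := ht (phi n).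
have ol n : dot (t n).2 l = 0.
  have [_ Tn tnz ti _] := ht n.
  have := sT _ _ _ _ Tn Tl; rewrite dotZl.
  have zr : z^*%R = z.
    by move: zi; case: (z) => a b /= ->; apply/eqP; rewrite eq_complex/= oppr0 !eqxx.
  rewrite -{1}zr dotZr_conj => /eqP; rewrite -subr_eq0 -mulrBl mulf_eq0 subr_eq0.
  by rewrite (negbTE tnz) => /eqP.
have : rdot l l = 0.
  have := @hcvg_rdotr _ _ dot _ _ l ul; rewrite (_ : (fun n => _) = fun=> 0).
    by move=> /(cvg_unique _ (@cvg_cst _ _ _ _ _)) <-.
  by apply/funext => n /=; rewrite ol.
by rewrite -sqr_hnorm nl expr1n => /eqP; rewrite oner_eq0.
Qed.

(** Completing the square gives alpha <w, u> >= - |w|^2 / K - K alpha^2 |u|^2 / 4, and |w|^2 / K <=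
    |u|^2 + <v, u> cancels the form of [A]. *)
Lemma perturbed_form_bounded : exists C : R, forall u y, T (u, y) ->
  - C * rdot u u <= rdot y u.
Proof.
exists (1 + K * alpha ^+ 2 / 4) => u y /perturbedE[v [w [Auv Vuw ->]]].
rewrite rdotDl rdotZl.
have h1 := V_bnd Auv Vuw.
have h2 := rdot_ge0 dot ((K^-1 * 2)%:C *: w + alpha%:C *: u).
have h3 : 0 <= K / 4 * rdot ((K^-1 * 2)%:C *: w + alpha%:C *: u)
    ((K^-1 * 2)%:C *: w + alpha%:C *: u).
  by rewrite mulr_ge0// divr_ge0// ltW.
move: h3; rewrite !rdotDl !rdotDr !rdotZl !rdotZr (rdotC _ u w).
set a := rdot w w; set b := rdot w u; set d := rdot u u; set r := rdot v u => h3.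
have h4 : K^-1 * a <= d + r by rewrite mulrC ler_pdivrMr// mulrC.
have h5 : K^-1 * a + alpha * b + K * alpha ^+ 2 / 4 * d = K / 4 * (K^-1 * 2 * (K^-1 * 2 * a) + K^-1 * 2 * (alpha * b) +
   (alpha * (K^-1 * 2 * b) + alpha * (alpha * d))).
  by field; rewrite gt_eqF.
move: h3; rewrite -[X in _ <= X]h5 => h3.
have -> : - (1 + K * alpha ^+ 2 / 4) * d = - d - K * alpha ^+ 2 / 4 * d by ring.
lra.
Qed.

(* If m is the infimum of the quadratic form on the unit sphere and m is in the
   resolvent set, the Cauchy-Schwarz inequality for the form of T - m, applied to
   u and (T - m)^-1 u, improves the lower bound m. *)
Lemma negative_perturbed_spectrum u0 y0 : T (u0, y0) -> rdot y0 u0 < 0 ->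
  exists2 z : R[i], spectrum dot T z & z < 0.
Proof.
move=> Tu0 neg; have [C hC] := perturbed_form_bounded.
have lT := linear_perturbed; have sT := symmetric_perturbed.
pose S := [set x | exists u y, [/\ T (u, y), rdot u u = 1 & x = rdot y u]].
have scaled u y : T (u, y) -> u != 0 -> S (rdot y u / rdot u u).
  move=> Tuy un0; have n0 := hnorm_gt0 dot un0.
  exists ((hnorm u)^-1%:C *: u), ((hnorm u)^-1%:C *: y); split.
  - exact: linopZ.
  - by rewrite -sqr_hnorm normalize// expr1n.
  - by rewrite rdotZl rdotZr -sqr_hnorm; field; rewrite gt_eqF.
have u0n0 : u0 != 0 by apply: contraTN neg => /eqP ->; rewrite dot0r ltxx.
have hS : has_inf S.
  split; first by exists (rdot y0 u0 / rdot u0 u0); exact: scaled.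
  exists (- C) => _ [u [y [Tuy nu ->]]].
  by have := hC _ _ Tuy; rewrite nu mulr1.
pose m := inf S.
have m0 : m < 0.
  apply: le_lt_trans (_ : m <= rdot y0 u0 / rdot u0 u0) _.
    by apply: ge_inf; [exact: hS.2|exact: scaled].
  rewrite pmulr_llt0// invr_gt0 -sqr_hnorm exprn_gt0//; exact: hnorm_gt0.
exists m%:C; last by rewrite ltcR.
move=> rm; have [c c0 hc] := resolvent_setE rm.
have form_ge0 u y : T (u, y) -> 0 <= rdot (y - m%:C *: u) u.
  move=> Tuy; rewrite rdotBl rdotZl subr_ge0.
  have [->|un0] := eqVneq u 0; first by rewrite !dot0r mulr0.
  have n0 : 0 < rdot u u by rewrite -sqr_hnorm exprn_gt0// hnorm_gt0.
  by rewrite -ler_pdivlMr//; apply: ge_inf; [exact: hS.2|exact: scaled].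
have improved u y : T (u, y) -> rdot u u = 1 -> m + c^-1 <= rdot y u.
  move=> Tuy nu; have [u2 [y2 [Tuy2 uy2]]] := resolvent_set_onto u rm.
  have h1 : hnorm u = 1 by rewrite /Defs.hnorm nu sqrtr1.
  have h2 : rdot u u2 <= c.
    apply: le_trans (CauchySchwarz_rdot _ _ _) _; rewrite h1 mul1r.
    by have := hc _ _ Tuy2; rewrite uy2 h1 mulr1.
  (* With (T - m) u2 = u, the form of T - m at u - u2 / c is <(T - m) u, u> - 2 / c + <u, u2> / c^2,
     and <u, u2> <= c. Its nonnegativity therefore gains 1 / c. *)
  have /form_ge0 : T (u + (- c^-1)%:C *: u2, y + (- c^-1)%:C *: y2).
    by apply: linopD => //; exact: linopZ.
  have e1 : rdot (y - m%:C *: u) u2 = 1.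
    rewrite rdotBl rdotZl (symmetric_rdot sT Tuy Tuy2) -nu.
    by rewrite -[X in _ = complex.Re (dot _ X)]uy2 rdotBr rdotZr.
  rewrite scalerDr opprD addrACA scalerA [m%:C * _]mulrC -scalerA -scalerBr uy2.
  rewrite rdotDl !rdotDr !rdotZl !rdotZr e1 nu rdotBl rdotZl nu.
  have -> : - c^-1 * (- c^-1 * rdot u u2) = c^-1 * (c^-1 * rdot u u2) by ring.
  have : c^-1 * (c^-1 * rdot u u2) <= c^-1.
    rewrite -[leRHS]mulr1 ler_wpM2l ?invr_ge0 ?(ltW c0)//.
    by rewrite mulrC ler_pdivrMr// mul1r.
  lra.
have : m + c^-1 <= m.
  apply: lb_le_inf; first exact: hS.1.
  by move=> _ [u [y [Tuy nu ->]]]; exact: improved.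
by rewrite gerDl leNgt invr_gt0 c0.
Qed.

(** Off [0, +oo) every spectral point is discrete. On [0, +oo) none is: [z + e / 2] is a further
    spectral point within distance [e] of [z], so [z] is not isolated. *)
Lemma perturbed_essential_spectrum :
  (forall z : R[i], 0 <= z -> spectrum dot T z) ->
  essential_spectrum dot T = [set z : R[i] | 0 <= z].
Proof.
move=> h; apply/seteqP; split => [z [sz nd] /=|z /= z0].
  by apply: contrapT => /negP z0; apply: nd; exact: discrete_perturbed_spectrum.
split; first exact: h.
move=> [_ [e e0 iso] _ _].
have e2 : 0 <= (e / 2)%:C by rewrite lecR divr_ge0// ltW.
have := iso (z + (e / 2)%:C) (h _ (addr_ge0 z0 e2)).
rewrite addrAC subrr add0r ger0_norm// ltcR; have -> : e / 2 < e by lra.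
move=> /(_ isT) /(congr1 (fun x => x - z)); rewrite addrAC subrr add0r => -[]; lra.
Qed.

End Perturbed.
End Perturbation.

(** * Absolutely continuous functions on the half-line *)

Section Integrability.
Context (R : realType).
Local Notation mu := (@lebesgue_measure R).
Local Notation TR := (measurableTypeR R).
Implicit Types (A B : set TR) (f g h : TR -> R) (a b c x y : R).

Definition itg (A : set TR) (f : TR -> R) := mu.-integrable A (EFin \o f).

Lemma itg_measurable A f : measurable A -> itg A f -> measurable_fun A f.
Proof. by move=> mA /integrableP[+ _] => /measurable_EFinP. Qed.

Lemma itgD A f g : measurable A -> itg A f -> itg A g -> itg A (fun x => f x + g x).
Proof. by move=> mA fi gi; have := integrableD mA fi gi. Qed.

Lemma itgZ A c f : measurable A -> itg A f -> itg A (fun x => c * f x).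
Proof. by move=> mA fi; have := @integrableZl _ _ _ mu A mA c _ fi. Qed.

Lemma itgN A f : measurable A -> itg A f -> itg A (fun x => - f x).
Proof.
move=> mA /(@itgZ A (-1) f mA); congr (mu.-integrable A _).
by apply/funext => x /=; rewrite mulN1r.
Qed.

Lemma itgB A f g : measurable A -> itg A f -> itg A g -> itg A (fun x => f x - g x).
Proof. by move=> mA fi /(itgN mA); exact: itgD. Qed.

Lemma itgS (A B : set TR) f : measurable A -> measurable B -> B `<=` A -> itg A f -> itg B f.
Proof. exact: integrableS. Qed.

Lemma itg_le A f g : measurable A -> measurable_fun A f ->
  (forall x, A x -> `|f x| <= g x) -> itg A g -> itg A f.
Proof.
move=> mA mf fg; apply: (le_integrable mA); first exact/measurable_EFinP.
by move=> x Ax /=; rewrite lee_fin (le_trans (fg _ Ax))// ler_norm.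
Qed.

Lemma itg_norm A f : measurable A -> itg A f -> itg A (fun x => `|f x|).
Proof.
move=> mA fi; have := fi; apply: (le_integrable mA).
  by apply/measurable_EFinP; apply: measurableT_comp => //; exact: itg_measurable.
by move=> x Ax /=; rewrite normr_id.
Qed.

Lemma itgM_bounded A f h c : measurable A -> itg A f -> measurable_fun A h ->
  (forall x, A x -> `|h x| <= c) -> itg A (fun x => f x * h x).
Proof.
move=> mA fi mh hc.
apply: (@itg_le _ _ (fun x => c * `|f x|)) => //.
- by apply: measurable_funM => //; exact: itg_measurable fi.
- by move=> x Ax; rewrite normrM mulrC ler_wpM2r// hc.
- by apply: itgZ => //; exact: itg_norm.
Qed.

Lemma itg_bounded A f c : measurable A -> (mu A < +oo)%E -> measurable_fun A f ->
  (forall x, A x -> `|f x| <= c) -> itg A f.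
Proof.
move=> mA Aoo mf fc; apply: measurable_bounded_integrable => //.
exists c; split; first exact: num_real.
by move=> d cd x Ax /=; rewrite (le_trans (fc _ Ax))// ltW.
Qed.

Lemma itg_setT A f : measurable A -> itg A f -> itg setT (f \_ A).
Proof.
move=> mA /(integrable_mkcond (EFin \o f) mA); rewrite /itg.
by rewrite -restrict_EFin.
Qed.

Lemma itg_ae_eq A f g : measurable A -> measurable_fun A g ->
  {ae mu, forall x, A x -> f x = g x} -> itg A f -> itg A g.
Proof.
move=> mA mg fg fi; apply/integrableP; split; first exact/measurable_EFinP.
have <- : (\int[mu]_(x in A) `|(EFin \o f) x| = \int[mu]_(x in A) `|(EFin \o g) x|)%E.
  apply: ae_eq_integral => //.
  - by do 2! apply: measurableT_comp => //; exact: itg_measurable fi.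
  - by do 2! apply: measurableT_comp => //.
  - by apply: filterS fg => x fg Ax /=; rewrite fg.
by case/integrableP : fi.
Qed.

Lemma ae_eq_Rintegral A f g : measurable A -> measurable_fun A f ->
  measurable_fun A g -> {ae mu, forall x, A x -> f x = g x} ->
  \int[mu]_(x in A) f x = \int[mu]_(x in A) g x.
Proof.
move=> mA mf mg fg; congr fine; apply: ae_eq_integral => //.
- exact/measurable_EFinP.
- exact/measurable_EFinP.
- by apply: filterS fg => x fg Ax /=; rewrite fg.
Qed.

Lemma Rintegral_EFin A f : measurable A -> itg A f ->
  (\int[mu]_(x in A) (f x)%:E = (\int[mu]_(x in A) f x)%:E)%E.
Proof. by move=> mA fi; rewrite /Rintegral fineK//; exact: integrable_fin_num. Qed.

Lemma measurable_indic_prod (P : TR * TR -> bool) :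
  measurable [set z | P z] -> measurable_fun setT (fun z => (P z)%:R : R).
Proof.
move=> mP; rewrite (_ : (fun z => _) = \1_[set z | P z]).
  exact: measurable_indic.
apply/funext => z; rewrite indicE; congr (_ %:R).
by congr nat_of_bool; apply/idP/idP; rewrite inE.
Qed.

Lemma measurable_triangle_le : measurable [set z : TR * TR | (z.2 : R) <= z.1].
Proof.
have mh : measurable_fun setT (fun z : TR * TR => (z.1 : R) - z.2).
  by apply: measurable_funB.
rewrite (_ : [set _ | _] = (fun z : TR * TR => (z.1 : R) - z.2) @^-1` `[0, +oo[%classic).
  by rewrite -[X in measurable X]setTI; exact: mh.
by apply/seteqP; split => z /=; rewrite in_itv/= andbT subr_ge0.
Qed.

Lemma measurable_triangle_lt : measurable [set z : TR * TR | (z.1 : R) < z.2].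
Proof.
rewrite (_ : [set _ | _] = ~` [set z : TR * TR | (z.2 : R) <= z.1]).
  by apply: measurableC; exact: measurable_triangle_le.
by apply/seteqP; split => z /=; rewrite ltNge => /negP.
Qed.

(* Fubini on the two triangles t <= s and s < t. *)
Lemma Rintegral_mul_triangles f g : itg setT f -> itg setT g ->
  \int[mu]_s (f s * \int[mu]_t (g t * ((t : R) <= s)%R%:R)) +
  \int[mu]_t (g t * \int[mu]_s (f s * ((s : R) < t)%R%:R)) =
  (\int[mu]_s f s) * (\int[mu]_t g t).
Proof.
move=> fi gi.
have mf := itg_measurable measurableT fi; have mg := itg_measurable measurableT gi.
pose H (P : TR * TR -> bool) (z : TR * TR) := f z.1 * g z.2 * (P z)%:R.
have gib (P : TR -> bool) : measurable_fun setT (fun t => (P t)%:R : R) ->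
    itg setT (fun t => g t * (P t)%:R).
  by move=> mP; apply: (itgM_bounded (c := 1)) => // x _; case: (P x); rewrite ?normr1 ?normr0.
have fib (P : TR -> bool) : measurable_fun setT (fun t => (P t)%:R : R) ->
    itg setT (fun t => f t * (P t)%:R).
  by move=> mP; apply: (itgM_bounded (c := 1)) => // x _; case: (P x); rewrite ?normr1 ?normr0.
have mH (P : TR * TR -> bool) : measurable [set z | P z] -> measurable_fun setT (H P).
  move=> mP; apply: measurable_funM; last exact: measurable_indic_prod.
  by apply: measurable_funM; apply: measurableT_comp.
have iH (P : TR * TR -> bool) : measurable [set z | P z] ->
    (mu \x mu)%E.-integrable setT (EFin \o H P).
  move=> mP; apply/integrable12ltyP.
    by apply/measurable_EFinP; exact: mH.
  apply: (@le_lt_trans _ _ (\int[mu]_s \int[mu]_t (`|f s| * `|g t|)%R%:E)%E).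
    apply: ge0_le_integral => //.
    + by move=> s _; apply: integral_ge0.
    + apply: (@measurable_fun_fubini_tonelli_F _ _ _ _ _ mu
        (fun z => `|(H P z)%:E|%E)) => //.
      by apply: measurableT_comp => //; apply/measurable_EFinP; exact: mH.
    + apply: (@measurable_fun_fubini_tonelli_F _ _ _ _ _ mu
        (fun z => (`|f z.1| * `|g z.2|)%:E)) => //.
        apply/measurable_EFinP; apply: measurable_funM;
          apply: measurableT_comp => //; exact: measurableT_comp.
    move=> s _; apply: ge0_le_integral => //.
    + apply: measurableT_comp => //; apply/measurable_EFinP.
      have := mH _ mP; move=> /measurableT_comp/(_ (measurable_pair1 s)).
      exact.
    + apply/measurable_EFinP; apply: measurable_funM => //.
      exact: measurableT_comp.
    move=> t _; rewrite lee_fin /H !normrM ler_piMr ?mulr_ge0//.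
    by case: (P _); rewrite ?normr1 ?normr0.
  have -> : (\int[mu]_s \int[mu]_t (`|f s| * `|g t|)%R%:E)%E =
      (\int[mu]_s (`|f s| * \int[mu]_t `|g t|)%R%:E)%E.
    apply: eq_integral => s _; rewrite Rintegral_EFin//.
      by rewrite RintegralZl//; exact: itg_norm.
    by apply: itgZ => //; exact: itg_norm.
  rewrite Rintegral_EFin ?ltry//.
  rewrite (_ : (fun x => _) = fun x => (\int[mu]_t `|g t|) * `|f x|).
    by apply: itgZ => //; exact: itg_norm.
  by apply/funext => x; rewrite mulrC.
have slice1 (P : TR * TR -> bool) (hP : measurable [set z | P z]) s :
    measurable_fun setT (fun t => (P (s, t))%:R : R).
  have := measurable_indic_prod hP => /measurableT_comp/(_ (measurable_pair1 s)).
  exact.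
have slice2 (P : TR * TR -> bool) (hP : measurable [set z | P z]) t :
    measurable_fun setT (fun s => (P (s, t))%:R : R).
  have := measurable_indic_prod hP => /measurableT_comp/(_ (measurable_pair2 t)).
  exact.
have I1 (P : TR * TR -> bool) : measurable [set z | P z] ->
    \int[mu]_s (f s * \int[mu]_t (g t * (P (s, t))%:R)) =
    fine (\int[mu \x mu]_z (H P z)%:E)%E.
  move=> mP; rewrite -(integral12_prod_meas1 (iH _ mP)); congr fine.
  apply: eq_integral => s _; rewrite /fubini_F /H /=.
  under [in RHS]eq_integral do rewrite -mulrA.
  rewrite Rintegral_EFin//; last by apply: itgZ => //; exact: gib (slice1 _ mP s).
  by rewrite RintegralZl//; exact: gib (slice1 _ mP s).
have I2 (P : TR * TR -> bool) : measurable [set z | P z] ->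
    \int[mu]_t (g t * \int[mu]_s (f s * (P (s, t))%:R)) =
    fine (\int[mu \x mu]_z (H P z)%:E)%E.
  move=> mP; rewrite -(integral21_prod_meas1 (iH _ mP)); congr fine.
  apply: eq_integral => t _; rewrite /fubini_G /H /=.
  under [in RHS]eq_integral do rewrite [X in X * _]mulrC -mulrA.
  rewrite Rintegral_EFin//; last by apply: itgZ => //; exact: fib (slice2 _ mP t).
  by rewrite RintegralZl//; exact: fib (slice2 _ mP t).
have mle := measurable_triangle_le; have mlt := measurable_triangle_lt.
rewrite (I1 (fun z => (z.2 : R) <= z.1) mle) (I2 (fun z => (z.1 : R) < z.2) mlt).
(* The product of the two integrals is the case of the trivial predicate, and the indicators of the
   two triangles add up to 1. *)
have mT : measurable [set z : TR * TR | (fun=> true) z].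
  by rewrite (_ : [set _ | _] = setT)//; apply/seteqP; split.
have <- : \int[mu]_s (f s * \int[mu]_t (g t * ((fun=> true) (s, t))%:R)) =
    (\int[mu]_s f s) * (\int[mu]_t g t).
  rewrite -RintegralZr//; apply: eq_Rintegral => s _; congr (_ * _).
  by apply: eq_Rintegral => t _; rewrite mulr1.
rewrite (I1 (fun=> true) mT) -fineD; last 2 first.
- exact: integrable_fin_num (iH _ mle).
- exact: integrable_fin_num (iH _ mlt).
congr fine; rewrite -integralD//; [|exact: iH|exact: iH].
apply: eq_integral => z _; rewrite -EFinD /H /=; congr EFin.
by rewrite leNgt; case: ((z.1 : R) < z.2) => /=; ring.
Qed.

End Integrability.

(** * Calculus of primitives on the half-line *)

Section Primitive.
Context (R : realType).
Local Notation mu := (@lebesgue_measure R).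
Local Notation TR := (measurableTypeR R).
Local Notation D := (halfline : set TR).
Implicit Types (F G f g h : R -> R) (a b c x y : R).

(* F is absolutely continuous on [0, +oo) with derivative f; F x is arbitrary for
   x < 0. *)
Definition primitive F f := (forall b, itg (`]0, b]%classic : set TR) f) /\
  forall x, 0 <= x -> F x = F 0 + \int[mu]_(t in `]0, x]) f t.

Lemma measurable_itvT (i : interval R) : measurable ([set` i] : set TR).
Proof. exact: measurable_itv. Qed.

Hint Extern 0 (measurable [set` _]) => exact: measurable_itvT : core.

Lemma itg_halfline_itv h b : itg D h -> itg (`]0, b]%classic : set TR) h.
Proof. by apply: itgS => //; apply: subset_itvl. Qed.

Lemma itg_itv h a b : 0 <= a -> (forall b, itg (`]0, b]%classic : set TR) h) ->
  itg (`]a, b]%classic : set TR) h.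
Proof. by move=> a0 /(_ b); apply: itgS => //; apply: subset_itvr; rewrite bnd_simp. Qed.

Lemma primitive_diff F f x y : primitive F f -> 0 <= x -> x <= y ->
  F y - F x = \int[mu]_(t in `]x, y]) f t.
Proof.
move=> [fi FE] x0 xy; rewrite (FE x)// (FE y)//; last exact: le_trans xy.
by rewrite opprD addrACA subrr add0r Rintegral_itvB ?bnd_simp//; exact: fi.
Qed.

Lemma primitive_cst c : primitive (fun=> c) (fun=> 0).
Proof.
split=> [b|x x0]; first exact: integrable0.
by rewrite Rintegral_cst// mul0r addr0.
Qed.

Lemma primitiveD F f G g : primitive F f -> primitive G g ->
  primitive (fun x => F x + G x) (fun x => f x + g x).
Proof.
move=> [fi FE] [gi GE]; split=> [b|x x0]; first exact: itgD.
by rewrite RintegralD//; [rewrite FE// GE//; ring|exact: fi|exact: gi].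
Qed.

Lemma primitiveZ c F f : primitive F f -> primitive (fun x => c * F x) (fun x => c * f x).
Proof.
move=> [fi FE]; split=> [b|x x0]; first exact: itgZ.
by rewrite RintegralZl//; [rewrite FE//; ring|exact: fi].
Qed.

Lemma primitiveN F f : primitive F f -> primitive (fun x => - F x) (fun x => - f x).
Proof.
move=> /(primitiveZ (-1)); congr primitive; apply/funext => x; exact: mulN1r.
Qed.

Lemma primitive_bounded F f b x : primitive F f -> 0 <= x -> x <= b ->
  `|F x| <= `|F 0| + \int[mu]_(t in `]0, b]) `|f t|.
Proof.
move=> [fi FE] x0 xb; rewrite FE// (le_trans (ler_normD _ _))// lerD2l.
rewrite (le_trans (le_normr_Rintegral _ _))//; first exact: fi.
rewrite -subr_ge0 Rintegral_itvB ?bnd_simp//; last exact: itg_norm.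
exact: Rintegral_ge0.
Qed.

Lemma primitive_measurable_itv F f b : primitive F f ->
  measurable_fun (`]0, b]%classic : set TR) F.
Proof.
move=> [fi FE]; have [b0|b0] := ltP b 0.
  by rewrite set_itv_ge ?bnd_simp -?leNgt ?ltW//; exact: measurable_fun_set0.
pose f0 := f \_ `]0, b].
have fi0 : itg (setT : set TR) f0 by apply: itg_setT => //; exact: fi.
have fi0S (i : interval R) : mu.-integrable [set` i] (EFin \o f0).
  exact: (itgS measurableT (measurable_itvT i) (@subsetT _ _) fi0).
have FE0 x : 0 <= x -> x <= b ->
    F x = F 0 + parameterized_integral mu 0 x f0.
  move=> x0 xb; rewrite FE// /parameterized_integral -Rintegral_itv_obnd_cbnd//.
  congr (_ + _); apply: eq_Rintegral => t; rewrite inE/= in_itv/= => /andP[t0 tx].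
  by rewrite /f0 patchE mem_set//= in_itv/= t0 (le_trans tx).
have cF := parameterized_integral_continuous b0 (fi0S `[0, b]).
apply: (@measurable_funS _ _ _ _ (`[0, b]%classic : set TR)) => //.
  by apply: subset_itvr; rewrite bnd_simp.
apply: (@eq_measurable_fun _ _ _ _ (`[0, b]%classic : set TR)
  (fun x => F 0 + parameterized_integral mu 0 x f0)).
  by move=> x; rewrite inE/= in_itv/= => /andP[x0 xb]; rewrite -FE0.
apply: measurable_funD => //.
exact: (subspace_continuous_measurable_fun (measurable_itvT `[0, b]) cF).
Qed.

Lemma measurable_fun_halfline h :
  (forall b, measurable_fun (`]0, b]%classic : set TR) h) -> measurable_fun D h.
Proof.
move=> mh; have -> : D = \bigcup_n `]0, n%:R]%classic.
  apply/seteqP; split => [x|x [n _]] /=; rewrite !in_itv/= => /andP[x0 _].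
    have [n hn] : exists n : nat, x <= n%:R.
      by exists (Num.truncn x).+1; rewrite ltW// truncnS_gt.
    by exists n => //=; rewrite in_itv/= x0.
  by rewrite x0.
by apply/measurable_fun_bigcup => // n; exact: mh.
Qed.

Lemma primitive_measurable F f : primitive F f -> measurable_fun D F.
Proof.
by move=> Ff; apply: measurable_fun_halfline => b; exact: primitive_measurable_itv Ff.
Qed.

Lemma primitive_itg F f b : primitive F f -> itg (`]0, b]%classic : set TR) F.
Proof.
move=> Ff; apply: (itg_bounded (c := `|F 0| + \int[mu]_(t in `]0, b]) `|f t|)) => //.
- by rewrite lebesgue_measure_itv/=; case: ifP => _; rewrite ?ltry// -EFinB ltry.
- exact: primitive_measurable_itv Ff.
- move=> x /=; rewrite in_itv/= => /andP[/ltW x0 xb].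
  exact: primitive_bounded Ff x0 xb.
Qed.

(** F(x) G(x) is the integral of f(s) g(t) over the square []0, x]^2]; cutting it along the diagonal
    gives the integrals of f G and of g F. *)
Lemma primitiveM0 F f G g : primitive F f -> primitive G g -> F 0 = 0 -> G 0 = 0 ->
  primitive (fun x => F x * G x) (fun x => f x * G x + g x * F x).
Proof.
move=> Ff Gg F0 G0.
have ifG b : itg (`]0, b]%classic : set TR) (fun x => f x * G x).
  apply: (itgM_bounded (c := `|G 0| + \int[mu]_(t in `]0, b]) `|g t|)) => //.
  - exact: Ff.1.
  - exact: primitive_measurable_itv Gg.
  - by move=> x /=; rewrite in_itv/= => /andP[/ltW x0 xb]; exact: primitive_bounded Gg x0 xb.
have igF b : itg (`]0, b]%classic : set TR) (fun x => g x * F x).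
  apply: (itgM_bounded (c := `|F 0| + \int[mu]_(t in `]0, b]) `|f t|)) => //.
  - exact: Gg.1.
  - exact: primitive_measurable_itv Ff.
  - by move=> x /=; rewrite in_itv/= => /andP[/ltW x0 xb]; exact: primitive_bounded Ff x0 xb.
split=> [b|x x0]; first exact: itgD.
rewrite F0 mul0r add0r RintegralD//; [|exact: ifG|exact: igF].
have [fi FE] := Ff; have [gi GE] := Gg.
have hF y : 0 <= y -> \int[mu]_(t in `]0, y]) f t = F y.
  by move=> y0; rewrite FE// F0 add0r.
have hG y : 0 <= y -> \int[mu]_(t in `]0, y]) g t = G y.
  by move=> y0; rewrite GE// G0 add0r.
have := @Rintegral_mul_triangles R (f \_ `]0, x]) (g \_ `]0, x])
  (itg_setT (measurable_itvT `]0, x]) (fi x)) (itg_setT (measurable_itvT `]0, x]) (gi x)).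
rewrite -!Rintegral_mkcond hF// hG// => <-; congr (_ + _).
- rewrite [RHS]Rintegral_mkcond; apply: eq_Rintegral => s _.
  rewrite !patchE; case: ifPn; last by rewrite mul0r.
  rewrite inE/= in_itv/= => /andP[s0 sx].
  rewrite -hG ?(ltW s0)//; congr (_ * _); rewrite [RHS]Rintegral_mkcond.
  apply: eq_Rintegral => t _; rewrite !patchE.
  rewrite [in RHS](_ : t \in `]0, s]%classic = (t \in `]0, x]%classic) && (t <= s)).
    by case: ifP => _; case: leP => _; rewrite /= ?mulr1 ?mulr0// mul0r.
  apply/idP/idP => [|/andP[]]; rewrite !inE/= !in_itv/=.
    by move=> /andP[t0 ts]; rewrite ts andbT inE/= in_itv/= t0 (le_trans ts).
  by move=> /andP[-> _] ->.
- rewrite [RHS]Rintegral_mkcond; apply: eq_Rintegral => t _.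
  rewrite !patchE; case: ifPn; last by rewrite mul0r.
  rewrite inE/= in_itv/= => /andP[t0 tx].
  (* The second triangle is strict, s < t, so the integral for F(t) is taken over the open
     interval. *)
  rewrite -hF ?(ltW t0)// -Rintegral_itv_bndo_bndc; last first.
    by apply: itgS (fi t) => //; apply: subset_itvl; rewrite bnd_simp.
  congr (_ * _); rewrite [RHS]Rintegral_mkcond.
  apply: eq_Rintegral => s _; rewrite !patchE.
  rewrite [in RHS](_ : s \in `]0, t[%classic = (s \in `]0, x]%classic) && (s < t)).
    by case: ifP => _; case: ltP => _; rewrite /= ?mulr1 ?mulr0// mul0r.
  apply/idP/idP => [|/andP[]]; rewrite !inE/= !in_itv/=.
    by move=> /andP[s0 st]; rewrite st andbT inE/= in_itv/= s0 (le_trans (ltW st) tx).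
  by move=> /andP[-> _] ->.
Qed.

Lemma primitiveM F f G g : primitive F f -> primitive G g ->
  primitive (fun x => F x * G x) (fun x => f x * G x + g x * F x).
Proof.
move=> Ff Gg.
have Ff0 := primitiveD Ff (primitive_cst (- F 0)).
have Gg0 := primitiveD Gg (primitive_cst (- G 0)).
have := primitiveM0 Ff0 Gg0 (subrr _) (subrr _).
(* F G = (F - F(0)) (G - G(0)) + G(0) F + F(0) G - F(0) G(0). *)
move=> /primitiveD/(_ (primitiveZ (G 0) Ff))/primitiveD/(_ (primitiveZ (F 0) Gg)).
move=> /primitiveD/(_ (primitive_cst (- F 0 * G 0))).
by congr primitive; apply/funext => x; ring.
Qed.

Lemma Rintegral_unit_cst x c : \int[mu]_(t in `]x, (x + 1)]) c = c.
Proof.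
rewrite Rintegral_cst//=. rewrite lebesgue_measure_itv/= lte_fin ltrDl ltr01.
by rewrite -EFinB/= addrAC subrr add0r mulr1.
Qed.

(** For every t in the unit interval to the right of [x], |F(x)| is at most |F(t)| plus the integral
    of |f| over that interval; averaging over t gives the bound. It yields both the decay at
    infinity and the Sobolev bound. *)
Lemma primitive_sup F f x : primitive F f -> 0 <= x ->
  `|F x| <= \int[mu]_(t in `]x, (x + 1)]) (`|F t| + `|f t|).
Proof.
move=> Ff x0.
have iF : itg (`]x, (x + 1)]%classic : set TR) (fun t => `|F t|).
  by apply: itg_norm => //; apply: itg_itv => // b; exact: primitive_itg Ff.
have if_ : itg (`]x, (x + 1)]%classic : set TR) f by apply: itg_itv => // b; exact: Ff.1.
have if' := itg_norm (measurable_itvT _) if_.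
rewrite RintegralD//; set c := \int[mu]_(t in _) `|f t|.
rewrite -(Rintegral_unit_cst x `|F x|) -[X in _ <= _ + X](Rintegral_unit_cst x c).
have icst (d : R) : itg (`]x, (x + 1)]%classic : set TR) (fun=> d).
  apply: (itg_bounded (c := `|d|)) => //.
  by rewrite lebesgue_measure_itv/=; case: ifP => _; rewrite ?ltry// -EFinB ltry.
rewrite -RintegralD//; [|exact: icst].
apply: le_Rintegral => //; [exact: icst|by apply: itgD => //; exact: icst|].
move=> y /=; rewrite in_itv/= => /andP[xy yx].
rewrite -lerBlDl (le_trans (lerB_dist _ _))// distrC (primitive_diff Ff x0 (ltW xy)).
apply: le_trans (le_normr_Rintegral _ _) _ => //.
  by apply: itgS if_ => //; apply: subset_itvl; rewrite bnd_simp.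
rewrite /c -subr_ge0 Rintegral_itvB ?bnd_simp ?(ltW xy)//.
exact: Rintegral_ge0.
Qed.

Lemma Rintegral_cvg_halfline h : itg D h ->
  \int[mu]_(t in `]0, n%:R]) h t @[n --> \oo] --> \int[mu]_(t in D) h t.
Proof.
move=> hi.
have hn n : itg D (h \_ `]0, n%:R]).
  by apply: itgS measurableT _ (@subsetT _ _) _ => //; apply: itg_setT => //; exact: itg_halfline_itv.
have [|||||] := @dominated_convergence _ _ _ mu D (measurable_itvT _)
    (fun n => EFin \o (h \_ `]0, n%:R])) (EFin \o h) (fun x => `|h x|%:E).
- by move=> n; apply/measurable_EFinP; exact: itg_measurable (hn n).
- by apply/measurable_EFinP; exact: itg_measurable hi.
- apply: aeW => x /=; rewrite in_itv/= andbT => x0.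
  apply: cvg_near_cst; exists (Num.truncn x).+1 => // n /= xn.
  rewrite patchE mem_set//= in_itv/= x0/=.
  apply: le_trans (_ : (Num.truncn x).+1%:R <= _); last by rewrite ler_nat.
  by rewrite ltW// truncnS_gt.
- exact: itg_norm.
- apply: aeW => x n _ /=; rewrite lee_fin patchE.
  by case: ifP => _ //; rewrite normr0.
move=> _ _; rewrite Rintegral_EFin// => /fine_cvg; apply: cvg_trans.
apply: near_eq_cvg; apply: nearW => n /=.
have {2}<- : D `&` `]0, n%:R]%classic = `]0, n%:R]%classic.
  by apply: setIidr; apply: subset_itvl.
by rewrite Rintegral_mkcondr.
Qed.

(** |F(n)| is bounded by the integral of |F| + |f| over []n, n + 1]], a difference of consecutive
    terms of a convergent sequence. *)
Lemma primitive_cvg0 F f : primitive F f -> itg D F -> itg D f ->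
  F n%:R @[n --> \oo] --> (0 : R).
Proof.
move=> Ff Fi fi.
pose h t := `|F t| + `|f t|.
have hi : itg D h by apply: itgD => //; apply: itg_norm.
have c1 := Rintegral_cvg_halfline hi.
have c2 : \int[mu]_(t in `]0, n.+1%:R]) h t @[n --> \oo] --> \int[mu]_(t in D) h t.
  by move: c1; rewrite -(cvg_shiftS (fun n => \int[mu]_(t in `]0, n%:R]) h t)).
apply/norm_cvg0P.
have c3 : (\int[mu]_(t in `]0, n.+1%:R]) h t - \int[mu]_(t in `]0, n%:R]) h t)
    @[n --> \oo] --> (0 : R).
  by have := cvgB c2 c1; rewrite subrr; apply.
apply: (squeeze_cvgr _ (@cvg_cst _ _ _ _ _) c3); apply: nearW => n.
rewrite normr_ge0/= Rintegral_itvB ?bnd_simp ?ler_nat//.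
  by rewrite -natr1 primitive_sup// ler0n.
exact: itg_halfline_itv.
Qed.

Lemma primitive_total F f : primitive F f -> itg D F -> itg D f ->
  \int[mu]_(t in D) f t = - F 0.
Proof.
move=> Ff Fi fi; have c := primitive_cvg0 Ff Fi fi.
have c2 := Rintegral_cvg_halfline fi.
have c3 : \int[mu]_(t in `]0, n%:R]) f t @[n --> \oo] --> (0 - F 0 : R).
  rewrite (_ : (fun n => _) = (fun n => F n%:R - F 0)); last first.
    by apply/funext => n; rewrite (primitive_diff Ff).
  by apply: cvgB => //; exact: cvg_cst.
by apply: etrans (cvg_unique _ c2 c3) _ => //; rewrite sub0r.
Qed.

Lemma primitive_C1 F : (forall x, derivable F x 1) -> continuous (derive1 F) ->
  primitive F (derive1 F).
Proof.
move=> dF cF.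
have ci b : itg (`[0, b]%classic : set TR) (derive1 F).
  apply: continuous_compact_integrable; first exact: segment_compact.
  exact: continuous_subspaceT.
split=> [b|x].
  by apply: itgS (ci b) => //; apply: subset_itvr; rewrite bnd_simp.
rewrite le_eqVlt => /predU1P[<-|x0].
  by rewrite set_itv_ge ?bnd_simp ?ltxx// Rintegral_set0 addr0.
rewrite Rintegral_itv_obnd_cbnd; last first.
  by apply: itgS (ci x) => //; apply: subset_itvr; rewrite bnd_simp.
rewrite /Rintegral (@continuous_FTC2 _ _ F)//=.
- by rewrite addrCA subrr addr0.
- exact: continuous_subspaceT.
- have cvF y : F @ y --> F y.
    by apply: differentiable_continuous; apply/derivable1_diffP; exact: dF.
  split=> [y _||]; first exact: dF.
  + by apply: cvg_at_right_filter; exact: cvF.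
  + by apply: cvg_at_left_filter; exact: cvF.
Qed.

Lemma primitive_ae F f g : primitive F f -> measurable_fun D g ->
  {ae mu, forall x, D x -> f x = g x} -> primitive F g.
Proof.
move=> [fi FE] mg fg.
have sub b : `]0, b]%classic `<=` (D : set R) by exact: subset_itvl.
have fgb b : {ae mu, forall x, `]0, b]%classic x -> f x = g x}.
  by apply: filterS fg => x h /sub; exact: h.
have mgb b : measurable_fun (`]0, b]%classic : set TR) g.
  exact: measurable_funS mg.
split=> [b|x x0]; first by apply: itg_ae_eq (fi b).
rewrite FE//; congr (_ + _); apply: ae_eq_Rintegral => //.
exact: itg_measurable (fi x).
Qed.

End Primitive.

(** * Weak derivatives *)

Section TestFunctions.
Context (R : realType).
Implicit Types (f g h phi : R -> R) (a b c x y : R) (n k : nat).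

(** Finite smoothness in recursive form: since the recursive call is on the derivative of [f],
    stability under sums, products and affine substitutions follows by induction on [n] for all
    functions at once. *)
Fixpoint smooth_upto n f : Prop :=
  if n is n.+1 then (forall x, derivable f x 1) /\ smooth_upto n (derive1 f) else True.

Definition smooth f := forall n, smooth_upto n f.

Lemma smoothP f : smooth f <-> forall n x, derivable (derive1n n f) x 1.
Proof.
split=> [+ n|h n].
  elim: n f => [f /(_ 1)[]//|n ih f fs x].
  by rewrite derive1Sn; apply: ih => k; have [] := fs k.+1.
elim: n f h => //= n ih f h; split; first exact: h 0%N.
by apply: ih => k x; have := h k.+1 x; rewrite derive1Sn.
Qed.

Lemma smooth_uptoS n f : smooth_upto n.+1 f -> smooth_upto n f.
Proof. by elim: n f => // n ih f [df /ih]. Qed.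

Lemma derive1_is_derive f f' : (forall x, is_derive x 1 f (f' x)) -> derive1 f = f'.
Proof. by move=> h; apply/funext => x; rewrite derive1E; exact: derive_val. Qed.

Lemma derivable_is_derive f x : derivable f x 1 -> is_derive x 1 f (derive1 f x).
Proof. by move=> df; apply: DeriveDef => //; rewrite derive1E. Qed.

Lemma smooth_uptoD n f g : smooth_upto n f -> smooth_upto n g ->
  smooth_upto n (fun x => f x + g x).
Proof.
elim: n f g => // n ih f g [df sf] [dg sg].
have h x : is_derive x 1 (fun x => f x + g x) (derive1 f x + derive1 g x).
  by apply: is_deriveD; exact: derivable_is_derive.
by split=> [x|]; [have [] := h x|rewrite (derive1_is_derive h); exact: ih].
Qed.

Lemma smooth_uptoM n f g : smooth_upto n f -> smooth_upto n g ->
  smooth_upto n (fun x => f x * g x).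
Proof.
elim: n f g => // n ih f g sf sg.
have [df sf'] := sf; have [dg sg'] := sg.
have h x : is_derive x 1 (fun x => f x * g x) (f x * derive1 g x + g x * derive1 f x).
  apply: is_derive_eq; first by apply: is_deriveM; exact: derivable_is_derive.
  by [].
split=> [x|]; first by have [] := h x.
rewrite (derive1_is_derive h); apply: smooth_uptoD; apply: ih => //;
  exact: smooth_uptoS.
Qed.

Lemma smooth_upto_cst n c : smooth_upto n (fun=> c).
Proof.
elim: n c => // n ih c; split; first by move=> x; exact: derivable_cst.
by rewrite (@derive1_is_derive _ (fun=> 0))// => x; exact: is_derive_cst.
Qed.

Lemma smooth_uptoZ n c f : smooth_upto n f -> smooth_upto n (fun x => c * f x).
Proof. by move=> sf; apply: smooth_uptoM => //; exact: smooth_upto_cst. Qed.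

Lemma smooth_upto_affine n f a b : smooth_upto n f ->
  smooth_upto n (fun x => f (a * x + b)).
Proof.
elim: n f => // n ih f [df sf].
have h x : is_derive x 1 (fun x => f (a * x + b)) (a * derive1 f (a * x + b)).
  have ha : is_derive x 1 (fun x => a * x + b) a.
    have h1 : is_derive x 1 (fun x => a *: x : R) (a *: 1 : R).
      by apply: is_deriveZ; exact: is_derive_id.
    have h2 := is_deriveD h1 (is_derive_cst b x 1).
    by apply: (is_derive_eq h2); rewrite addr0; exact: mulr1.
  have := @is_derive1_comp _ f (fun x => a * x + b) x _ _ (derivable_is_derive (df _)) ha.
  by rewrite mulrC.
split=> [x|]; first by have [] := h x.
by rewrite (derive1_is_derive h); apply: smooth_uptoZ; exact: ih.
Qed.

(** The classical flat function exp(-1/x). Carrying the power [k] of 1/x makes the span of the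
    family stable under differentiation. *)
Definition flat_exp k x : R := if 0 < x then x^-1 ^+ k * expR (- x^-1) else 0.

(** The inequality t <= exp(t) at t = y / (m + 1), raised to the power m + 1. With y = 1/x it gives
    the flatness at 0. *)
Lemma expr_expRN_le m y : 0 <= y -> y ^+ m.+1 * expR (- y) <= m.+1%:R ^+ m.+1.
Proof.
move=> y0; rewrite expRN ler_pdivrMr ?expR_gt0//.
have -> : expR y = expR (y / m.+1%:R) ^+ m.+1.
  by rewrite -expRM_natl mulrC divfK.
rewrite -exprMn lerXn2r ?nnegrE ?mulr_ge0 ?expR_ge0//.
rewrite -[leLHS](@divfK _ m.+1%:R)// mulrC ler_wpM2l//.
by rewrite (le_trans _ (expR_ge1Dx _))// lerDr.
Qed.

Lemma is_derive_flat_exp k x :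
  is_derive x 1 (flat_exp k) (- k%:R * flat_exp k.+1 x + flat_exp k.+2 x).
Proof.
have [x0|x0|<-] := ltgtP 0 x.
- pose f y : R := y^-1 ^+ k * expR (- y^-1).
  apply: (@near_eq_is_derive _ _ _ f).
    by near=> y; rewrite /flat_exp ifT//; near: y; exact: lt_nbhsr.
  have xn0 : x != 0 by rewrite gt_eqF.
  have h1 : is_derive x 1 (fun y : R => y^-1) (- x ^- 2).
    apply: is_derive_eq; first by apply: is_deriveV => //; exact: is_derive_id.
    by rewrite -[RHS]mulr1.
  have h2 : is_derive x 1 (fun y : R => y^-1 ^+ k) (k%:R * x^-1 ^+ k.-1 * (- x ^- 2)).
    have -> : (fun y : R => y^-1 ^+ k) = (fun y : R => y^-1) ^+ k.
      by apply/funext => y; rewrite exprfctE.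
    exact: (is_deriveX k h1).
  have h3 : is_derive x 1 (fun y : R => expR (- y^-1)) (expR (- x^-1) * x ^- 2).
    have := @is_derive1_comp _ expR (fun y : R => - y^-1) x _ _
      (is_derive_expR _) (is_deriveN h1).
    by rewrite opprK.
  apply: (is_derive_eq (is_deriveM h2 h3)).
  rewrite /flat_exp x0 /GRing.scale/= -!exprVn.
  case: k {f h2} => [|k] /=; last by rewrite !exprS; ring.
  by rewrite !mul0r mulr0 oppr0 mul0r !addr0 add0r expr0 !exprS; ring.
- apply: (@near_eq_is_derive _ _ _ (fun=> 0)).
    near=> y; rewrite /flat_exp ltNge ifF//; apply/negbTE; rewrite negbK.
    by apply/ltW; near: y; exact: lt_nbhsl.
  apply: (is_derive_eq (is_derive_cst (0 : R) x 1)).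
  by rewrite /flat_exp ltNge (ltW x0)/= mulr0 addr0.
- have -> : - k%:R * flat_exp k.+1 0 + flat_exp k.+2 0 = 0.
    by rewrite /flat_exp ltxx mulr0 addr0.
  have c : h^-1 *: ((flat_exp k \o shift 0) (h *: 1) - flat_exp k 0) @[h --> 0^'] --> (0 : R).
    apply/norm_cvg0P.
    (* For h > 0 the difference quotient is h y^(k+2) exp(-y) with y = 1/h, and the factor y^(k+2)
       exp(-y) is at most (k+2)^(k+2). *)
    have h0 : (k.+2%:R ^+ k.+2) * `|h| @[h --> (0 : R)^'] --> (0 : R).
      rewrite -[X in _ --> X](mulr0 (k.+2%:R ^+ k.+2)); apply: cvgM; first exact: cvg_cst.
      by rewrite -[X in _ --> X](@normr0 R R); apply: cvg_norm; exact: cvg_within.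
    apply: (squeeze_cvgr _ (@cvg_cst _ _ _ _ _) h0).
    near=> h; rewrite normr_ge0/= addr0 /flat_exp ltxx subr0 -[h *: 1]/(h * 1) mulr1.
    case: ltP => h_gt0; last by rewrite scaler0 normr0 mulr_ge0// exprn_ge0.
    rewrite -[_ *: _]/(_ * _) ger0_norm; last first.
      by rewrite !mulr_ge0 ?exprn_ge0 ?expR_ge0// invr_ge0 ltW.
    rewrite gtr0_norm// -ler_pdivrMr//.
    have hi : 0 <= h^-1 by rewrite invr_ge0 ltW.
    apply: le_trans (expr_expRN_le k.+1 hi).
    by rewrite le_eqVlt; apply/orP; left; apply/eqP; rewrite !exprS; ring.
  apply: DeriveDef; first by apply/cvg_ex; exists 0.
  exact: cvg_lim c.
Unshelve. all: by end_near. Qed.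

Lemma smooth_flat_exp k : smooth (flat_exp k).
Proof.
move=> n; elim: n k => // n ih k; split=> [x|].
  by have [] := is_derive_flat_exp k x.
rewrite (derive1_is_derive (is_derive_flat_exp k)).
by apply: smooth_uptoD => //; apply: smooth_uptoZ.
Qed.

Lemma flat_exp_itv x : 0 <= flat_exp 0 x <= 1.
Proof.
rewrite /flat_exp; case: ltP => x0; rewrite ?lexx ?ler01// expr0 mul1r expR_ge0/=.
by rewrite -expR0 ler_expR oppr_le0 invr_ge0 ltW.
Qed.

(** [flat_exp 0] tends to 1 at infinity, so as [n] grows these functions tend to the indicator of
    []a, b[], while their supports stay in [[a, b]]. *)
Definition smooth_bump a b n x : R :=
  flat_exp 0 (n.+1%:R * (x - a)) * flat_exp 0 (n.+1%:R * (b - x)).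

Lemma smooth_bump_itv a b n x : 0 <= smooth_bump a b n x <= 1.
Proof.
rewrite /smooth_bump; have /andP[h1 h2] := flat_exp_itv (n.+1%:R * (x - a)).
have /andP[h3 h4] := flat_exp_itv (n.+1%:R * (b - x)).
by rewrite mulr_ge0//= mulr_ile1.
Qed.

Lemma smooth_bump_out a b n x : x \notin `]a, b[ -> smooth_bump a b n x = 0.
Proof.
rewrite in_itv/= negb_and -!leNgt /smooth_bump /flat_exp => /orP[xa|bx].
  by rewrite ltNge mulr_ge0_le0 ?subr_le0//= mul0r.
by rewrite [0 < n.+1%:R * (b - x)]ltNge mulr_ge0_le0 ?subr_le0//= mulr0.
Qed.

Lemma test_function_smooth_bump a b n : 0 < a -> test_function (smooth_bump a b n).
Proof.
move=> a0; split.
  apply/smoothP => k; apply: smooth_uptoM.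
    rewrite (_ : (fun x => _) = fun x => flat_exp 0 (n.+1%:R * x + - n.+1%:R * a)).
      by apply: smooth_upto_affine; exact: smooth_flat_exp.
    by apply/funext => x; congr flat_exp; ring.
  rewrite (_ : (fun x => _) = fun x => flat_exp 0 (- n.+1%:R * x + n.+1%:R * b)).
    by apply: smooth_upto_affine; exact: smooth_flat_exp.
  by apply/funext => x; congr flat_exp; ring.
exists a, b; split=> // x xab; apply: smooth_bump_out; apply: contra xab.
by rewrite !in_itv/= => /andP[/ltW -> /ltW ->].
Qed.

Lemma flat_exp_cvg c : 0 < c -> flat_exp 0 (n.+1%:R * c) @[n --> \oo] --> (1 : R).
Proof.
move=> c0.
have h : expR (- (n.+1%:R^-1 * c^-1)) @[n --> \oo] --> (1 : R).
  rewrite -[X in _ --> X](@expR0 R); apply: continuous_cvg; first exact: continuous_expR.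
  rewrite -[X in _ --> X](@oppr0 R); apply: cvgN; rewrite -[X in _ --> X](mul0r c^-1).
  by apply: cvgM; [exact: cvg_harmonic|exact: cvg_cst].
apply: cvg_trans h; apply: near_eq_cvg; apply: nearW => n /=.
by rewrite /flat_exp mulr_gt0// expr0 mul1r invfM.
Qed.

Lemma smooth_bump_cvg a b x : smooth_bump a b n x @[n --> \oo] --> (\1_(`]a, b[%classic) x : R).
Proof.
rewrite indicE; case: (boolP (x \in `]a, b[)) => xab.
  rewrite mem_set//=; move: xab; rewrite in_itv/= => /andP[ax xb].
  rewrite -(mulr1 1) [X in _ --> X](_ : _ = (1 : R) * 1); last by rewrite !mulr1.
  by apply: cvgM; apply: flat_exp_cvg; rewrite subr_gt0.
rewrite memNset//=; last exact/negP.
rewrite (_ : (fun n => _) = fun=> 0); first exact: cvg_cst.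
by apply/funext => n; rewrite smooth_bump_out.
Qed.

End TestFunctions.

(** * Absolutely continuous representatives of weakly differentiable functions *)

Section WeakDerivative.
Context (R : realType).
Local Notation mu := (@lebesgue_measure R).
Local Notation TR := (measurableTypeR R).
Local Notation D := (halfline : set TR).
Implicit Types (F f g h u v phi : R -> R) (a b c x y : R) (n k : nat).

Hint Extern 0 (measurable [set` _]) => exact: measurable_itvT : core.

Lemma mu_itv_lty a b : (mu (`]a, b]%classic : set TR) < +oo)%E.
Proof. by rewrite lebesgue_measure_itv/=; case: ifP => _; rewrite ?ltry// -EFinB ltry. Qed.

Lemma itg_cst a b c : itg (`]a, b]%classic : set TR) (fun=> c).
Proof. by apply: (itg_bounded (c := `|c|)) => //; exact: mu_itv_lty. Qed.

Lemma square_integrable_sqr f : square_integrable f -> itg D (fun x => f x ^+ 2).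
Proof. by case. Qed.

Lemma square_integrable_itg f a b : square_integrable f -> 0 <= a ->
  itg (`]a, b]%classic : set TR) f.
Proof.
move=> [mf fi] a0; have sub : `]a, b]%classic `<=` (D : set TR).
  by move=> x /=; rewrite !in_itv/= andbT => /andP[+ _]; exact: le_lt_trans.
apply: (@itg_le _ _ _ (fun x => 1 + f x ^+ 2)) => //.
- exact: measurable_funS mf.
- move=> x _; rewrite -real_normK ?num_real//.
  have := normr_ge0 (f x); move: (`|f x|) => t t0; nra.
- by apply: itgD => //; [exact: itg_cst|exact: itgS fi].
Qed.

Lemma CauchySchwarz_itv f x y : 0 <= x -> x <= y -> square_integrable f ->
  (\int[mu]_(t in `]x, y]) f t) ^+ 2 <= (y - x) * \int[mu]_(t in D) (f t) ^+ 2.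
Proof.
move=> x0; rewrite le_eqVlt => /predU1P[<- _|xy sf].
  by rewrite set_itv_ge ?bnd_simp ?ltxx// Rintegral_set0 expr0n/= subrr mul0r.
have L0 : 0 < y - x by rewrite subr_gt0.
have fi := square_integrable_itg y sf x0.
have sub : `]x, y]%classic `<=` (D : set TR).
  by move=> t /=; rewrite !in_itv/= andbT => /andP[+ _]; exact: le_lt_trans.
have f2 : itg (`]x, y]%classic : set TR) (fun t => f t ^+ 2).
  by apply: itgS sub _ => //; exact: square_integrable_sqr.
pose m := \int[mu]_(t in `]x, y]) f t.
have muxy : fine (mu (`]x, y]%classic : set TR)) = y - x.
  by rewrite lebesgue_measure_itv/= lte_fin xy -EFinB.
have h : 0 <= \int[mu]_(t in `]x, y]) (f t - m / (y - x)) ^+ 2.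
  by apply: Rintegral_ge0 => t _; exact: sqr_ge0.
have e : \int[mu]_(t in `]x, y]) (f t - m / (y - x)) ^+ 2 =
    \int[mu]_(t in `]x, y]) f t ^+ 2 - m ^+ 2 / (y - x).
  rewrite (_ : (fun t => _) = fun t => (f t ^+ 2 + - (2 * m / (y - x)) * f t) + (m / (y - x)) ^+ 2); last first.
    by apply/funext => t; ring.
  rewrite RintegralD//; [|by apply: itgD => //; exact: itgZ|exact: itg_cst].
  rewrite RintegralD//; [|exact: itgZ].
  rewrite RintegralZl// Rintegral_cst// muxy -/m; field.
  by rewrite subr_eq0 gt_eqF.
have h2 : \int[mu]_(t in `]x, y]) f t ^+ 2 <= \int[mu]_(t in D) f t ^+ 2.
  rewrite -(@setIidr _ D `]x, y]%classic)// Rintegral_mkcondr.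
  apply: le_Rintegral => //.
  - by apply: itgS measurableT _ (@subsetT _ _) _ => //; exact: itg_setT.
  - exact: square_integrable_sqr.
  - by move=> t _; rewrite patchE; case: ifP => // _; exact: sqr_ge0.
rewrite -/m -ler_pdivrMl// mulrC; apply: le_trans h2.
by rewrite -subr_ge0 -e.
Qed.

Lemma primitive_holder F f x y : primitive F f -> square_integrable f ->
  0 <= x -> x <= y -> (F y - F x) ^+ 2 <= (y - x) * \int[mu]_(t in D) (f t) ^+ 2.
Proof. by move=> Ff sf x0 xy; rewrite (primitive_diff Ff)//; exact: CauchySchwarz_itv. Qed.

Lemma square_integrable_norm f : square_integrable f -> square_integrable (fun x => `|f x|).
Proof.
move=> [mf f2]; split; first exact: measurableT_comp.
by rewrite (_ : (fun x => _) = (fun x => (f x ^+ 2)%:E))//; apply/funext => x; rewrite real_normK ?num_real.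
Qed.

(** The Sobolev bound of the supremum by the H^1 norm: the unit-interval bound on |F(x)|, followed
    by the Cauchy-Schwarz inequality on an interval of length 1. *)
Lemma primitive_sup_sqr F f x : primitive F f -> square_integrable F -> square_integrable f ->
  0 <= x -> F x ^+ 2 <= 2 * (\int[mu]_(t in D) (F t) ^+ 2 + \int[mu]_(t in D) (f t) ^+ 2).
Proof.
move=> Ff sF sf x0; have sFf := square_integrableD (square_integrable_norm sF) (square_integrable_norm sf).
have x1 : x <= x + 1 by rewrite lerDl.
have := CauchySchwarz_itv x0 x1 sFf; rewrite addrAC subrr add0r mul1r => h.
rewrite -real_normK ?num_real//; apply: le_trans (_ : _ <= (\int[mu]_(t in `]x, (x + 1)]) ((fun x => `|F x|) \+ (fun x => `|f x|)) t) ^+ 2) _.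
  by rewrite lerXn2r ?nnegrE ?Rintegral_ge0//=; exact: primitive_sup.
apply: le_trans h _.
have F2 := square_integrable_sqr sF; have f2 := square_integrable_sqr sf.
rewrite -RintegralD// -RintegralZl//; last exact: itgD.
apply: le_Rintegral => //.
- exact: square_integrable_sqr sFf.
- by apply: itgZ => //; exact: itgD.
- move=> t _ /=; rewrite -[F t ^+ 2]real_normK ?num_real// -[f t ^+ 2]real_normK ?num_real//.
  have := sqr_ge0 (`|F t| - `|f t|); lra.
Qed.

Lemma primitive_within_continuous F f : primitive F f -> square_integrable f ->
  {within `[0, +oo[, continuous F}.
Proof.
move=> Ff sf; apply/subspace_continuousP => x /=; rewrite in_itv/= andbT => x0.
pose K := \int[mu]_(t in D) (f t) ^+ 2.
have K0 : 0 <= K by apply: Rintegral_ge0 => t _; exact: sqr_ge0.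
apply/cvgrPdist_lt => e e0.
have d0 : 0 < e ^+ 2 / (K + 1) by rewrite divr_gt0 ?exprn_gt0// ltr_wpDl.
near=> y; have y0 : 0 <= y.
  have : `[0, +oo[%classic y by near: y; exact: withinT.
  by rewrite /= in_itv/= andbT.
have xy : `|x - y| < e ^+ 2 / (K + 1).
  near: y; apply: (@cvg_within _ (nbhs x)).
  exact: (nbhsx_ballx x _ d0).
rewrite -(@ltr_pXn2r _ 2)// ?nnegrE ?(ltW e0)// real_normK ?num_real//.
apply: le_lt_trans (_ : `|x - y| * K < _).
  have [xley|ylex] := leP x y.
    by rewrite ler0_norm ?subr_le0// opprB -sqrrN opprB; exact: primitive_holder Ff sf x0 xley.
  by rewrite gtr0_norm ?subr_gt0//; exact: primitive_holder Ff sf y0 (ltW ylex).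
apply: le_lt_trans (_ : `|x - y| * (K + 1) < _); first by rewrite ler_wpM2l// lerDl.
by rewrite -ltr_pdivlMr// ltr_wpDl.
Unshelve. all: by end_near. Qed.

Lemma test_function_derivable phi x : test_function phi -> derivable phi x 1.
Proof. by move=> [/(_ 0%N)]. Qed.

Lemma derivable_continuous phi : (forall x, derivable phi x 1) -> continuous phi.
Proof. by move=> d x; apply: differentiable_continuous; apply/derivable1_diffP. Qed.

Lemma test_function_continuous phi : test_function phi -> continuous phi.
Proof. by move=> tphi; apply: derivable_continuous => x; exact: test_function_derivable. Qed.

Lemma test_function_deriv phi : test_function phi -> test_function (derive1 phi).
Proof.
move=> [sphi [a [b [a0 phi0]]]]; split.
  by move=> n x; rewrite -derive1Sn.
exists a, b; split => // x xab.
rewrite derive1E (@near_eq_derive _ _ _ _ (fun=> 0)); first exact: derive_cst.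
have : open (~` `[a, b]%classic : set R) by exact/closed_openC/itv_closed.
rewrite openE => /(_ x) h; near=> y; apply: phi0; apply/negP.
by near: y; apply: h => /=; exact/negP.
Unshelve. all: by end_near. Qed.

Lemma test_function_measurable phi A : test_function phi ->
  measurable_fun (A : set TR) phi.
Proof.
move=> /test_function_continuous c; apply: (@measurable_funS _ _ _ _ (setT : set TR)) => //.
exact: continuous_measurable_fun.
Qed.

Lemma test_function_bounded phi : test_function phi -> exists C, forall x, `|phi x| <= C.
Proof.
move=> tphi; have [_ [a [b [a0 phi0]]]] := tphi.
have [ab|ba] := leP a b; last first.
  exists 0 => x; rewrite phi0 ?normr0//; rewrite in_itv/=; apply/negP => /andP[ax xb].
  by move: ba; rewrite ltNge (le_trans ax).
have [|c _ hc] := @EVT_max _ (fun x => `|phi x|) a b ab.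
  apply: continuous_subspaceT => x; apply: cvg_norm; exact: test_function_continuous.
exists (`|phi c|) => x; have [xab|xab] := boolP (x \in `[a, b]); first exact: hc.
by rewrite phi0// normr0.
Qed.

Lemma test_function_itg phi h : test_function phi ->
  (forall b, itg (`]0, b]%classic : set TR) h) -> itg D (fun x => h x * phi x).
Proof.
move=> tphi hi; have [C hC] := test_function_bounded tphi.
have [_ [a [b [a0 phi0]]]] := tphi.
have : itg D (fun x => (h \_ `]0, b]) x * phi x).
  apply: itgM_bounded (fun x _ => hC x) => //; last exact: test_function_measurable.
  by apply: itgS measurableT _ (@subsetT _ _) _ => //; exact: itg_setT.
apply: eq_integrable => // x; rewrite inE/= in_itv/= andbT => x0.
rewrite patchE; case: ifPn => // /negP xb; rewrite mul0r phi0 ?mulr0//.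
apply/negP; rewrite in_itv/= => /andP[_ h1]; apply: xb.
by rewrite inE/= in_itv/= x0.
Qed.

Lemma test_function0 phi : test_function phi -> phi 0 = 0.
Proof.
move=> [_ [a [b [a0 phi0]]]]; apply: phi0; rewrite in_itv/= negb_and.
by rewrite -ltNge a0.
Qed.

Lemma test_function_primitive phi : test_function phi -> primitive phi (derive1 phi).
Proof.
move=> tphi; apply: primitive_C1; first by move=> x; exact: test_function_derivable.
exact/test_function_continuous/test_function_deriv.
Qed.

Lemma primitive_test_by_parts F f phi : primitive F f -> test_function phi ->
  \int[mu]_(x in D) (F x * derive1 phi x) = - \int[mu]_(x in D) (f x * phi x).
Proof.
move=> Ff tphi; have Pphi := test_function_primitive tphi.
have tphi' := test_function_deriv tphi.
have i1 := test_function_itg tphi Ff.1.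
have i2 := test_function_itg tphi' (fun b => primitive_itg b Ff).
have i2' : itg D (fun x => derive1 phi x * F x).
  by rewrite (_ : (fun x => _) = fun x => F x * derive1 phi x)//; apply/funext => x; rewrite mulrC.
have := primitive_total (primitiveM Ff Pphi)
  (test_function_itg tphi (fun b => primitive_itg b Ff)) (itgD (measurable_itvT _) i1 i2').
rewrite RintegralD// (test_function0 tphi) mulr0 oppr0 => /eqP.
rewrite addrC addr_eq0 => /eqP <-; apply: eq_Rintegral => x _; exact: mulrC.
Qed.

(** The integral from - oo vanishes to the left of the support, and to its right because the mean is
    0; so the antiderivative is again compactly supported. *)
Lemma test_function_antiderivative phi : test_function phi ->
  \int[mu]_(x in D) phi x = 0 -> exists2 theta, test_function theta & derive1 theta = phi.
Proof.
move=> tphi phi_int; have [sphi [a [b [a0 phi0]]]] := tphi.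
have i1 : itg (setT : set TR) phi.
  have : itg (setT : set TR) (phi \_ `[a, b]%classic).
    apply: itg_setT => //; apply: continuous_compact_integrable.
      exact: segment_compact.
    by apply: continuous_subspaceT; exact: test_function_continuous.
  congr (mu.-integrable _ (EFin \o _)); apply/funext => x; rewrite patchE.
  by case: ifPn => // /negP xab; rewrite phi0//; apply/negP => h; apply: xab; rewrite inE.
have iS (i : interval R) : itg ([set` i] : set TR) phi.
  exact: itgS measurableT _ (@subsetT _ _) i1.
pose theta x := \int[mu]_(t in `]-oo, x]) phi t.
have dtheta x : derivable theta x 1 /\ derive1 theta x = phi x.
  have x1 : x < x + 1 by rewrite ltrDl.
  have cx : {for x, continuous phi} by apply: (test_function_continuous tphi).
  apply: (continuous_FTC1 x1 _ _ cx); last by rewrite /= ltNyr.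
  exact: (iS `]-oo, (x + 1)]).
have theta' : derive1 theta = phi by apply/funext => x; have [] := dtheta x.
exists theta => //; split.
  by move=> [|n] x; [have [] := dtheta x|rewrite derive1Sn theta'].
exists a, b; split => // x; rewrite in_itv/= negb_and -!ltNge => /orP[xa|bx].
  rewrite /theta (@eq_Rintegral _ _ _ _ _ (fun=> 0)) ?Rintegral_cst ?mul0r//.
  move=> t; rewrite inE/= in_itv/= => tx; rewrite phi0// in_itv/= negb_and -!ltNge.
  by rewrite (le_lt_trans tx xa).
rewrite /theta -phi_int Rintegral_mkcond [RHS]Rintegral_mkcond.
apply: eq_Rintegral => t _; rewrite !patchE.
have [tab|tab] := boolP (t \in `[a, b]); last by rewrite phi0//; do 2 case: ifP.
move: tab; rewrite in_itv/= => /andP[at_ tb].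
rewrite !mem_set//= in_itv/= ?andbT; first exact: lt_le_trans at_.
exact: le_trans tb (ltW bx).
Qed.

Lemma smooth_bump_Rintegral_cvg h a b : 0 < a -> (forall b, itg (`]0, b]%classic : set TR) h) ->
  \int[mu]_(x in D) (h x * smooth_bump a b n x) @[n --> \oo] -->
  \int[mu]_(x in `]a, b[) h x.
Proof.
move=> a0 hi.
have mh : measurable_fun D h by apply: measurable_fun_halfline => c; exact: itg_measurable (hi c).
have ib n := test_function_itg (test_function_smooth_bump b n a0) hi.
have E : \int[mu]_(x in `]a, b[) h x = \int[mu]_(x in D) (h x * \1_(`]a, b[%classic) x).
  rewrite -{1}(@setIidr _ D `]a, b[%classic); last first.
    by move=> x /=; rewrite !in_itv/= andbT => /andP[ax _]; exact: lt_trans ax.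
  rewrite Rintegral_mkcondr; apply: eq_Rintegral => x _; rewrite patchE indicE.
  by case: ifP => _; rewrite ?mulr1 ?mulr0.
have m1 : measurable_fun D (fun x => h x * \1_(`]a, b[%classic) x).
  by apply: measurable_funM => //; exact: measurable_indic.
have ih : itg D (h \_ `]0, b]).
  by apply: itgS measurableT _ (@subsetT _ _) _ => //; exact: itg_setT.
have ih' := itg_norm (measurable_itvT _) ih.
have dom (x t : R) : 0 < x -> 0 <= t <= 1 -> (x \notin `]a, b[ -> t = 0) ->
    `|h x * t| <= `|(h \_ `]0, b]) x|.
  move=> x0 /andP[t0 t1] ht; have [xab|/ht ->] := boolP (x \in `]a, b[); last first.
    by rewrite mulr0 normr0.
  rewrite patchE mem_set/=; first by rewrite normrM (ger0_norm t0) ler_piMr.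
  by move: xab; rewrite !in_itv/= x0 => /andP[_ /ltW].
have [|||||] := @dominated_convergence _ _ _ mu D (measurable_itvT _)
    (fun n => EFin \o (fun x => h x * smooth_bump a b n x))
    (EFin \o (fun x => h x * \1_(`]a, b[%classic) x))
    (fun x => `|(h \_ `]0, b]) x|%:E).
- by move=> n; apply/measurable_EFinP; exact: itg_measurable (ib n).
- exact/measurable_EFinP.
- apply: aeW => x _ /=; apply: cvg_EFin; first exact: nearW.
  by apply: cvgM; [exact: cvg_cst|exact: smooth_bump_cvg].
- exact: ih'.
- apply: aeW => x n /=; rewrite in_itv/= andbT => x0; rewrite lee_fin.
  by apply: dom => //; [exact: smooth_bump_itv|exact: smooth_bump_out].
move=> i1 _.
rewrite Rintegral_EFin// => /fine_cvg; rewrite -E; apply: cvg_trans.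
by apply: near_eq_cvg; exact: nearW.
Qed.

(** Integrals from a fixed left end are constantly 0, so by Lebesgue differentiation [h] vanishes
    almost everywhere to its right. The left ends 1 / (n + 1) and the cuts at [m], which make [h]
    integrable, exhaust the half-line. *)
Lemma ae_zero_of_Rintegral h : (forall b, itg (`]0, b]%classic : set TR) h) ->
  (forall a b, 0 < a -> a < b -> \int[mu]_(x in `]a, b]) h x = 0) ->
  {ae mu, forall x, D x -> h x = 0}.
Proof.
move=> hi h0.
have main (n m : nat) : {ae mu, forall x, n.+1%:R^-1 < x -> x < m%:R -> h x = 0}.
  pose f := h \_ `]0, m%:R].
  have fi : itg (setT : set TR) f by exact: itg_setT.
  have fl : locally_integrable [set: R] f.
    by apply: integrable_locally => //; exact: hi.
  have fS y : mu.-integrable [set` Interval (BRight (n.+1%:R^-1 : R)) (BRight y)] (EFin \o f).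
    exact: itgS measurableT _ (@subsetT _ _) fi.
  apply: filterS (FTC1 fS fl) => x + nx xm; rewrite /= lte_fin => /(_ nx)[_].
  rewrite /f patchE mem_set/= ?in_itv/=; last first.
    by rewrite (ltW xm) andbT (lt_trans _ nx)// invr_gt0.
  move=> <-; rewrite derive1E (@near_eq_derive _ _ _ _ (fun=> 0)); first exact: derive_cst.
  near=> y.
  have ny : n.+1%:R^-1 < y by near: y; exact: lt_nbhsr.
  have ym : y < m%:R by near: y; exact: lt_nbhsl.
  rewrite -[RHS](h0 n.+1%:R^-1 y)// ?invr_gt0//; apply: eq_Rintegral => t.
  rewrite inE/= in_itv/= => /andP[nt ty]; rewrite patchE mem_set//= in_itv/=.
  by rewrite (lt_trans _ nt) ?invr_gt0//= (le_trans ty)// ltW.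
have := ae_foralln (fun n => ae_foralln (main n)).
apply: filterS => x hx; rewrite /= in_itv/= andbT => x0.
have [N hN] := exists_invS_lt x0.
by apply: (hx N (Num.truncn x).+1); [exact: hN|exact: truncnS_gt].
Unshelve. all: by end_near. Qed.

(** A test function of mean 0 is the derivative of a test function, so [h] is orthogonal to it.
    Combining bumps that approximate the indicators of []a, b[] and of the reference interval []1,
    2[] shows that [h] has the same average on both, namely [c]. *)
Lemma du_bois_reymond h : (forall b, itg (`]0, b]%classic : set TR) h) ->
  (forall phi, test_function phi -> \int[mu]_(x in D) (h x * derive1 phi x) = 0) ->
  exists c, {ae mu, forall x, D x -> h x = c}.
Proof.
move=> hi h0.
have i1 b : itg (`]0, b]%classic : set TR) (fun=> 1) by exact: itg_cst.
pose c := \int[mu]_(x in `]1, 2[) h x; exists c.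
pose I g a b n := \int[mu]_(x in D) (g x * smooth_bump a b n x).
have mean a b : 0 < a -> a < b -> \int[mu]_(x in `]a, b[) h x = (b - a) * c.
  move=> a0 ab.
  have key n : I (fun=> 1) 1 2 n * I h a b n = I (fun=> 1) a b n * I h 1 2 n.
    have t1 := test_function_smooth_bump b n a0.
    have t2 := @test_function_smooth_bump R 1 2 n ltr01.
    have j1 := test_function_itg t1 i1; have j2 := test_function_itg t2 i1.
    have j3 := test_function_itg t1 hi; have j4 := test_function_itg t2 hi.
    set J := I (fun=> 1) 1 2 n; set K := I (fun=> 1) a b n.
    (* [J] and [K] are the masses of the two bumps, crossed so that the combination has mean 0. *)
    pose phi x := J * smooth_bump a b n x + (- K) * smooth_bump 1 2 n x.
    have tphi : test_function phi.
      split.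
        apply/smoothP => k; apply: smooth_uptoD; apply: smooth_uptoZ.
          by have [/smoothP] := t1.
        by have [/smoothP] := t2.
      exists (Num.min a 1), (Num.max b 2); split; first by rewrite lt_min a0 ltr01.
      move=> x; rewrite in_itv/= negb_and -!ltNge lt_min gt_max => xo.
      rewrite /phi !smooth_bump_out ?mulr0 ?addr0// in_itv/= negb_and -!leNgt.
        by case/orP: xo => /andP[h1 h2]; apply/orP; [left|right]; apply: ltW.
      by case/orP: xo => /andP[h1 h2]; apply/orP; [left|right]; apply: ltW.
    have [|theta ttheta theta'] := test_function_antiderivative tphi.
      pose g1 x := 1 * smooth_bump a b n x; pose g2 x := 1 * smooth_bump 1 2 n x.
      transitivity (\int[mu]_(x in D) (J * g1 x + - K * g2 x)).
        by apply: eq_Rintegral => x _; rewrite /g1 /g2 !mul1r.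
      rewrite RintegralD//; [|exact: itgZ|exact: itgZ].
      have e1 : \int[mu]_(x in D) (J * g1 x) = J * K by exact: RintegralZl.
      have e2 : \int[mu]_(x in D) (- K * g2 x) = - K * J by exact: RintegralZl.
      by rewrite e1 e2 mulrC mulNr subrr.
    have := h0 _ ttheta; rewrite theta' => hphi.
    apply/eqP; rewrite -subr_eq0; apply/eqP; rewrite -[RHS]hphi.
    transitivity (\int[mu]_(x in D)
        (J * (h x * smooth_bump a b n x) + - K * (h x * smooth_bump 1 2 n x))).
      rewrite RintegralD//; [|exact: itgZ|exact: itgZ].
      by rewrite !RintegralZl// /I; ring.
    by apply: eq_Rintegral => x _; rewrite /phi; ring.
  have lhs : I (fun=> 1) 1 2 n * I h a b n @[n --> \oo] -->
      (\int[mu]_(x in `]1, 2[) (1 : R)) * \int[mu]_(x in `]a, b[) h x.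
    by apply: cvgM; exact: smooth_bump_Rintegral_cvg.
  have rhs : I (fun=> 1) a b n * I h 1 2 n @[n --> \oo] -->
      (\int[mu]_(x in `]a, b[) (1 : R)) * c.
    by apply: cvgM; exact: smooth_bump_Rintegral_cvg.
  move: lhs; rewrite (_ : (fun n => _) = fun n => I (fun=> 1) a b n * I h 1 2 n); last exact/funext.
  move=> lhs'; have := cvg_unique (@Rhausdorff R) lhs' rhs.
  rewrite !Rintegral_cst//= !lebesgue_measure_itv/= !lte_fin ab ltr1n/=.
  rewrite !mul1r => <-; ring.
have ki b : itg (`]0, b]%classic : set TR) (fun x => h x - c).
  by apply: itgB => //; exact: itg_cst.
have : {ae mu, forall x, D x -> h x - c = 0}.
  apply: ae_zero_of_Rintegral ki _ => a b a0 ab.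
  have ha : itg (`]a, b]%classic : set TR) h.
    by apply: itg_itv => //; exact: ltW.
  rewrite RintegralB//; [|exact: itg_cst].
  rewrite -Rintegral_itv_bndo_bndc; last first.
    by apply: itgS ha => //; apply: subset_itvl; rewrite bnd_simp.
  rewrite mean// Rintegral_cst//= lebesgue_measure_itv/= lte_fin ab -EFinB/=.
  by rewrite mulrC subrr.
by apply: filterS => x + Dx => /(_ Dx) /eqP; rewrite subr_eq0 => /eqP.
Qed.

(** The difference of [u] and the integral [W] of [v] has weak derivative 0, so it is almost
    everywhere constant. *)
Lemma weak_primitive u v : square_integrable u -> square_integrable v ->
  (forall phi, test_function phi -> \int[mu]_(x in D) (u x * derive1 phi x) =
    - \int[mu]_(x in D) (v x * phi x)) ->
  exists2 F, primitive F v & {ae mu, forall x, D x -> u x = F x}.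
Proof.
move=> su sv uv.
pose W x := \int[mu]_(t in `]0, x]) v t.
have vi b : itg (`]0, b]%classic : set TR) v by exact: square_integrable_itg.
have ui b : itg (`]0, b]%classic : set TR) u by exact: square_integrable_itg.
have Wv : primitive W v.
  split=> // x x0; rewrite {2}/W set_itv_ge ?bnd_simp ?ltxx//.
  by rewrite Rintegral_set0 add0r.
have [||c hc] := @du_bois_reymond (fun x => u x - W x).
- by move=> b; apply: itgB => //; exact: primitive_itg Wv.
- move=> phi tphi; have tphi' := test_function_deriv tphi.
  transitivity (\int[mu]_(x in D) (u x * derive1 phi x - W x * derive1 phi x)).
    by apply: eq_Rintegral => x _; rewrite mulrBl.
  rewrite RintegralB//; last 2 first.
  + exact: test_function_itg.
  + by apply: test_function_itg => // b; exact: primitive_itg Wv.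
  by rewrite uv// (primitive_test_by_parts Wv)// subrr.
exists (fun x => W x + c); last first.
  by apply: filterS hc => x + Dx => /(_ Dx) <-; rewrite addrC subrK.
have := primitiveD Wv (primitive_cst c); congr primitive.
by apply/funext => x; rewrite addr0.
Qed.

Lemma primitive_weak F u v phi : primitive F v -> measurable_fun D u ->
  {ae mu, forall x, D x -> u x = F x} -> test_function phi ->
  \int[mu]_(x in D) (u x * derive1 phi x) = - \int[mu]_(x in D) (v x * phi x).
Proof.
move=> Fv mu_ uF tphi; rewrite -(primitive_test_by_parts Fv tphi).
have m' := test_function_measurable (A := D) (test_function_deriv tphi).
apply: ae_eq_Rintegral => //.
- exact: measurable_funM.
- by apply: measurable_funM => //; exact: primitive_measurable Fv.
- by apply: filterS uF => x + Dx => /(_ Dx) ->.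
Qed.

End WeakDerivative.

(** * Completeness of L^2 *)

Section SquareIntegrableComplete.
Context (R : realType).
Local Notation mu := (@lebesgue_measure R).
Local Notation TR := (measurableTypeR R).
Local Notation D := (halfline : set TR).
Implicit Types (f g h : R -> R) (x : R) (n k m : nat).

Hint Extern 0 (measurable [set` _]) => exact: measurable_itvT : core.

Lemma real_cauchy_cvg (u : nat -> R) : (forall e : R, 0 < e -> exists N, forall m n,
  (N <= m)%N -> (N <= n)%N -> `|u m - u n| < e) -> cvgn u.
Proof.
move=> h; apply: cauchy_cvg; apply: cauchy_exP => e e0; have [N hN] := h e e0.
by exists (u N), N => // n /= Nn; exact: hN.
Qed.

Lemma square_integrableB f g : square_integrable f -> square_integrable g ->
  square_integrable (fun x => f x - g x).
Proof.
move=> sf /(square_integrableZ (-1)) sg; have := square_integrableD sf sg.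
by congr square_integrable; apply/funext => x /=; rewrite mulN1r.
Qed.

Lemma geometric_increments_cvg (u : nat -> R) (s : R) :
  (forall k, `|u k.+1 - u k| <= s * 2^-1 ^+ k) -> 0 <= s ->
  cvgn u /\ forall k, `|u k - limn u| <= 2 * s * 2^-1 ^+ k.
Proof.
move=> hu s0.
have step k i : `|u (k + i)%N - u k| <= s * 2^-1 ^+ k * (2 - 2 * 2^-1 ^+ i).
  elim: i => [|i ih]; first by rewrite addn0 subrr normr0 expr0 mulr1 subrr mulr0.
  rewrite addnS -(subrKA (u (k + i)%N)) (le_trans (ler_normD _ _))//.
  apply: le_trans (lerD (hu _) ih) _; rewrite exprD exprS.
  by rewrite le_eqVlt; apply/orP; left; apply/eqP; field.
have tail k i : `|u (k + i)%N - u k| <= 2 * s * 2^-1 ^+ k.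
  apply: le_trans (step k i) _.
  have h1 : 0 <= s * 2^-1 ^+ k by rewrite mulr_ge0// exprn_ge0.
  have h2 : 0 <= 2^-1 ^+ i :> R by rewrite exprn_ge0.
  have h3 := mulr_ge0 h1 h2.
  by move: (2^-1 ^+ k) (2^-1 ^+ i) h3 => a b; lra.
have g0 : 2 * s * 2^-1 ^+ k @[k --> \oo] --> (0 : R).
  rewrite -[X in _ --> X](mulr0 (2 * s)); apply: cvgM; first exact: cvg_cst.
  by apply: cvg_expr; rewrite ger0_norm// invf_lt1// ltr1n.
have cu : cvgn u.
  apply: real_cauchy_cvg => e e0; have e2 : 0 < e / 2 by rewrite divr_gt0.
  have /cvgrPdist_lt/(_ _ e2)[N _ hN] := g0; exists N => m n Nm Nn.
  have := hN _ (leqnn N); rewrite /= sub0r normrN ger0_norm; last first.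
    by rewrite !mulr_ge0// exprn_ge0.
  move=> hN'; rewrite -(subrKA (u N)) (le_lt_trans (ler_normD _ _))// [ltRHS]splitr.
  have tN i : (N <= i)%N -> `|u i - u N| < e / 2.
    by move=> Ni; rewrite -(subnKC Ni); exact: le_lt_trans (tail _ _) hN'.
  by rewrite ltrD ?tN// distrC tN.
split=> // k.
have c2 : `|u k - u (k + i)%N| @[i --> \oo] --> `|u k - limn u|.
  apply: cvg_norm; apply: cvgB; first exact: cvg_cst.
  have cu2 : [sequence u (n + k)%N]_n @ \oo --> limn u by rewrite cvg_shiftn.
  by apply: cvg_trans cu2; apply: near_eq_cvg; apply: nearW => i /=; rewrite addnC.
rewrite -(cvg_lim _ c2)//; apply: limr_le; first by apply/cvg_ex; eexists; exact: c2.
by apply: nearW => i; rewrite distrC.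
Qed.

(** Riesz-Fischer: a rapidly converging subsequence converges almost everywhere with an explicit
    geometric rate, and the rate integrates to convergence in L^2. *)
Lemma square_integrable_complete (f : nat -> R -> R) :
  (forall n, square_integrable (f n)) ->
  (forall e : R, 0 < e -> exists N, forall m n, (N <= m)%N -> (N <= n)%N ->
    \int[mu]_(x in D) (f m x - f n x) ^+ 2 < e) ->
  exists2 g, square_integrable g & forall e : R, 0 < e -> exists N, forall n,
    (N <= n)%N -> \int[mu]_(x in D) (f n x - g x) ^+ 2 < e.
Proof.
move=> sf cf.
have /boolp.choice[N0 hN0] : forall k, exists N, forall m n, (N <= m)%N -> (N <= n)%N ->
    \int[mu]_(x in D) (f m x - f n x) ^+ 2 < 8^-1 ^+ k.
  by move=> k; apply: cf; rewrite exprn_gt0.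
(* The sum makes [nk] nondecreasing, at least [N0 k], and at least [k]. *)
pose nk k := (\sum_(i < k.+1) (N0 i).+1)%N.
have nkS k : (nk k <= nk k.+1)%N by rewrite /nk [X in (_ <= X)%N]big_ord_recr leq_addr.
have nkN k : (N0 k <= nk k)%N.
  by rewrite /nk big_ord_recr/= (leq_trans (leqnSn _))// leq_addl.
have nk_ge k : (k <= nk k)%N.
  elim: k => [//|j ih]; apply: leq_ltn_trans ih _.
  by rewrite /nk [X in (_ < X)%N]big_ord_recr/= -[X in (X < _)%N]addn0 ltn_add2l.
pose d k x := f (nk k.+1) x - f (nk k) x.
have sd k : square_integrable (d k) by exact: square_integrableB.
have d8 k : \int[mu]_(x in D) d k x ^+ 2 < 8^-1 ^+ k.
  by apply: hN0 => //; exact: leq_trans (nkS k).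
(* The weight 4^k splits the decay 8^(-k) in two: the integral of the sum [S] is at most the sum of
   the 2^(-k), which is 2, and where [S] is finite |d k| <= sqrt(S) 2^(-k). *)
pose w k x : \bar R := (4 ^+ k * d k x ^+ 2)%:E.
have w0 k x : (0 <= w k x)%E by rewrite /w lee_fin mulr_ge0 ?sqr_ge0 ?exprn_ge0.
have iw k : itg D (fun x => 4 ^+ k * d k x ^+ 2).
  by apply: itgZ => //; exact: square_integrable_sqr.
have mw k : measurable_fun D (w k).
  by apply/measurable_EFinP; exact: itg_measurable (iw k).
pose S x : \bar R := (\sum_(0 <= k <oo) w k x)%E.
have S0 x : (0 <= S x)%E by apply: nneseries_ge0 => k _ _; exact: w0.
have mS : measurable_fun D S.
  by have := ge0_emeasurable_sum (fun k x _ _ => w0 k x) (fun k (_ : predT k) => mw k).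
have intS : (\int[mu]_(x in D) S x <= 2%:E)%E.
  rewrite integral_nneseries//.
  apply: lime_le.
    by apply: is_cvg_nneseries => k _ _; apply: integral_ge0 => x _; exact: w0.
  apply: nearW => n; apply: (@le_trans _ _ (2 - 2 * 2^-1 ^+ n)%:E); last first.
    by rewrite lee_fin gerBl mulr_ge0// exprn_ge0.
  elim: n => [|n ih]; first by rewrite big_geq// lee_fin expr0 mulr1 subrr.
  rewrite big_nat_recr//=; apply: le_trans (leeD ih (_ : _ <= (2^-1 ^+ n)%:E)%E) _.
    rewrite Rintegral_EFin// lee_fin RintegralZl//; last exact: square_integrable_sqr.
    rewrite (_ : 2^-1 ^+ n = 4 ^+ n * 8^-1 ^+ n :> R); last first.
      by rewrite -exprMn; congr (_ ^+ _); field.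
    by rewrite ler_wpM2l ?exprn_ge0// ltW.
  by rewrite -EFinD lee_fin exprS; lra.
have Sfin : {ae mu, forall x, D x -> S x \is a fin_num}.
  apply: integrable_ae => //; apply/integrableP; split=> //.
  under eq_integral do rewrite gee0_abs//.
  by apply: le_lt_trans intS _; rewrite ltry.
(* The upper limit is measurable on all of [D], and it is the limit wherever [S] is finite. *)
pose g x := fine (limn_esup (fun k => (f (nk k) x)%:E)).
have mg : measurable_fun D g.
  apply: measurableT_comp; first exact: fine_measurable.
  apply: measurable_fun_limn_esup => k; apply/measurable_EFinP.
  by have [] := sf (nk k).
have fg k : {ae mu, forall x, D x -> (((f (nk k) x - g x) ^+ 2)%:E <= (4 * 4^-1 ^+ k)%:E * S x)%E}.
  apply: filterS Sfin => x + Dx => /(_ Dx) Sx.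
  pose s := Num.sqrt (fine (S x)).
  have s2 : s ^+ 2 = fine (S x) by rewrite sqr_sqrtr// fine_ge0.
  have hd j : `|f (nk j.+1) x - f (nk j) x| <= s * 2^-1 ^+ j.
    rewrite -(@ler_pXn2r _ 2)// ?nnegrE ?mulr_ge0 ?sqrtr_ge0 ?exprn_ge0//.
    rewrite real_normK ?num_real// exprMn s2 -exprM mulnC exprM.
    rewrite (_ : 2^-1 ^+ 2 = 4^-1 :> R); last by field.
    rewrite exprVn ler_pdivlMr ?exprn_gt0// -lee_fin fineK// mulrC.
    have := @nneseries_lim_ge _ (fun k => w k x) predT 0%N j.+1 (fun n _ _ => w0 n x).
    apply: le_trans; rewrite big_nat_recr//= leeDr//.
    by apply: sume_ge0 => i _; exact: w0.
  have [cu] := geometric_increments_cvg hd (sqrtr_ge0 _); move=> /(_ k).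
  have -> : limn (fun k => f (nk k) x) = g x.
    have cE : (f (nk k) x)%:E @[k --> \oo] --> (limn (fun k => f (nk k) x))%:E.
      by apply: cvg_EFin; [exact: nearW|exact: cu].
    rewrite /g is_cvg_limn_esupE; first by rewrite (cvg_lim _ cE).
    by apply/cvg_ex; eexists; exact: cE.
  move=> h; rewrite -(fineK Sx) -EFinM lee_fin -s2 -real_normK ?num_real//.
  have -> : 4 * 4^-1 ^+ k * s ^+ 2 = (2 * s * 2^-1 ^+ k) ^+ 2.
    rewrite !exprMn -exprM mulnC exprM (_ : 2^-1 ^+ 2 = 4^-1 :> R); last by field.
    by ring.
  by rewrite lerXn2r ?nnegrE ?mulr_ge0 ?sqrtr_ge0 ?exprn_ge0.
have fg_int k : (\int[mu]_(x in D) ((f (nk k) x - g x) ^+ 2)%:E <= (8 * 4^-1 ^+ k)%:E)%E.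
  apply: (@le_trans _ _ (\int[mu]_(x in D) ((4 * 4^-1 ^+ k)%:E * S x))%E).
    apply: ae_ge0_le_integral => //.
    - by move=> x _; rewrite lee_fin sqr_ge0.
    - apply/measurable_EFinP; apply: measurable_funX; apply: measurable_funB => //.
      by have [] := sf (nk k).
    - by move=> x _; rewrite mule_ge0// lee_fin mulr_ge0// exprn_ge0.
    - exact: measurable_funeM.
  rewrite ge0_integralZl//.
  rewrite (_ : 8 * 4^-1 ^+ k = 4 * 4^-1 ^+ k * 2 :> R); last by ring.
  by rewrite [X in (_ <= X)%E]EFinM lee_pmul2l// lte_fin mulr_gt0// exprn_gt0.
have sfg k : square_integrable (fun x => f (nk k) x - g x).
  have m : measurable_fun D (fun x => f (nk k) x - g x).
    by apply: measurable_funB => //; have [] := sf (nk k).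
  split => //; apply/integrableP; split.
    by apply/measurable_EFinP; exact: measurable_funX.
  under eq_integral do rewrite gee0_abs ?lee_fin ?sqr_ge0//.
  by apply: le_lt_trans (fg_int k) _; rewrite ltry.
have sg : square_integrable g.
  have := square_integrableB (sf (nk 0%N)) (sfg 0%N).
  by congr square_integrable; apply/funext => x; rewrite opprB addrC subrK.
exists g => // e e0; have e4 : 0 < e / 4 by rewrite divr_gt0.
have [M hM] := cf _ e4.
have g0 : 8 * 4^-1 ^+ k @[k --> \oo] --> (0 : R).
  rewrite -[X in _ --> X](mulr0 (8 : R)); apply: cvgM; first exact: cvg_cst.
  by apply: cvg_expr; rewrite ger0_norm// invf_lt1// ltr1n.
have /cvgrPdist_lt/(_ _ e4)[K _ hK] := g0.
exists M => n Mn; pose k := maxn K M.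
have := hK k (leq_maxl _ _); rewrite /= sub0r normrN ger0_norm; last first.
  by rewrite mulr_ge0// exprn_ge0.
have := fg_int k; rewrite Rintegral_EFin; [|by []|exact: square_integrable_sqr (sfg k)].
rewrite lee_fin => h1 h2.
have h3 : \int[mu]_(x in D) (f n x - f (nk k) x) ^+ 2 < e / 4.
  by apply: hM => //; apply: leq_trans (nk_ge k); exact: leq_maxr.
have i1 := square_integrable_sqr (square_integrableB (sf n) (sf (nk k))).
have i2 := square_integrable_sqr (sfg k).
apply: (@le_lt_trans _ _ (2 * \int[mu]_(x in D) (f n x - f (nk k) x) ^+ 2 +
    2 * \int[mu]_(x in D) (f (nk k) x - g x) ^+ 2)); last by lra.
rewrite -!RintegralZl// -RintegralD//; [|exact: itgZ|exact: itgZ].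
apply: le_Rintegral => //.
- exact: square_integrable_sqr (square_integrableB (sf n) sg).
- by apply: itgD => //; exact: itgZ.
- move=> x _; have := sqr_ge0 ((f n x - f (nk k) x) - (f (nk k) x - g x)); nra.
Qed.

End SquareIntegrableComplete.

(** * Almost everywhere calculus and completeness in the complex L^2 *)

Section L2Facts.
Context (R : realType).
Local Open Scope quotient_scope.
Local Notation mu := (@lebesgue_measure R).
Local Notation TR := (measurableTypeR R).
Local Notation D := (halfline : set TR).
Local Notation Re := complex.Re.
Local Notation Im := complex.Im.
Local Notation dot := (@L2dot R).
Implicit Types (u v w : L2 R) (f g : R -> R) (x : R).

Hint Extern 0 (measurable [set` _]) => exact: measurable_itvT : core.

Lemma L2_square_integrable u :
  square_integrable (fun x => Re (u x)) /\ square_integrable (fun x => Im (u x)).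
Proof. by have := L2fun_valP (repr u); rewrite inE. Qed.

Lemma L2_Re u : square_integrable (fun x => Re (u x)).
Proof. by have [] := L2_square_integrable u. Qed.

Lemma L2_Im u : square_integrable (fun x => Im (u x)).
Proof. by have [] := L2_square_integrable u. Qed.

Lemma exists_L2 f g : square_integrable f -> square_integrable g ->
  exists u, {ae mu, forall x, D x -> u x = f x +i* g x}.
Proof.
move=> sf sg.
have h : (fun x => f x +i* g x) \in @csqint R by rewrite inE; split.
by exists (\pi_(L2 R) (MkL2fun h)); exact: (L2_reprE (MkL2fun h)).
Qed.

Lemma L2_ext u v : {ae mu, forall x, D x -> u x = v x} -> u = v.
Proof. by move=> uv; rewrite -[u]reprK -[v]reprK; apply/eq_L2P. Qed.

Lemma L2D_ae u v : {ae mu, forall x, D x -> (u + v : L2 R) x = u x + v x}.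
Proof.
have -> : u + v = \pi_(L2 R) (repr u + repr v).
  by rewrite -[in LHS](reprK u) -[in LHS](reprK v); apply/esym; exact: Quotient.pi_add.
exact: L2_reprE.
Qed.

Lemma L2Z_ae (c : R[i]) u : {ae mu, forall x, D x -> (c *: u : L2 R) x = c * u x}.
Proof. exact: (L2_reprE (c *: repr u)). Qed.

Lemma L2B_ae u v : {ae mu, forall x, D x -> (u - v : L2 R) x = u x - v x}.
Proof.
have := L2D_ae u (-1 *: v); have := L2Z_ae (-1) v; rewrite scaleN1r.
by apply: filterS2 => x h1 h2 Dx; rewrite h2// h1// mulN1r.
Qed.

Lemma L20_ae : {ae mu, forall x, D x -> (0 : L2 R) x = 0}.
Proof.
have := L2Z_ae 0 0; rewrite scaler0.
by apply: filterS => x + Dx => ->//; rewrite mul0r.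
Qed.

Lemma itg_mul f g : square_integrable f -> square_integrable g ->
  itg D (fun x => f x * g x).
Proof. exact: square_integrableM. Qed.

Lemma L2dotE_Re u v : Re (dot u v) =
  \int[mu]_(x in D) (Re (u x) * Re (v x)) + \int[mu]_(x in D) (Im (u x) * Im (v x)).
Proof.
rewrite -RintegralD//; [|exact: (itg_mul (L2_Re u) (L2_Re v))|exact: (itg_mul (L2_Im u) (L2_Im v))].
rewrite /L2dot /cintegral/=; apply: eq_Rintegral => x _.
by case: (u x) (v x) => [a b] [c d] /=; rewrite mulrN opprK.
Qed.

Lemma L2dotE_Im u v : Im (dot u v) =
  \int[mu]_(x in D) (Im (u x) * Re (v x)) - \int[mu]_(x in D) (Re (u x) * Im (v x)).
Proof.
rewrite -RintegralB//; [|exact: (itg_mul (L2_Im u) (L2_Re v))|exact: (itg_mul (L2_Re u) (L2_Im v))].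
rewrite /L2dot /cintegral/=; apply: eq_Rintegral => x _.
by case: (u x) (v x) => [a b] [c d] /=; rewrite mulrN addrC.
Qed.

Lemma rdot_ae u f g : measurable_fun D f -> measurable_fun D g ->
  {ae mu, forall x, D x -> u x = f x +i* g x} ->
  Re (dot u u) = \int[mu]_(x in D) (f x) ^+ 2 + \int[mu]_(x in D) (g x) ^+ 2.
Proof.
move=> mf mg ufg; rewrite L2dotE_Re; congr (_ + _).
  apply: ae_eq_Rintegral => //.
  - by apply: measurable_funM; have [] := L2_Re u.
  - exact: measurable_funX.
  - by apply: filterS ufg => x + Dx => ->.
apply: ae_eq_Rintegral => //.
- by apply: measurable_funM; have [] := L2_Im u.
- exact: measurable_funX.
- by apply: filterS ufg => x + Dx => ->.
Qed.

Lemma L2_complete : hcomplete dot.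
Proof.
move=> u0 cu0; pose u : nat -> L2 R := u0; have cu : hcauchy dot u := cu0.
have sub m n : Re (dot (u m - u n) (u m - u n)) =
    \int[mu]_(x in D) (Re (u m x) - Re (u n x)) ^+ 2 +
    \int[mu]_(x in D) (Im (u m x) - Im (u n x)) ^+ 2.
  apply: (@rdot_ae _ (fun x => Re (u m x) - Re (u n x)) (fun x => Im (u m x) - Im (u n x))).
  - by have [] := square_integrableB (L2_Re (u m)) (L2_Re (u n)).
  - by have [] := square_integrableB (L2_Im (u m)) (L2_Im (u n)).
  - apply: filterS (L2B_ae (u m) (u n)) => x + Dx => -> //.
    by case: (u m x) (u n x) => [a b] [c d].
have small e : 0 < e -> exists N, forall m n, (N <= m)%N -> (N <= n)%N ->
    Re (dot (u m - u n) (u m - u n)) < e.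
  move=> e0; have se : 0 < Num.sqrt e by rewrite sqrtr_gt0.
  have [N hN] := cu _ se; exists N => m n Nm Nn.
  by rewrite -sqr_hnorm -[ltRHS]sqr_sqrtr ?(ltW e0)// ltr_pXn2r ?nnegrE ?hnorm_ge0 ?sqrtr_ge0// hN.
have pos (h : R -> R) : 0 <= \int[mu]_(x in D) (h x) ^+ 2.
  by apply: Rintegral_ge0 => x _; exact: sqr_ge0.
have [f sf uf] := @square_integrable_complete R (fun n x => Re (u n x))
  (fun n => L2_Re (u n)) (fun e e0 => ltac:(
    have [N hN] := small _ e0; exists N => m n Nm Nn;
    apply: le_lt_trans (hN _ _ Nm Nn); by rewrite sub lerDl pos)).
have [g sg ug] := @square_integrable_complete R (fun n x => Im (u n x))
  (fun n => L2_Im (u n)) (fun e e0 => ltac:(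
    have [N hN] := small _ e0; exists N => m n Nm Nn;
    apply: le_lt_trans (hN _ _ Nm Nn); by rewrite sub lerDr pos)).
have [l lfg] := exists_L2 sf sg; exists l; apply/hcvgP => e e0.
have e2 : 0 < e ^+ 2 / 2 by rewrite divr_gt0// exprn_gt0.
have [N1 hN1] := uf _ e2; have [N2 hN2] := ug _ e2.
exists (maxn N1 N2) => n; rewrite geq_max => /andP[n1 n2].
apply: lt_hnorm_sqr => //.
rewrite (@rdot_ae _ (fun x => Re (u n x) - f x) (fun x => Im (u n x) - g x)).
- by rewrite [ltRHS]splitr ltrD ?hN1 ?hN2.
- by have [] := square_integrableB (L2_Re (u n)) sf.
- by have [] := square_integrableB (L2_Im (u n)) sg.
- apply: filterS2 (L2B_ae (u n) l) lfg => x h1 h2 Dx; rewrite h1// h2//.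
  by case: (u n x).
Qed.

End L2Facts.

(** * Weak derivatives and multiplication operators in the complex L^2 *)

Section WeakDerivativeL2.
Context (R : realType).
Local Notation mu := (@lebesgue_measure R).
Local Notation TR := (measurableTypeR R).
Local Notation D := (halfline : set TR).
Local Notation Re := complex.Re.
Local Notation Im := complex.Im.
Local Notation dot := (@L2dot R).
Implicit Types (u v w : L2 R) (f g F G : R -> R) (x : R).

Hint Extern 0 (measurable [set` _]) => exact: measurable_itvT : core.

Lemma ReM_real (z : R[i]) (a : R) : Re (z * a%:C) = Re z * a.
Proof. by case: z => p q /=; rewrite mulr0 subr0. Qed.

Lemma ImM_real (z : R[i]) (a : R) : Im (z * a%:C) = Im z * a.
Proof. by case: z => p q /=; rewrite mulr0 add0r. Qed.

Lemma ReMl_real (z : R[i]) (a : R) : Re (a%:C * z) = a * Re z.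
Proof. by rewrite mulrC ReM_real mulrC. Qed.

Lemma ImMl_real (z : R[i]) (a : R) : Im (a%:C * z) = a * Im z.
Proof. by rewrite mulrC ImM_real mulrC. Qed.

Lemma weak_derivativeP u v : weak_derivative u v <-> forall phi, test_function phi ->
  (\int[mu]_(x in D) (Re (u x) * derive1 phi x) = - (\int[mu]_(x in D) (Re (v x) * phi x))) /\
  (\int[mu]_(x in D) (Im (u x) * derive1 phi x) = - (\int[mu]_(x in D) (Im (v x) * phi x))).
Proof.
have E (z : R -> R[i]) (h : R -> R) : cintegral (fun x => z x * (h x)%:C) =
    (\int[mu]_(x in D) (Re (z x) * h x)) +i* (\int[mu]_(x in D) (Im (z x) * h x)).
  by rewrite /cintegral; congr (_ +i* _); apply: eq_Rintegral => x _; rewrite ?ReM_real ?ImM_real.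
split=> [h phi tphi|h phi tphi].
  by have := h _ tphi; rewrite !E => -[-> ->].
have [h1 h2] := h _ tphi; rewrite !E h1 h2; apply/eqP.
by rewrite eq_complex /= !eqxx.
Qed.

Lemma weak_rep u v : weak_derivative u v -> exists F G,
  [/\ primitive F (fun x => Re (v x)), primitive G (fun x => Im (v x)) &
      {ae mu, forall x, D x -> u x = F x +i* G x}].
Proof.
move=> /weak_derivativeP uv.
have [F PF uF] := weak_primitive (L2_Re u) (L2_Re v) (fun phi t => (uv phi t).1).
have [G PG uG] := weak_primitive (L2_Im u) (L2_Im v) (fun phi t => (uv phi t).2).
exists F, G; split => //; apply: filterS2 uF uG => x hF hG Dx.
by rewrite -hF// -hG//; case: (u x).
Qed.

Lemma rep_weak u v F f G g : primitive F f -> primitive G g ->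
  {ae mu, forall x, D x -> u x = F x +i* G x} ->
  {ae mu, forall x, D x -> v x = f x +i* g x} -> weak_derivative u v.
Proof.
move=> PF PG uFG vfg; apply/weak_derivativeP => phi tphi; split.
- apply: (@primitive_weak _ F) => //.
  + apply: (primitive_ae PF); first by have [] := L2_Re v.
    by apply: filterS vfg => x h Dx; rewrite h.
  + by have [] := L2_Re u.
  + by apply: filterS uFG => x h Dx; rewrite h.
- apply: (@primitive_weak _ G) => //.
  + apply: (primitive_ae PG); first by have [] := L2_Im v.
    by apply: filterS vfg => x h Dx; rewrite h.
  + by have [] := L2_Im u.
  + by apply: filterS uFG => x h Dx; rewrite h.
Qed.

Lemma square_integrable_ae f g : square_integrable f -> measurable_fun D g ->
  {ae mu, forall x, D x -> f x = g x} -> square_integrable g.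
Proof.
move=> [mf f2] mg fg; split => //.
apply: (@itg_ae_eq _ _ (fun x => f x ^+ 2)) => //; first exact: measurable_funX.
by apply: filterS fg => x h Dx; rewrite h.
Qed.

Lemma rep_square_integrable u F f G g : primitive F f -> primitive G g ->
  {ae mu, forall x, D x -> u x = F x +i* G x} ->
  square_integrable F /\ square_integrable G.
Proof.
move=> PF PG uFG; split.
  apply: (square_integrable_ae (L2_Re u)); first exact: primitive_measurable PF.
  by apply: filterS uFG => x h Dx; rewrite h.
apply: (square_integrable_ae (L2_Im u)); first exact: primitive_measurable PG.
by apply: filterS uFG => x h Dx; rewrite h.
Qed.

Lemma square_integrableM_bounded f g c : square_integrable f -> measurable_fun D g ->
  (forall x, D x -> `|g x| <= c) -> square_integrable (fun x => g x * f x).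
Proof.
move=> [mf f2] mg gc; split; first exact: measurable_funM.
have : itg D (fun x => f x ^+ 2 * g x ^+ 2).
  apply: (itgM_bounded (c := c ^+ 2)) => //; first exact: measurable_funX.
  move=> x Dx; rewrite ger0_norm ?sqr_ge0// -real_normK ?num_real//.
  by rewrite lerXn2r ?nnegrE ?gc// (le_trans _ (gc _ Dx)).
congr (mu.-integrable _ (EFin \o _)); apply/funext => x; rewrite exprMn; exact: mulrC.
Qed.

Lemma exists_multiplication u (m : R -> R) c : measurable_fun D m ->
  (forall x, D x -> `|m x| <= c) -> exists v, multiplication_operator m (u, v).
Proof.
move=> mm mc.
have [v hv] := exists_L2 (square_integrableM_bounded (L2_Re u) mm mc)
  (square_integrableM_bounded (L2_Im u) mm mc).
exists v; apply: filterS hv => x h Dx; rewrite h//=.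
by case: (u x) => a b; apply/eqP; rewrite eq_complex /= !mul0r subr0 addr0 !eqxx.
Qed.

Lemma multiplication_Re m u v : multiplication_operator m (u, v) ->
  {ae mu, forall x, D x -> Re (v x) = m x * Re (u x)}.
Proof. by apply: filterS => x h Dx; rewrite h// ReMl_real. Qed.

Lemma multiplication_Im m u v : multiplication_operator m (u, v) ->
  {ae mu, forall x, D x -> Im (v x) = m x * Im (u x)}.
Proof. by apply: filterS => x h Dx; rewrite h// ImMl_real. Qed.

Lemma linear_multiplication (m : R -> R) : linear_operator (multiplication_operator m).
Proof.
split.
- by apply: filterS (@L20_ae R) => x h Dx /=; rewrite h// mulr0.
- move=> c [u u'] [v v'] /= hu hv; rewrite /multiplication_operator /=.
  have h1 := L2D_ae (c *: u) v; have h2 := L2Z_ae c u.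
  have h3 := L2D_ae (c *: u') v'; have h4 := L2Z_ae c u'.
  near=> x => Dx.
  rewrite (near h1 x)// (near h2 x)// (near h3 x)// (near h4 x)//.
  by rewrite (near hu x)// (near hv x)//= mulrDr mulrCA.
- move=> u v w hv hw; apply: L2_ext; apply: filterS2 hv hw => x h1 h2 Dx.
  by rewrite h1// h2.
Unshelve. all: by end_near. Qed.

Lemma symmetric_multiplication (m : R -> R) : measurable_fun D m ->
  symmetric_operator dot (multiplication_operator m).
Proof.
move=> mm u v u' v' uv uv'.
have main u1 v1 u2 v2 : multiplication_operator m (u1, v1) ->
    multiplication_operator m (u2, v2) -> Re (dot v1 u2) = Re (dot u1 v2).
  move=> h1 h2; rewrite !L2dotE_Re; congr (_ + _); apply: ae_eq_Rintegral => //.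
  - exact: measurable_funM (L2_Re v1).1 (L2_Re u2).1.
  - exact: measurable_funM (L2_Re u1).1 (L2_Re v2).1.
  - apply: filterS2 (multiplication_Re h1) (multiplication_Re h2) => x e1 e2 Dx.
    by rewrite e1// e2//; ring.
  - exact: measurable_funM (L2_Im v1).1 (L2_Im u2).1.
  - exact: measurable_funM (L2_Im u1).1 (L2_Im v2).1.
  - apply: filterS2 (multiplication_Im h1) (multiplication_Im h2) => x e1 e2 Dx.
    by rewrite e1// e2//; ring.
apply: dot_ext; first exact: main.
apply: main => //; exact: linopZ (linear_multiplication m) uv.
Qed.

Lemma multiplication_bound (m : R -> R) c u v : measurable_fun D m ->
  (forall x, D x -> `|m x| <= c) -> multiplication_operator m (u, v) ->
  Re (dot v v) <= c ^+ 2 * Re (dot u u).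
Proof.
move=> mm mc uv.
have sq (h : R -> R) x : D x -> (m x * h x) ^+ 2 <= c ^+ 2 * h x ^+ 2.
  move=> Dx; rewrite exprMn ler_wpM2r ?sqr_ge0// -real_normK ?num_real//.
  by rewrite lerXn2r ?nnegrE ?mc// (le_trans _ (mc _ Dx)).
have sR := square_integrableM_bounded (L2_Re u) mm mc.
have sI := square_integrableM_bounded (L2_Im u) mm mc.
rewrite (@rdot_ae _ v (fun x => m x * Re (u x)) (fun x => m x * Im (u x)) sR.1 sI.1); last first.
  apply: filterS2 (multiplication_Re uv) (multiplication_Im uv) => x h1 h2 Dx.
  by rewrite -h1// -h2//; case: (v x).
rewrite (@rdot_ae _ u (fun x => Re (u x)) (fun x => Im (u x)) (L2_Re u).1 (L2_Im u).1); last first.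
  by apply: nearW => x Dx; case: (u x).
have iR := square_integrable_sqr (L2_Re u); have iI := square_integrable_sqr (L2_Im u).
rewrite mulrDr -!RintegralZl//; apply: lerD; apply: le_Rintegral => //.
- exact: square_integrable_sqr.
- exact: itgZ.
- by move=> x Dx; exact: (sq (fun x => Re (u x)) _ Dx).
- exact: square_integrable_sqr.
- exact: itgZ.
- by move=> x Dx; exact: (sq (fun x => Im (u x)) _ Dx).
Qed.

Lemma test_function_square_integrable (phi : R -> R) : test_function phi -> square_integrable phi.
Proof.
move=> tphi; split; first exact: test_function_measurable.
have i1 b : itg (`]0, b]%classic : set TR) (fun=> 1) by exact: itg_cst.
have [C hC] := test_function_bounded tphi.
have := itgM_bounded (measurable_itvT `]0, +oo[) (test_function_itg tphi i1)
  (test_function_measurable tphi) (fun x _ => hC x).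
congr (mu.-integrable _ _); apply/funext => x /=.
by rewrite mul1r expr2.
Qed.

Lemma exists_real_L2 f : square_integrable f ->
  exists u, {ae mu, forall x, D x -> u x = (f x)%:C}.
Proof. by move=> sf; have := exists_L2 sf square_integrable0. Qed.

(** Turns the pairing with a test function into an inner product of L^2, through which weak
    derivatives pass to limits and linear combinations. *)
Lemma dot_real_ae u v f : measurable_fun D f ->
  {ae mu, forall x, D x -> v x = (f x)%:C} ->
  dot u v = cintegral (fun x => u x * (f x)%:C).
Proof.
move=> mf vf.
have mRu := (L2_Re u).1; have mIu := (L2_Im u).1.
have mRv := (L2_Re v).1; have mIv := (L2_Im v).1.
apply/eqP; rewrite eq_complex L2dotE_Re L2dotE_Im /cintegral/=; apply/andP; split; apply/eqP.
- rewrite [X in _ + X](_ : _ = 0); last first.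
    rewrite (ae_eq_Rintegral (g := fun=> 0))//; [|exact: measurable_funM|].
      by rewrite /Rintegral integral0.
    by apply: filterS vf => x h Dx; rewrite h//= mulr0.
  rewrite addr0; apply: ae_eq_Rintegral => //; first exact: measurable_funM.
    rewrite (_ : (fun x => _) = fun x => Re (u x) * f x); last first.
      by apply/funext => x; exact: ReM_real.
    exact: measurable_funM.
  by apply: filterS vf => x h Dx; rewrite h//; apply/esym; exact: ReM_real.
- rewrite [X in _ - X](_ : _ = 0); last first.
    rewrite (ae_eq_Rintegral (g := fun=> 0))//; [|exact: measurable_funM|].
      by rewrite /Rintegral integral0.
    by apply: filterS vf => x h Dx; rewrite h//= mulr0.
  rewrite subr0; apply: ae_eq_Rintegral => //; first exact: measurable_funM.
    rewrite (_ : (fun x => _) = fun x => Im (u x) * f x); last first.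
      by apply/funext => x; exact: ImM_real.
    exact: measurable_funM.
  by apply: filterS vf => x h Dx; rewrite h//; apply/esym; exact: ImM_real.
Qed.

Lemma weak_derivative_dot u v (phi : R -> R) (p p' : L2 R) : test_function phi ->
  {ae mu, forall x, D x -> p x = (phi x)%:C} ->
  {ae mu, forall x, D x -> p' x = (derive1 phi x)%:C} ->
  weak_derivative u v -> dot u p' = - dot v p.
Proof.
move=> tphi hp hp' uv.
rewrite (dot_real_ae u (test_function_measurable (test_function_deriv tphi)) hp').
by rewrite (dot_real_ae v (test_function_measurable tphi) hp); exact: uv.
Qed.

Lemma dot_weak_derivative u v : (forall (phi : R -> R) (p p' : L2 R), test_function phi ->
  {ae mu, forall x, D x -> p x = (phi x)%:C} ->
  {ae mu, forall x, D x -> p' x = (derive1 phi x)%:C} ->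
  dot u p' = - dot v p) -> weak_derivative u v.
Proof.
move=> h phi tphi.
have [p hp] := exists_real_L2 (test_function_square_integrable tphi).
have [p' hp'] := exists_real_L2 (test_function_square_integrable (test_function_deriv tphi)).
rewrite -(dot_real_ae u (test_function_measurable (test_function_deriv tphi)) hp').
by rewrite -(dot_real_ae v (test_function_measurable tphi) hp); exact: h hp hp'.
Qed.

Lemma weak_derivative_closed (u v : nat -> L2 R) l k :
  (forall n, weak_derivative (u n) (v n)) -> hcvg dot u l -> hcvg dot v k ->
  weak_derivative l k.
Proof.
move=> uv ul vk; apply: dot_weak_derivative => phi p p' tphi hp hp'.
rewrite -(dotNl dot); apply: (hcvg_dotl_eq ul (hcvgN vk)) => n.
by rewrite dotNl; exact: (weak_derivative_dot tphi hp hp' (uv n)).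
Qed.

Lemma weak_derivativeZD (c : R[i]) u v u' v' : weak_derivative u v ->
  weak_derivative u' v' -> weak_derivative (c *: u + u') (c *: v + v').
Proof.
move=> uv uv'; apply: dot_weak_derivative => phi p p' tphi hp hp'.
have e1 : dot (c *: u + u') p' = c * dot u p' + dot u' p' := L2dot_linearl p' c u u'.
have e2 : dot (c *: v + v') p = c * dot v p + dot v' p := L2dot_linearl p c v v'.
rewrite e1 e2 (weak_derivative_dot tphi hp hp' uv).
by rewrite (weak_derivative_dot tphi hp hp' uv') mulrN opprD.
Qed.

Lemma weak_derivative0 : weak_derivative (0 : L2 R) 0.
Proof.
by apply: dot_weak_derivative => phi p p' _ _ _; rewrite !(dot0l dot) oppr0.
Qed.

Lemma test_orthogonal_zero f : (forall b, itg (`]0, b]%classic : set TR) f) ->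
  (forall phi, test_function phi -> \int[mu]_(x in D) (f x * phi x) = 0) ->
  {ae mu, forall x, D x -> f x = 0}.
Proof.
move=> fi f0; apply: ae_zero_of_Rintegral (fi) _ => a b a0 ab.
have ia : itg (`]a, b]%classic : set TR) f by apply: itg_itv => //; exact: ltW.
rewrite -Rintegral_itv_bndo_bndc; last first.
  by apply: itgS ia => //; apply: subset_itvl; rewrite bnd_simp.
have := smooth_bump_Rintegral_cvg (b := b) a0 fi.
rewrite (_ : (fun n => _) = fun=> 0); last first.
  by apply/funext => n; exact: f0 (test_function_smooth_bump b n a0).
by move=> /(cvg_unique (@Rhausdorff R) (@cvg_cst _ _ _ _ _)) <-.
Qed.

Lemma weak_derivative_uniq u v v' : weak_derivative u v -> weak_derivative u v' -> v = v'.
Proof.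
move=> uv uv'.
have := weak_derivativeZD (-1) uv uv'; rewrite !scaleN1r addNr addrC.
move=> /weak_derivativeP h; apply/esym/eqP; rewrite -subr_eq0; apply/eqP/L2_ext.
have z1 (g : R -> R) phi : measurable_fun D g -> {ae mu, forall x, D x -> g x = 0} ->
    test_function phi -> \int[mu]_(x in D) (g x * derive1 phi x) = 0.
  move=> mg g0 tphi; transitivity (\int[mu]_(x in D) (0 : R)).
    apply: ae_eq_Rintegral => //.
      exact: measurable_funM (test_function_measurable (test_function_deriv tphi)).
    by apply: filterS g0 => x e Dx; rewrite e// mul0r.
  by rewrite /Rintegral integral0.
have z0 phi : test_function phi ->
    \int[mu]_(x in D) (Re ((0 : L2 R) x) * derive1 phi x) = 0 /\
    \int[mu]_(x in D) (Im ((0 : L2 R) x) * derive1 phi x) = 0.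
  move=> tphi; split; apply: z1 => //.
  - exact: (L2_Re 0).1.
  - by apply: filterS (@L20_ae R) => x e Dx; rewrite e.
  - exact: (L2_Im 0).1.
  - by apply: filterS (@L20_ae R) => x e Dx; rewrite e.
have hR : {ae mu, forall x, D x -> Re ((v' - v : L2 R) x) = 0}.
  apply: test_orthogonal_zero => [b|phi tphi].
    by apply: square_integrable_itg => //; exact: L2_Re.
  have [h1 _] := h _ tphi; have [h2 _] := z0 _ tphi.
  by apply/eqP; rewrite -oppr_eq0 -h1 h2.
have hI : {ae mu, forall x, D x -> Im ((v' - v : L2 R) x) = 0}.
  apply: test_orthogonal_zero => [b|phi tphi].
    by apply: square_integrable_itg => //; exact: L2_Im.
  have [_ h1] := h _ tphi; have [_ h2] := z0 _ tphi.
  by apply/eqP; rewrite -oppr_eq0 -h1 h2.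
have z := @L20_ae R.
near=> x => Dx; rewrite (near z x)//.
apply/eqP; rewrite eq_complex; apply/andP; split; apply/eqP; first exact: (near hR x).
exact: (near hI x).
Unshelve. all: by end_near. Qed.

(** A nonzero value at 0 would persist on some []0, d[], a set of positive measure. *)
Lemma within_continuous_ae_zero f : {within `[0, +oo[, continuous f} ->
  {ae mu, forall x, D x -> f x = 0} -> f 0 = 0.
Proof.
move=> cf [N [mN N0 subN]]; apply/eqP; apply: contrapT => /negP f0.
have f0' : 0 < `|f 0| by rewrite normr_gt0.
have : f @ within `[0, +oo[ (nbhs (0 : R)) --> f 0.
  by move/subspace_continuousP : cf; apply; rewrite /= in_itv/= lexx.
move=> /cvgrPdist_lt/(_ _ f0').
rewrite near_withinE => -[d /= d0 hd].
have sub : `]0, d[%classic `<=` N.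
  move=> x /=; rewrite in_itv/= => /andP[x0 xd]; apply: subN => /= h.
  have := hd x; rewrite /ball_/= sub0r normrN gtr0_norm// => /(_ xd).
  rewrite in_itv/= andbT => /(_ (ltW x0)); rewrite h ?subr0 ?ltxx//.
  by rewrite /= in_itv/= x0.
pose I : set TR := `]0, d[%classic.
have : (mu I <= mu N)%E by apply: le_measure => //; rewrite inE//; exact: measurable_itvT.
by rewrite /I N0 lebesgue_measure_itv/= lte_fin d0 sube0 lee_fin leNgt d0.
Qed.

End WeakDerivativeL2.

(** * Factorization of the Neumann operator *)

Section GroundState.
Context (R : realType).
Local Notation mu := (@lebesgue_measure R).
Local Notation TR := (measurableTypeR R).
Local Notation D := (halfline : set TR).
Implicit Types (u v w g h : L2 R) (x : R).

Hint Extern 0 (measurable [set` _]) => exact: measurable_itvT : core.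

Definition ground_state x : R := (x ^+ 2 + 1)^-1.
(** Since psi' = - 2 x psi^2, this is w = psi' / psi. The next definition is its derivative - 2 (psi
    + x psi'), with psi' written as w psi. *)
Definition log_deriv x : R := - 2 * (x * ground_state x).
Definition log_deriv' x : R := - 2 * (ground_state x + log_deriv x * ground_state x * x).

Local Notation psi := ground_state.
Local Notation w0 := log_deriv.
Local Notation w1 := log_deriv'.

Lemma ground_state_itv x : 0 < psi x <= 1.
Proof.
have h : 0 < x ^+ 2 + 1 by rewrite ltr_wpDl// sqr_ge0.
by rewrite /psi invr_gt0 h invf_le1// lerDr sqr_ge0.
Qed.

Lemma sqr_ground_state x : x ^+ 2 * psi x = 1 - psi x.
Proof.
have h : 0 < x ^+ 2 + 1 by rewrite ltr_wpDl// sqr_ge0.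
by rewrite /psi; field; rewrite gt_eqF.
Qed.

Lemma log_deriv_le1 x : `|w0 x| <= 1.
Proof.
rewrite ler_norml /w0; have /andP[p0 _] := ground_state_itv x.
have := sqr_ground_state x; have : 0 <= psi x * (x - 1) ^+ 2 by rewrite mulr_ge0 ?sqr_ge0 ?(ltW p0).
have : 0 <= psi x * (x + 1) ^+ 2 by rewrite mulr_ge0 ?sqr_ge0 ?(ltW p0).
move: (psi x) => p h1 h2 h3; apply/andP; split; lra.
Qed.

Lemma log_deriv'_bound x : `|w1 x| <= 6.
Proof.
have /andP[p0 p1] := ground_state_itv x; have s := sqr_ground_state x.
have -> : w1 x = - 2 * psi x + 4 * (x ^+ 2 * psi x) * psi x by rewrite /w1 /w0; ring.
rewrite s; move: (psi x) p0 p1 => p p0 p1; rewrite ler_norml; apply/andP; split; nra.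
Qed.

Lemma potential_log_deriv x : potential x = w1 x + w0 x ^+ 2.
Proof.
have h : 0 < x ^+ 2 + 1 by rewrite ltr_wpDl// sqr_ge0.
by rewrite /potential /w1 /w0 /psi; field; rewrite gt_eqF.
Qed.

Lemma potential_bound x : `|potential x| <= 7.
Proof.
rewrite potential_log_deriv (le_trans (ler_normD _ _))//.
have := log_deriv'_bound x; have := log_deriv_le1 x; rewrite normrX.
have := normr_ge0 (w0 x); move: (`|w0 x|) (`|w1 x|) => a b; nra.
Qed.

Lemma is_derive_ground_state x : is_derive x 1 psi (w0 x * psi x).
Proof.
have h : x ^+ 2 + 1 != 0 by rewrite gt_eqF// ltr_wpDl// sqr_ge0.
have d1 : is_derive x 1 (fun y : R => y * y + 1) (x *: (1 : R) + x *: (1 : R) + 0).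
  apply: is_deriveD; apply: is_deriveM; exact: is_derive_id.
have d2 : is_derive x 1 (fun y : R => y ^+ 2 + 1) (2 * x).
  rewrite (_ : (fun y => _) = fun y : R => y * y + 1); last by apply/funext => y; rewrite expr2.
  by apply: (is_derive_eq d1); rewrite addr0 /GRing.scale/= mulr1; ring.
have d3 := @is_deriveV _ (fun y : R => y ^+ 2 + 1) x _ 1 h d2.
apply: (is_derive_eq d3); rewrite /w0 /psi /GRing.scale/=; field; exact: h.
Qed.

Lemma continuous_ground_state : continuous psi.
Proof.
by apply: derivable_continuous => x; have [] := is_derive_ground_state x.
Qed.

Lemma continuous_log_deriv : continuous w0.
Proof.
move=> x; apply: cvgM; first exact: cvg_cst.
by apply: cvgM; [exact: cvg_id|exact: continuous_ground_state].
Qed.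

Lemma primitive_id : primitive (@idfun R) (fun=> 1).
Proof.
have E : derive1 (@idfun R) = fun=> 1.
  by apply: derive1_is_derive => x; exact: is_derive_id.
have := @primitive_C1 R idfun; rewrite E; apply.
  by move=> x; exact: derivable_id.
by move=> x; exact: cvg_cst.
Qed.

Lemma primitive_ground_state : primitive psi (fun x => w0 x * psi x).
Proof.
have E : derive1 psi = fun x => w0 x * psi x.
  by apply: derive1_is_derive; exact: is_derive_ground_state.
have := @primitive_C1 R psi; rewrite E; apply.
  by move=> x; have [] := is_derive_ground_state x.
by move=> x; apply: cvgM; [exact: continuous_log_deriv|exact: continuous_ground_state].
Qed.

Lemma primitive_log_deriv : primitive w0 w1.
Proof.
have := primitiveZ (- 2) (primitiveM primitive_id primitive_ground_state).
by congr primitive; apply/funext => x; rewrite /w1 mul1r.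
Qed.

Lemma primitive_ground_state' :
  primitive (fun x => w0 x * psi x) (fun x => potential x * psi x).
Proof.
have := primitiveM primitive_log_deriv primitive_ground_state.
congr primitive; apply/funext => x; rewrite potential_log_deriv; ring.
Qed.

Lemma measurable_ground_state : measurable_fun D psi.
Proof. exact: primitive_measurable primitive_ground_state. Qed.

Lemma measurable_log_deriv : measurable_fun D w0.
Proof. exact: primitive_measurable primitive_log_deriv. Qed.

Lemma measurable_log_deriv' : measurable_fun D w1.
Proof.
apply: measurable_fun_halfline => b; have [h _] := primitive_log_deriv.
exact: itg_measurable (h b).
Qed.

Lemma measurable_potential : measurable_fun D (@potential R).
Proof.
rewrite (_ : @potential R = fun x => w1 x + w0 x ^+ 2); last first.
  by apply/funext => x; exact: potential_log_deriv.
apply: measurable_funD; first exact: measurable_log_deriv'.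
by apply: measurable_funX; exact: measurable_log_deriv.
Qed.

(** For x > 1, psi^2 is at most 2 x psi^2 = - psi', which is integrable because psi decreases to 0;
    on []0, 1]] the bound is 1. *)
Lemma ground_state_square_integrable : square_integrable psi.
Proof.
split; first exact: measurable_ground_state.
pose f x : R := - (w0 x * psi x).
have f0 x : 0 <= x -> 0 <= f x.
  move=> x0; rewrite /f /w0; have /andP[/ltW p0 _] := ground_state_itv x.
  have : 0 <= x * psi x * psi x by rewrite !mulr_ge0.
  by move: (x) (psi x) => y p; lra.
have cpsi0 : psi x @[x --> +oo] --> (0 : R).
  apply/cvgrPdist_lt => e e0; near=> x.
  have x1 : 1 < x by near: x; exact: nbhs_pinfty_gt.
  have xe : e^-1 < x by near: x; apply: nbhs_pinfty_gt; exact: num_real.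
  have h : 0 < x ^+ 2 + 1 by rewrite ltr_wpDl// sqr_ge0.
  rewrite sub0r normrN gtr0_norm /psi ?invr_gt0// invf_plt ?posrE//.
  by apply: (lt_trans xe); nra.
have FTC : (\int[mu]_(x in `[0%R, +oo[) (f x)%:E = 0%:E - (- psi 0)%:E)%E.
  apply: (@ge0_continuous_FTC2y R f (fun x => - psi x) 0 0).
  - exact: f0.
  - apply: continuous_subspaceT => x; apply: cvgN; apply: cvgM.
      exact: continuous_log_deriv.
    exact: continuous_ground_state.
  - by rewrite -[X in _ --> X](@oppr0 R); exact: cvgN.
  - by move=> x _; apply: derivableN; have [] := is_derive_ground_state x.
  - by apply: cvg_at_right_filter; apply: cvgN; exact: continuous_ground_state.
  - move=> x _; rewrite derive1E.
    have h : is_derive x 1 (fun x => - psi x) (- (w0 x * psi x)).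
      by apply: is_deriveN; exact: is_derive_ground_state.
    exact: derive_val.
have fi : itg D f.
  have : itg (`[0, +oo[%classic : set TR) f.
    apply/integrableP; split.
      apply/measurable_EFinP; apply: (@measurable_funS _ _ _ _ (setT : set TR)) => //.
      apply: continuous_measurable_fun => x; apply: cvgN; apply: cvgM.
        exact: continuous_log_deriv.
      exact: continuous_ground_state.
    rewrite (_ : (\int[mu]_(x in _) _)%E = (\int[mu]_(x in `[0%R, +oo[) (f x)%:E)%E).
      by rewrite FTC -EFinB ltry.
    apply: eq_integral => x; rewrite inE/= in_itv/= andbT => x0.
    by rewrite ger0_norm// f0.
  by apply: itgS => //; apply: subset_itvr; rewrite bnd_simp.
pose one := (fun x : TR => (1 : R)) \_ (`]0, 1]%classic : set TR).
have i1 : itg D one.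
  apply: itgS measurableT _ (@subsetT _ _) _ => //; apply: itg_setT => //.
  exact: itg_cst.
apply: (@itg_le _ _ _ (fun x => f x + one x)) => //.
- by apply: measurable_funX; exact: measurable_ground_state.
- move=> x; rewrite /= in_itv/= andbT => x0; have /andP[p0 p1] := ground_state_itv x.
  rewrite ger0_norm ?sqr_ge0// /one patchE; have [x1|x1] := leP x 1.
    by rewrite mem_set/= ?in_itv/= ?x0//; have := f0 _ (ltW x0); nra.
  rewrite memNset/=; last by rewrite in_itv/= x0/= leNgt x1.
  rewrite addr0 /f /w0; have : 0 <= psi x ^+ 2 * (x - 1) by rewrite mulr_ge0 ?sqr_ge0// subr_ge0 ltW.
  have := sqr_ge0 (psi x); move: (psi x) => p; lra.
- exact: itgD.
Unshelve. all: by end_near. Qed.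

End GroundState.

(** * The first-order factor and the form identity *)

Section Neumann.
Context (R : realType).
Local Notation mu := (@lebesgue_measure R).
Local Notation TR := (measurableTypeR R).
Local Notation D := (halfline : set TR).
Local Notation Re := complex.Re.
Local Notation Im := complex.Im.
Local Notation dot := (@L2dot R).
Local Notation rdot u v := (Re (dot u v)).
Implicit Types (u v w g h : L2 R) (x : R).

Local Notation psi := (@ground_state R).
Local Notation w0 := (@log_deriv R).
Local Notation w1 := (@log_deriv' R).
Local Notation q := (@potential R).
Local Notation A := (neumann_operator q).

Hint Extern 0 (measurable [set` _]) => exact: measurable_itvT : core.

Lemma by_parts_halfline (F f G g : R -> R) : primitive F f -> primitive G g ->
  square_integrable F -> square_integrable f -> square_integrable G ->
  square_integrable g -> F 0 * G 0 = 0 ->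
  \int[mu]_(x in D) (f x * G x) = - (\int[mu]_(x in D) (F x * g x)).
Proof.
move=> PF PG sF sf sG sg FG0.
have i1 := itg_mul sf sG; have i2 := itg_mul sg sF; have i3 := itg_mul sF sG.
have := primitive_total (primitiveM PF PG) i3 (itgD (measurable_itvT _) i1 i2).
rewrite RintegralD// FG0 oppr0 => /eqP; rewrite addr_eq0 => /eqP ->.
by congr (- _); apply: eq_Rintegral => x _; exact: mulrC.
Qed.

Lemma rdot_ae2 u v (f f' g g' : R -> R) : measurable_fun D f -> measurable_fun D f' ->
  measurable_fun D g -> measurable_fun D g' ->
  {ae mu, forall x, D x -> u x = f x +i* f' x} ->
  {ae mu, forall x, D x -> v x = g x +i* g' x} ->
  rdot u v = \int[mu]_(x in D) (f x * g x) + \int[mu]_(x in D) (f' x * g' x).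
Proof.
move=> mf mf' mg mg' hu hv; rewrite L2dotE_Re; congr (_ + _).
  apply: ae_eq_Rintegral => //; [exact: measurable_funM (L2_Re u).1 (L2_Re v).1|exact: measurable_funM|].
  by apply: filterS2 hu hv => x e1 e2 Dx; rewrite e1// e2.
apply: ae_eq_Rintegral => //; [exact: measurable_funM (L2_Im u).1 (L2_Im v).1|exact: measurable_funM|].
by apply: filterS2 hu hv => x e1 e2 Dx; rewrite e1// e2.
Qed.

Lemma L2_eta_ae u : {ae mu, forall x, D x -> u x = Re (u x) +i* Im (u x)}.
Proof. by apply: nearW => x _; case: (u x). Qed.

Lemma rdot_by_parts u u' v v' (F G : R -> R) : weak_derivative v v' ->
  primitive F (fun x => Re (u' x)) -> primitive G (fun x => Im (u' x)) ->
  {ae mu, forall x, D x -> u x = F x +i* G x} -> F 0 = 0 -> G 0 = 0 ->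
  rdot u' v = - rdot u v'.
Proof.
move=> /weak_rep[F' [G' [PF' PG' hv]]] PF PG hu F0 G0.
have [sF sG] := rep_square_integrable PF PG hu.
have [sF' sG'] := rep_square_integrable PF' PG' hv.
rewrite (rdot_ae2 (L2_Re u').1 (L2_Im u').1 sF'.1 sG'.1 (L2_eta_ae u') hv).
rewrite (rdot_ae2 sF.1 sG.1 (L2_Re v').1 (L2_Im v').1 hu (L2_eta_ae v')).
rewrite (by_parts_halfline PF PF')//; [|exact: L2_Re|exact: L2_Re|by rewrite F0 mul0r].
rewrite (by_parts_halfline PG PG')//; [|exact: L2_Im|exact: L2_Im|by rewrite G0 mul0r].
by rewrite opprD.
Qed.

Lemma weak_derivativeM (m m' : R -> R) u u' mu_ m'u mu' : primitive m m' ->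
  weak_derivative u u' -> multiplication_operator m (u, mu_) ->
  multiplication_operator m' (u, m'u) -> multiplication_operator m (u', mu') ->
  weak_derivative mu_ (m'u + mu').
Proof.
move=> Pm /weak_rep[F [G [PF PG hu]]] h1 h2 h3.
apply: (rep_weak (primitiveM PF Pm) (primitiveM PG Pm)).
  apply: filterS2 h1 hu => x e1 e2 Dx; rewrite e1//= e2//.
  by apply/eqP; rewrite eq_complex/= !mul0r subr0 addr0; apply/andP; split; apply/eqP; exact: mulrC.
have h4 := L2D_ae m'u mu'.
near=> x => Dx; rewrite (near h4 x)// (near h2 x)// (near h3 x)//= (near hu x)//.
by case: (u' x) => a b; apply/eqP; rewrite eq_complex/=; apply/andP; split; apply/eqP; ring.
Unshelve. all: by end_near. Qed.

(* The factor L in A = L^* L. *)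
Definition ground_factor : set (L2 R * L2 R) := [set p | exists u' wu,
  [/\ weak_derivative p.1 u', multiplication_operator w0 (p.1, wu) & p.2 = u' - wu]].
Local Notation L := ground_factor.

Lemma linear_ground_factor0 : L 0.
Proof.
exists 0, 0; split; last by rewrite subr0.
- exact: weak_derivative0.
- by case: (linear_multiplication w0).
Qed.

Lemma linear_ground_factorZD (c : R[i]) p p' : L p -> L p' -> L (c *: p + p').
Proof.
move=> [u' [wu [h1 h2 h3]]] [v' [wv [h1' h2' h3']]].
exists (c *: u' + v'), (c *: wu + wv); split.
- exact: weak_derivativeZD.
- have [_ lD _] := linear_multiplication w0; exact: (lD c _ _ h2 h2').
- by rewrite /= h3 h3' scalerBr opprD addrACA.
Qed.

Lemma exists_log_deriv_mul u : exists wu, multiplication_operator w0 (u, wu).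
Proof.
apply: (exists_multiplication u (c := 1)); first exact: measurable_log_deriv.
by move=> x _; exact: log_deriv_le1.
Qed.

Lemma exists_log_deriv'_mul u : exists wu, multiplication_operator w1 (u, wu).
Proof.
apply: (exists_multiplication u (c := 6)); first exact: measurable_log_deriv'.
by move=> x _; exact: log_deriv'_bound.
Qed.

Lemma exists_potential_mul u : exists qu, multiplication_operator q (u, qu).
Proof.
apply: (exists_multiplication u (c := 7)); first exact: measurable_potential.
by move=> x _; exact: potential_bound.
Qed.

(** Multiplication by w is bounded with norm at most 1, so a limit in the graph of L is a limit of
    weak derivatives, which are closed. *)
Lemma closed_ground_factor : closed_relation dot L.
Proof.
move=> u g l k Lug ul gk.
have /boolp.choice[t ht] : forall n, exists p : L2 R * L2 R,
    [/\ weak_derivative (u n) p.1, multiplication_operator w0 (u n, p.2) & g n = p.1 - p.2].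
  by move=> n; have [u' [wu [h1 h2 h3]]] := Lug n; exists (u', wu).
have [wl hwl] := exists_log_deriv_mul l.
have t2 : hcvg dot (fun n => (t n).2) wl.
  apply: (@hcvg_squeeze _ _ _ _ _ (fun n => hnorm dot (u n - l))) => // n.
  apply: le_hnorm_sqr; first exact: hnorm_ge0.
  rewrite sqr_hnorm -[leRHS]mul1r -(expr1n _ 2).
  apply: (multiplication_bound (@measurable_log_deriv R)).
    by move=> x _; exact: log_deriv_le1.
  by have [_ h _] := ht n; exact: linopB (linear_multiplication w0) h hwl.
exists (k + wl), wl; split => //=; last by rewrite addrK.
apply: (weak_derivative_closed (u := u) (v := fun n => (t n).1)) => //.
  by move=> n; have [] := ht n.
have E : (fun n => (t n).1) = (fun n => g n + (t n).2).
  by apply/funext => n; have [_ _ ->] := ht n; rewrite subrK.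
by rewrite E; exact: hcvgD.
Qed.

Lemma ground_factor_psi : exists2 p : L2 R, {ae mu, forall x, D x -> p x = (psi x)%:C} & L (p, 0).
Proof.
have s := @ground_state_square_integrable R.
have [p hp] := exists_real_L2 s; exists p => //.
have [wp hwp] := exists_log_deriv_mul p.
exists wp, wp; split => //; last by rewrite subrr.
apply: (rep_weak (@primitive_ground_state R) (@primitive_cst R 0)) => //.
apply: filterS2 hp hwp => x e1 e2 Dx; rewrite e2//= e1//.
by apply/eqP; rewrite eq_complex/= !mulr0 mul0r subr0 addr0 !eqxx.
Qed.

Lemma weak_derivative_of_neumann u y : A (u, y) -> exists u' u'' qu,
  [/\ weak_derivative u u', weak_derivative u' u'', trace0 u' 0,
      multiplication_operator q (u, qu) & y = - u'' + qu].
Proof.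
move=> [[_ [u1' d1 tr]]] [u' [u'' [/= d1' d2 hy]]].
have e := weak_derivative_uniq d1 d1'; rewrite e in tr.
have [qu hqu] := exists_potential_mul u.
exists u', u'', qu; split => //; apply: L2_ext.
have h1 := L2D_ae (- u'') qu; have h2 := L2Z_ae (-1) u''; rewrite scaleN1r in h2.
near=> x => Dx; rewrite (near hy x)// (near h1 x)// (near h2 x)// (near hqu x)//=.
by rewrite mulN1r.
Unshelve. all: by end_near. Qed.

Lemma neumann_of_weak_derivative u u' u'' qu : weak_derivative u u' ->
  weak_derivative u' u'' -> trace0 u' 0 -> multiplication_operator q (u, qu) ->
  A (u, - u'' + qu).
Proof.
move=> d1 d2 tr hqu; split => /=.
  by split; [exists u', u''|exists u'].
exists u', u''; split => //.
have h1 := L2D_ae (- u'') qu; have h2 := L2Z_ae (-1) u''; rewrite scaleN1r in h2.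
near=> x => Dx; rewrite (near h1 x)// (near h2 x)// (near hqu x)//=.
by rewrite mulN1r.
Unshelve. all: by end_near. Qed.

(** Continuous representatives agree at 0, so the Neumann condition, stated for some continuous
    representative, can be read off the absolutely continuous one. *)
Lemma trace0_rep u' (F G f g : R -> R) : trace0 u' 0 -> primitive F f ->
  primitive G g -> square_integrable f -> square_integrable g ->
  {ae mu, forall x, D x -> u' x = F x +i* G x} -> F 0 = 0 /\ G 0 = 0.
Proof.
move=> [f0 [cR cI h0 f00]] PF PG sf sg hu.
have cF := primitive_within_continuous PF sf.
have cG := primitive_within_continuous PG sg.
have e1 : Re (f0 0) - F 0 = 0.
  apply: (@within_continuous_ae_zero _ (fun x => Re (f0 x) - F x)).
    by move=> x; apply: cvgB; [exact: cR|exact: cF].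
  by apply: filterS2 hu h0 => x e1 e2 Dx; rewrite e2// e1// subrr.
have e2 : Im (f0 0) - G 0 = 0.
  apply: (@within_continuous_ae_zero _ (fun x => Im (f0 x) - G x)).
    by move=> x; apply: cvgB; [exact: cI|exact: cG].
  by apply: filterS2 hu h0 => x e2 e3 Dx; rewrite e3// e2// subrr.
by move: e1 e2; rewrite f00 /= !sub0r => /eqP; rewrite oppr_eq0 => /eqP -> /eqP;
  rewrite oppr_eq0 => /eqP ->.
Qed.

Lemma rep_trace0 u' (F G f g : R -> R) : primitive F f ->
  primitive G g -> square_integrable f -> square_integrable g ->
  {ae mu, forall x, D x -> u' x = F x +i* G x} -> F 0 = 0 -> G 0 = 0 -> trace0 u' 0.
Proof.
move=> PF PG sf sg hu F0 G0; exists (fun x => F x +i* G x); split.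
- exact: primitive_within_continuous PF sf.
- exact: primitive_within_continuous PG sg.
- by apply: filterS hu => x e Dx; rewrite e.
- by rewrite F0 G0.
Qed.

(* w' u + w u' = (q - w^2) u + w u' *)
Lemma log_deriv_algebra u u' wu w'u wu' qu wg : multiplication_operator w0 (u, wu) ->
  multiplication_operator w1 (u, w'u) -> multiplication_operator w0 (u', wu') ->
  multiplication_operator q (u, qu) -> multiplication_operator w0 (u' - wu, wg) ->
  qu - (w'u + wu') = - wg.
Proof.
move=> h1 h2 h3 h4 h5; apply: L2_ext.
have e1 := L2B_ae qu (w'u + wu'); have e2 := L2D_ae w'u wu'.
have e3 := L2Z_ae (-1) wg; rewrite scaleN1r in e3; have e4 := L2B_ae u' wu.
near=> x => Dx; rewrite (near e1 x)// (near e2 x)// (near e3 x)//.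
rewrite (near h4 x)// (near h2 x)// (near h3 x)// (near h5 x)//= (near e4 x)//.
rewrite (near h1 x)//= potential_log_deriv rmorphD rmorphXn /=; ring.
Unshelve. all: by end_near. Qed.

(** For g = u' - w u the values u'(0) = 0 and w(0) = 0 give g(0) = 0. Integration by parts against
    any v in the domain of L then has no boundary term, whatever v(0) is. *)
Lemma neumann_form u y : A (u, y) -> exists2 g, L (u, g) &
  forall v h, L (v, h) -> rdot y v = rdot g h.
Proof.
move=> /weak_derivative_of_neumann[u' [u'' [qu [d1 d2 tr hqu ->]]]].
have [wu hwu] := exists_log_deriv_mul u; have [wu' hwu'] := exists_log_deriv_mul u'.
have [w'u hw'u] := exists_log_deriv'_mul u.
have dwu := weak_derivativeM (@primitive_log_deriv R) d1 hwu hw'u hwu'.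
pose g : L2 R := u' - wu; have dg : weak_derivative g (u'' - (w'u + wu')).
  have := weak_derivativeZD (-1) dwu d2; rewrite !scaleN1r.
  by rewrite addrC [_ + u'']addrC.
have [wg hwg] := exists_log_deriv_mul g.
exists g; first by exists u', wu.
move=> v h [v' [wv [/= dv hwv ->]]].
have alg := log_deriv_algebra hwu hw'u hwu' hqu hwg.
(* That is, - u'' + q u = - g' - w g, the formal adjoint of L applied to g. *)
have -> : - u'' + qu = - (u'' - (w'u + wu')) - wg.
  by rewrite -alg opprB [qu - _]addrC addrA [_ - u'' - _]addrAC subrr add0r.
have [F [G [PF PG hu']]] := weak_rep d2.
have [F0 G0] := trace0_rep tr PF PG (L2_Re u'') (L2_Im u'') hu'.
have [Fu [Gu [PFu PGu hu]]] := weak_rep d1.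
have gE : {ae mu, forall x, D x -> g x = (F x - w0 x * Fu x) +i* (G x - w0 x * Gu x)}.
  have e1 := L2B_ae u' wu.
  near=> x => Dx; rewrite (near e1 x)// (near hwu x)//= (near hu' x)// (near hu x)//.
  by apply/eqP; rewrite eq_complex/= !mul0r subr0 addr0 !eqxx.
have e2 := L2B_ae u'' (w'u + wu'); have e3 := L2D_ae w'u wu'.
have PFg : primitive (fun x => F x - w0 x * Fu x)
    (fun x => Re ((u'' - (w'u + wu') : L2 R) x)).
  apply: primitive_ae (primitiveD PF (primitiveN (primitiveM (@primitive_log_deriv R) PFu))) _ _.
    exact: (L2_Re _).1.
  near=> x => Dx; rewrite (near e2 x)// (near e3 x)// (near hw'u x)// (near hwu' x)//=.
  rewrite (near hu x)//; case: (u'' x) (u' x) => [a b] [c d] /=; ring.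
have PGg : primitive (fun x => G x - w0 x * Gu x)
    (fun x => Im ((u'' - (w'u + wu') : L2 R) x)).
  apply: primitive_ae (primitiveD PG (primitiveN (primitiveM (@primitive_log_deriv R) PGu))) _ _.
    exact: (L2_Im _).1.
  near=> x => Dx; rewrite (near e2 x)// (near e3 x)// (near hw'u x)// (near hwu' x)//=.
  rewrite (near hu x)//; case: (u'' x) (u' x) => [a b] [c d] /=; ring.
have w00 : w0 0 = 0 by rewrite /log_deriv mul0r mulr0.
have ibp := rdot_by_parts dv PFg PGg gE; rewrite F0 G0 w00 !mul0r subrr in ibp.
have sym := symmetric_multiplication (@measurable_log_deriv R) hwg hwv.
apply: etrans (rdotBl dot _ wg v) _; apply: etrans _ (esym (rdotBr dot v' wv g)).
congr (_ - _); last by rewrite sym.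
by apply: etrans (rdotNl dot _ v) _; rewrite [X in - X]ibp// opprK.
Unshelve. all: by end_near. Qed.

End Neumann.

(** * Surjectivity of A_N(q) + 1, symmetry and nonnegativity *)

Section NeumannSelfAdjoint.
Context (R : realType).
Local Notation mu := (@lebesgue_measure R).
Local Notation TR := (measurableTypeR R).
Local Notation D := (halfline : set TR).
Local Notation Re := complex.Re.
Local Notation Im := complex.Im.
Local Notation dot := (@L2dot R).
Local Notation rdot u v := (Re (dot u v)).
Implicit Types (u v w g h f : L2 R) (x : R).

Local Notation psi := (@ground_state R).
Local Notation w0 := (@log_deriv R).
Local Notation q := (@potential R).
Local Notation A := (neumann_operator q).
Local Notation L := (@ground_factor R).

Hint Extern 0 (measurable [set` _]) => exact: measurable_itvT : core.

Lemma test_weak_derivative (phi : R -> R) (p p' : L2 R) : test_function phi ->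
  {ae mu, forall x, D x -> p x = (phi x)%:C} ->
  {ae mu, forall x, D x -> p' x = (derive1 phi x)%:C} -> weak_derivative p p'.
Proof.
by move=> tphi; exact: rep_weak (test_function_primitive tphi) (@primitive_cst R 0).
Qed.

Lemma ground_state0 : psi 0 = 1.
Proof. by rewrite /ground_state expr0n/= add0r invr1. Qed.

Lemma log_deriv0 : w0 0 = 0.
Proof. by rewrite /log_deriv mul0r mulr0. Qed.

(* (psi F)' = psi (F' + w F), so orthogonality to psi is a boundary condition. *)
Lemma ground_state_boundary (F f c : R -> R) : primitive F f ->
  square_integrable F -> square_integrable f -> square_integrable c ->
  {ae mu, forall x, D x -> f x = c x - w0 x * F x} ->
  \int[mu]_(x in D) (c x * psi x) = 0 -> F 0 = 0.
Proof.
move=> PF sF sf sc fc int0.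
have spsi := @ground_state_square_integrable R.
have mw := @measurable_log_deriv R.
have swpsi : square_integrable (fun x => w0 x * psi x).
  by apply: (square_integrableM_bounded (c := 1)) => // x _; exact: log_deriv_le1.
have i1 := itg_mul sf spsi; have i2 := itg_mul swpsi sF.
have := primitive_total (primitiveM PF (@primitive_ground_state R)) (itg_mul sF spsi)
  (itgD (measurable_itvT _) i1 i2).
rewrite ground_state0 mulr1 => h.
suff e : \int[mu]_(x in D) (f x * psi x + w0 x * psi x * F x) = \int[mu]_(x in D) (c x * psi x).
  by move: h; rewrite e int0 => /eqP; rewrite eq_sym oppr_eq0 => /eqP.
apply: ae_eq_Rintegral => //.
- by apply: measurable_funD; [apply: measurable_funM|apply: measurable_funM => //];
    [exact: sf.1|exact: spsi.1|exact: swpsi.1|exact: sF.1].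
- by apply: measurable_funM; [exact: sc.1|exact: spsi.1].
- by apply: filterS fc => x e Dx; rewrite e//; ring.
Qed.

(** The minimizer satisfies <u - f, v> + <g, L v> = 0 on the domain of L, that is L^* g = f - u with
    g = L u. Testing with smooth v gives the weak derivative of g, and testing with psi gives g(0) =
    0; together they place u in the Neumann domain. *)
Lemma neumann_onto f : exists u v, A (u, v) /\ v + 1%:C *: u = f.
Proof.
have [u [g [Lug orth]]] := @closed_relation_minimizer R (L2 R) dot L f
  (@L2_complete R) (@closed_ground_factor R) (@linear_ground_factor0 R) (@linear_ground_factorZD R).
have [wg hwg] := exists_log_deriv_mul g.
(* The candidate for g', read off from v = phi and L v = phi' - w phi. *)
pose g1 : L2 R := (u - f) - wg.
have dg : weak_derivative g g1.
  apply: dot_weak_derivative => phi p p' tphi hp hp'.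
  have [wp hwp] := exists_log_deriv_mul p.
  have Lp : L (p, p' - wp).
    by exists p', wp; split => //; exact: test_weak_derivative hp hp'.
  have e1 : dot (u - f) p + dot g (p' - wp) = 0 := orth _ _ Lp.
  have e2 : dot g (p' - wp) = dot g p' - dot g wp.
    by apply: etrans (dotDr dot _ _ g) _; congr (_ + _); exact: (dotNr dot).
  have e3 : dot g1 p = dot (u - f) p - dot wg p.
    by apply: etrans (dotDl dot _ _ p) _; congr (_ + _); exact: (dotNl dot).
  have e4 := symmetric_multiplication (@measurable_log_deriv R) hwg hwp.
  move: e1; rewrite e2 e3 e4 => e1; apply/eqP; rewrite -subr_eq0 opprK; apply/eqP.
  exact: etrans (addrCA _ _ _) e1.
have [F [G [PF PG hg]]] := weak_rep dg.
have [sF sG] := rep_square_integrable PF PG hg.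
have [p hp Lp] := ground_factor_psi R.
(* psi is in the kernel of L and does not vanish at 0: this relation is the boundary condition g(0)
   = 0 in disguise. *)
have orthp : dot (u - f) p = 0 by have := orth _ _ Lp; rewrite [X in _ + X](dot0r dot) addr0.
have g1E : {ae mu, forall x, D x ->
    Re (g1 x) = Re ((u - f : L2 R) x) - w0 x * F x /\
    Im (g1 x) = Im ((u - f : L2 R) x) - w0 x * G x}.
  have e := L2B_ae (u - f) wg.
  near=> x => Dx; rewrite /g1 (near e x)// (near hwg x)//= (near hg x)//.
  by case: ((u - f : L2 R) x) => a b; split=> /=; ring.
have F0 : F 0 = 0.
  apply: (ground_state_boundary PF sF (L2_Re g1) (L2_Re (u - f))).
    by apply: filterS g1E => x e /e[].
  have := congr1 (fun z : R[i] => Re z) orthp.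
  rewrite (dot_real_ae _ (@measurable_ground_state R) hp) /= => e.
  by rewrite -[RHS]e; apply: eq_Rintegral => x _; rewrite ReM_real.
have G0 : G 0 = 0.
  apply: (ground_state_boundary PG sG (L2_Im g1) (L2_Im (u - f))).
    by apply: filterS g1E => x e /e[].
  have := congr1 (fun z : R[i] => Im z) orthp.
  rewrite (dot_real_ae _ (@measurable_ground_state R) hp) /= => e.
  by rewrite -[RHS]e; apply: eq_Rintegral => x _; rewrite ImM_real.
have [u' [wu [/= du hwu gE]]] := Lug.
have [w'u hw'u] := exists_log_deriv'_mul u; have [wu' hwu'] := exists_log_deriv_mul u'.
have [qu hqu] := exists_potential_mul u.
have dwu := weak_derivativeM (@primitive_log_deriv R) du hwu hw'u hwu'.
(* Hence u' is weakly differentiable like g and w u, and u'(0) = g(0) + w(0) u(0) = 0. *)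
have u'E : u' = g + wu by rewrite gE subrK.
pose u'' : L2 R := g1 + (w'u + wu').
have du' : weak_derivative u' u''.
  by have := weak_derivativeZD 1 dg dwu; rewrite !scale1r u'E.
have [Fu [Gu [PFu PGu hu]]] := weak_rep du.
have e2 := L2D_ae g1 (w'u + wu'); have e3 := L2D_ae w'u wu'.
have PFu' : primitive (fun x => F x + w0 x * Fu x) (fun x => Re (u'' x)).
  apply: primitive_ae (primitiveD PF (primitiveM (@primitive_log_deriv R) PFu)) _ _.
    exact: (L2_Re _).1.
  near=> x => Dx; rewrite /u'' (near e2 x)// (near e3 x)// (near hw'u x)// (near hwu' x)//=.
  rewrite (near hu x)//; case: (g1 x) (u' x) => [a b] [c d] /=; ring.
have PGu' : primitive (fun x => G x + w0 x * Gu x) (fun x => Im (u'' x)).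
  apply: primitive_ae (primitiveD PG (primitiveM (@primitive_log_deriv R) PGu)) _ _.
    exact: (L2_Im _).1.
  near=> x => Dx; rewrite /u'' (near e2 x)// (near e3 x)// (near hw'u x)// (near hwu' x)//=.
  rewrite (near hu x)//; case: (g1 x) (u' x) => [a b] [c d] /=; ring.
have hu' : {ae mu, forall x, D x -> u' x = (F x + w0 x * Fu x) +i* (G x + w0 x * Gu x)}.
  have e4 := L2D_ae g wu; rewrite -u'E in e4.
  near=> x => Dx; rewrite (near e4 x)// (near hwu x)//= (near hu x)// (near hg x)//.
  by apply/eqP; rewrite eq_complex/= !mul0r subr0 addr0 !eqxx.
have tr : trace0 u' 0.
  apply: (rep_trace0 PFu' PGu' (L2_Re _) (L2_Im _) hu').
    by rewrite F0 log_deriv0 mul0r addr0.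
  by rewrite G0 log_deriv0 mul0r addr0.
exists u, (- u'' + qu); split; first exact: neumann_of_weak_derivative du du' tr hqu.
have hwg' : multiplication_operator w0 (u' - wu, wg) by rewrite -gE.
have alg := log_deriv_algebra hwu hw'u hwu' hqu hwg'.
rewrite scale1r /u'' opprD -(addrA (- g1)) [X in - g1 + X]addrC alg /g1 opprB.
by rewrite [wg - (u - f)]addrC addrK opprB subrK.
Unshelve. all: by end_near. Qed.

Lemma linear_neumann : linear_operator A.
Proof.
have mulZD m (c : R[i]) u v u' v' : multiplication_operator m (u, v) ->
    multiplication_operator m (u', v') -> multiplication_operator m (c *: u + u', c *: v + v').
  by move=> h h'; have [_ lD _] := linear_multiplication m; exact: (lD c _ _ h h').
split.
- have tr : trace0 (0 : L2 R) 0.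
    apply: (rep_trace0 (@primitive_cst R 0) (@primitive_cst R 0)) => //.
    - exact: square_integrable0.
    - exact: square_integrable0.
    - by apply: filterS (@L20_ae R) => x h Dx; rewrite h.
  have [hq _ _] := linear_multiplication q.
  have := neumann_of_weak_derivative (@weak_derivative0 R) (@weak_derivative0 R) tr hq.
  by rewrite oppr0 addr0.
- move=> c [u y] [v z] /weak_derivative_of_neumann[u' [u'' [qu [d1 d2 tr hq ->]]]].
  move=> /weak_derivative_of_neumann[v' [v'' [qv [d1' d2' tr' hq' ->]]]].
  rewrite (_ : _ + _ = (c *: u + v, - (c *: u'' + v'') + (c *: qu + qv))); last first.
    by congr pair; rewrite /= scalerDr scalerN opprD addrACA.
  apply: neumann_of_weak_derivative (weak_derivativeZD c d1 d1') (weak_derivativeZD c d2 d2') _ (mulZD _ _ _ _ _ _ hq hq').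
  have [F [G [PF PG hu]]] := weak_rep d2; have [F' [G' [PF' PG' hv]]] := weak_rep d2'.
  have [F0 G0] := trace0_rep tr PF PG (L2_Re _) (L2_Im _) hu.
  have [F0' G0'] := trace0_rep tr' PF' PG' (L2_Re _) (L2_Im _) hv.
  have [F1 [G1 [P1 P2 h]]] := weak_rep (weak_derivativeZD c d2 d2').
  case: c h P1 P2 => a b h P1 P2.
  have sR := square_integrableD (square_integrableZ a (L2_Re u'')) (square_integrableD (square_integrableZ (- b) (L2_Im u'')) (L2_Re v'')).
  have sI := square_integrableD (square_integrableZ b (L2_Re u'')) (square_integrableD (square_integrableZ a (L2_Im u'')) (L2_Im v'')).
  apply: (rep_trace0 (primitiveD (primitiveZ a PF) (primitiveD (primitiveZ (- b) PG) PF'))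
    (primitiveD (primitiveZ b PF) (primitiveD (primitiveZ a PG) PG')) sR sI).
  + have e1 := L2D_ae ((a +i* b) *: u') v'; have e2 := L2Z_ae (a +i* b) u'.
    near=> x => Dx; rewrite (near e1 x)// (near e2 x)// (near hu x)// (near hv x)//=.
    by apply/eqP; rewrite eq_complex/=; apply/andP; split; apply/eqP; ring.
  + by rewrite F0 G0 F0' !mulr0 !addr0.
  + by rewrite F0 G0 G0' !mulr0 !addr0.
- move=> u y z /weak_derivative_of_neumann[u' [u'' [qu [d1 d2 _ hq ->]]]].
  move=> /weak_derivative_of_neumann[v' [v'' [qv [d1' d2' _ hq' ->]]]].
  have e := weak_derivative_uniq d1 d1'; rewrite -e in d2'.
  have [_ _ fq] := linear_multiplication q.
  by rewrite (weak_derivative_uniq d2 d2') (fq _ _ _ hq hq').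
Unshelve. all: by end_near. Qed.

Lemma neumann_symmetric : symmetric_operator dot A.
Proof.
have main u y v z : A (u, y) -> A (v, z) -> rdot y v = rdot u z.
  move=> /neumann_form[g Lug hg] /neumann_form[h Lvh hh].
  by rewrite (hg _ _ Lvh) (rdotC dot g h) -(hh _ _ Lug) (rdotC dot z u).
move=> u y v z Au Av; apply: (dot_ext (dot := dot)); first exact: main.
by apply: main => //; exact: linopZ linear_neumann Au.
Qed.

Lemma neumann_ge0 u y : A (u, y) -> 0 <= rdot y u.
Proof.
by move=> /neumann_form[g Lug hg]; rewrite (hg _ _ Lug) (rdot_ge0 dot).
Qed.

(** As q is bounded, q u is in L^2 for every u, so the potential adds no condition. *)
Lemma op_dom_neumann : op_dom A = @neumann_domain R.
Proof.
apply/seteqP; split => [u [y []]//|u du].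
have [[u' [u'' [d1 d2]]] [u1 d1' tr]] := du.
have e := weak_derivative_uniq d1' d1; rewrite e in tr.
have [qu hqu] := exists_potential_mul u.
by exists (- u'' + qu); exact: neumann_of_weak_derivative d1 d2 tr hqu.
Qed.

End NeumannSelfAdjoint.

(** * Relative compactness of V *)

Section BoundedSequences.
Context (R : realType).
Implicit Types (F : nat -> R -> R) (B x y : R) (n k : nat) (phi : nat -> nat).

Lemma increasing_geq phi n : {homo phi : m k / (m < k)%N} -> (n <= phi n)%N.
Proof. by move=> h; elim: n => // n ih; apply: leq_ltn_trans ih _; exact: h. Qed.

Lemma cvgn_subseq (u : nat -> R) phi : (forall n, (n <= phi n)%N) -> cvgn u ->
  cvgn (u \o phi).
Proof.
move=> hphi /cvg_ex[l ul]; apply/cvg_ex; exists l; apply: cvg_comp ul.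
move=> A [N _ NA]; exists N => // n /= Nn; apply: NA => /=.
exact: leq_trans Nn (hphi n).
Qed.

(** Cantor's diagonal: [Phi k.+1] refines [Phi k] so that column [k] converges, and the diagonal
    inherits the convergence of every column. *)
Lemma diagonal_subsequence (a : nat -> nat -> R) B : (forall n k, `|a n k| <= B) ->
  exists2 phi, {homo phi : m n / (m < n)%N} & forall k, cvgn (fun n => a (phi n) k).
Proof.
move=> aB.
have /boolp.choice[s hs] : forall p : nat * (nat -> nat), exists f : nat -> nat,
    {homo f : m n / (m < n)%N} /\ cvgn (fun n => a (p.2 (f n)) p.1).
  move=> [k psi]; have [|f fi cf] := @bolzano_weierstrass R (fun n => a (psi n) k).
    exists B; split; first exact: num_real.
    by move=> M BM n _ /=; apply: le_trans (aB _ _) (ltW BM).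
  by exists f; split=> // m n; rewrite !ltnNge; have := fi n m; rewrite leEnat => ->.
pose Phi := fix Phi k := if k is k'.+1 then Phi k' \o s (k', Phi k') else id.
have PhiS k : Phi k.+1 = Phi k \o s (k, Phi k) by [].
have incr k : {homo Phi k : m n / (m < n)%N}.
  elim: k => // k ih m n mn; rewrite PhiS /=; apply: ih.
  by have [+ _] := hs (k, Phi k); exact.
have tail j i n : exists2 t, (n <= t)%N & Phi (j + i)%N n = Phi j t.
  elim: i n => [|i ih] n; first by exists n; rewrite ?addn0.
  have [t nt et] := ih (s ((j + i)%N, Phi (j + i)%N) n).
  exists t; last by rewrite addnS PhiS.
  apply: leq_trans nt; apply: increasing_geq.
  by have [] := hs ((j + i)%N, Phi (j + i)%N).
have diag : {homo (fun n => Phi n n) : m n / (m < n)%N}.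
  apply: homo_ltn => [? ? ?|n]; first exact: ltn_trans.
  rewrite PhiS /=; apply: incr; apply: increasing_geq.
  by have [] := hs (n, Phi n).
exists (fun n => Phi n n) => // k.
(* Only from index k + 1 on is the diagonal a subsequence of [Phi k.+1], hence the shift by
   [k.+1]. *)
have /boolp.choice[t ht] : forall n, exists t, (n <= t)%N /\
    Phi (n + k.+1)%N (n + k.+1)%N = Phi k.+1 t.
  move=> n; have [t nt et] := tail k.+1 n (n + k.+1)%N.
  by exists t; split; [exact: leq_trans (leq_addr _ _) nt|rewrite -et addnC].
have [_ ck] := hs (k, Phi k).
have /cvg_ex[l hl] := @cvgn_subseq _ t (fun n => (ht n).1) ck.
apply/cvg_ex; exists l; rewrite -(cvg_shiftn k.+1).
by apply: cvg_trans hl; apply: near_eq_cvg; apply: nearW => n /=; rewrite (ht n).2.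
Qed.

(* Arzela-Ascoli on [0, +oo): converge along the rationals, then everywhere by
   equicontinuity. *)
Lemma holder_subsequence F B :
  (forall n x, 0 <= x -> F n x ^+ 2 <= B) ->
  (forall n x y, 0 <= x -> x <= y -> (F n y - F n x) ^+ 2 <= (y - x) * B) ->
  exists2 phi, {homo phi : m n / (m < n)%N} &
    forall x, 0 <= x -> cvgn (fun n => F (phi n) x).
Proof.
move=> FB Fh.
have B0 : 0 <= B by apply: le_trans (FB 0%N 0 _); rewrite ?sqr_ge0.
(* An enumeration of the nonnegative rationals; a code that decodes to nothing gives 0. *)
pose e k : R := `|ratr (odflt 0 (@unpickle rat k))|.
have [|phi incr cphi] := @diagonal_subsequence (fun n k => F n (e k)) (1 + B).
  move=> n k; have := FB n (e k) (normr_ge0 _); rewrite -real_normK ?num_real// => h.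
  by have := sqr_ge0 (`|F n (e k)| - 1); nra.
exists phi => // x x0; apply: real_cauchy_cvg => eps eps0.
(* By the Hoelder bound, moving [x] by less than [d] changes every [F n] by less than eps / 3; the
   denominator [B + 1] is positive even if [B] is 0. *)
pose d := (eps / 3) ^+ 2 / (B + 1).
have d0 : 0 < d by rewrite divr_gt0 ?exprn_gt0 ?divr_gt0// ltr_wpDl.
have [|r] := @rat_in_itvoo R x (x + d); first by rewrite ltrDl.
rewrite in_itv/= => /andP[xr rd].
have er : e (pickle r) = ratr r by rewrite /e pickleK/= ger0_norm// (le_trans x0) ?ltW.
have near n : `|F n x - F n (ratr r)| < eps / 3.
  have e3 : 0 <= eps / 3 by rewrite divr_ge0// ltW.
  rewrite -(@ltr_pXn2r _ 2)// ?nnegrE// real_normK ?num_real// -opprB sqrrN.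
  apply: le_lt_trans (Fh n _ _ x0 (ltW xr)) _.
  have h : (ratr r - x) * (B + 1) < (eps / 3) ^+ 2.
    by rewrite -ltr_pdivlMr ?ltr_wpDl// ltrBlDl.
  have : 0 < ratr r - x by rewrite subr_gt0.
  by move: h; nra.
have /cvg_ex[l hl] := cphi (pickle r); rewrite er in hl.
have e6 : 0 < eps / 6 by rewrite divr_gt0.
have /cvgrPdist_lt/(_ _ e6)[N _ hN] := hl; exists N => m n Nm Nn.
have := hN _ Nm; have := hN _ Nn; have := near (phi m); have := near (phi n) => /=.
rewrite !ltr_norml => /andP[? ?] /andP[? ?] /andP[? ?] /andP[? ?].
by apply/andP; split; lra.
Qed.

End BoundedSequences.

(** * Bounds on the Neumann domain and compactness of multiplication by V *)

Section SquareIntegrablePerturbation.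
Context (R : realType).
Local Notation mu := (@lebesgue_measure R).
Local Notation TR := (measurableTypeR R).
Local Notation D := (halfline : set TR).
Local Notation Re := complex.Re.
Local Notation dot := (@L2dot R).
Local Notation rdot u v := (Re (dot u v)).
Local Notation hnorm := (hnorm (@L2dot R)).
Implicit Types (u v w y g h f : L2 R) (x : R).

Local Notation q := (@potential R).
Local Notation A := (neumann_operator q).

Hint Extern 0 (measurable [set` _]) => exact: measurable_itvT : core.

(** u' = L u + w u with |w| <= 1, and |L u|^2 is the form <A u, u>; the 2 is that of |a + b|^2 <= 2
    |a|^2 + 2 |b|^2. *)
Lemma neumann_derivative_bound u y u' : A (u, y) -> weak_derivative u u' ->
  rdot u' u' <= 2 * (rdot u u + rdot y u).
Proof.
move=> /neumann_form[g Lug hg] du.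
have [u1 [wu [du1 hwu gE]]] := Lug; rewrite /= in du1 hwu gE.
have e := weak_derivative_uniq du du1; rewrite -{u1 du1}e in gE.
have b : rdot wu wu <= 1 ^+ 2 * rdot u u.
  apply: (multiplication_bound (@measurable_log_deriv R)) hwu => x _.
  exact: log_deriv_le1.
rewrite expr1n mul1r in b.
rewrite (hg _ _ Lug); have -> : u' = g + wu by rewrite gE subrK.
have e1 : rdot (g + wu) (g + wu) = rdot g g + 2 * rdot g wu + rdot wu wu.
  have -> : rdot (g + wu) (g + wu) = rdot g (g + wu) + rdot wu (g + wu).
    exact: (rdotDl dot).
  have -> : rdot g (g + wu) = rdot g g + rdot g wu by exact: (rdotDr dot).
  have -> : rdot wu (g + wu) = rdot wu g + rdot wu wu by exact: (rdotDr dot).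
  by rewrite (rdotC dot wu g); lra.
have e2 : rdot (g - wu) (g - wu) = rdot g g - 2 * rdot g wu + rdot wu wu.
  have -> : rdot (g - wu) (g - wu) = rdot g (g - wu) - rdot wu (g - wu).
    exact: (rdotBl dot).
  have -> : rdot g (g - wu) = rdot g g - rdot g wu by exact: (rdotBr dot).
  have -> : rdot wu (g - wu) = rdot wu g - rdot wu wu by exact: (rdotBr dot).
  by rewrite (rdotC dot wu g); lra.
have := rdot_ge0 dot (g - wu); rewrite e2 e1; lra.
Qed.

(** The 6 combines |u(x)|^2 <= 2 (|u|^2 + |u'|^2) with |u'|^2 <= 2 (|u|^2 + <A u, u>). Only the form
    of A enters, as [V_bnd] requires. *)
Lemma neumann_rep u y : A (u, y) -> exists F G,
  [/\ {ae mu, forall x, D x -> u x = F x +i* G x},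
      measurable_fun D F /\ measurable_fun D G,
      forall x, 0 <= x -> F x ^+ 2 + G x ^+ 2 <= 6 * (rdot u u + rdot y u) &
      forall x z, 0 <= x -> x <= z -> (F z - F x) ^+ 2 + (G z - G x) ^+ 2 <=
        (z - x) * (6 * (rdot u u + rdot y u))].
Proof.
move=> Auy; have [u' [_ [_ [du _ _ _ _]]]] := weak_derivative_of_neumann Auy.
have b := neumann_derivative_bound Auy du.
have y0 := neumann_ge0 Auy; have u0 := rdot_ge0 dot u.
have [F [G [PF PG hu]]] := weak_rep du.
have [sF sG] := rep_square_integrable PF PG hu.
have eu := rdot_ae sF.1 sG.1 hu.
have eu' := rdot_ae (L2_Re u').1 (L2_Im u').1 (L2_eta_ae u').
exists F, G; split => //; first by split; [exact: sF.1|exact: sG.1].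
- move=> x x0.
  have := primitive_sup_sqr PF sF (L2_Re u') x0.
  have := primitive_sup_sqr PG sG (L2_Im u') x0.
  by lra.
- move=> x z x0 xz.
  have := primitive_holder PF (L2_Re u') x0 xz.
  have := primitive_holder PG (L2_Im u') x0 xz.
  by nra.
Qed.

(** Since (F_n - G)^2 <= 4 B, the integrable majorant is 4 B V^2: the integrability of V^2 turns
    pointwise convergence into convergence in L^2. *)
Lemma square_integrable_mul_cvg (V : R -> R) (F : nat -> R -> R) (G : R -> R) (B : R) :
  square_integrable V -> (forall n, measurable_fun D (F n)) ->
  (forall n x, D x -> F n x ^+ 2 <= B) ->
  (forall x, D x -> F n x @[n --> \oo] --> G x) ->
  square_integrable (fun x => V x * G x) /\
  \int[mu]_(x in D) (V x * F n x - V x * G x) ^+ 2 @[n --> \oo] --> 0.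
Proof.
move=> sV mF FB FG; have mG : measurable_fun D G := measurable_fun_cvg mF FG.
have GB x : D x -> G x ^+ 2 <= B.
  move=> Dx; have c : F n x ^+ 2 @[n --> \oo] --> G x ^+ 2.
    by rewrite expr2; under eq_fun do rewrite expr2; apply: cvgM; exact: FG.
  rewrite -(cvg_lim _ c)//; apply: limr_le; first by apply/cvg_ex; eexists; exact: c.
  by apply: nearW => n; exact: FB.
have sVG : square_integrable (fun x => V x * G x).
  rewrite (_ : (fun x => _) = (fun x => G x * V x)); last by apply/funext => x; exact: mulrC.
  apply: (square_integrableM_bounded (c := 1 + B)) => // x Dx.
  by have := GB _ Dx; rewrite -real_normK ?num_real//; have := sqr_ge0 (`|G x| - 1); nra.
split => //.
have iV : itg D (fun x => 4 * B * V x ^+ 2) by apply: itgZ => //; exact: square_integrable_sqr.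
have mVF n : measurable_fun D (fun x => (V x * F n x - V x * G x) ^+ 2).
  apply: measurable_funX; apply: measurable_funB; last exact: sVG.1.
  by apply: measurable_funM; [exact: sV.1|].
have [|||||] := @dominated_convergence _ _ _ mu D (measurable_itvT _)
    (fun n => EFin \o (fun x => (V x * F n x - V x * G x) ^+ 2))
    (EFin \o (fun=> 0)) (fun x => (4 * B * V x ^+ 2)%:E).
- by move=> n; exact/measurable_EFinP.
- exact/measurable_EFinP.
- apply: aeW => x Dx /=; apply: cvg_EFin; first exact: nearW.
  have c : V x * F n x - V x * G x @[n --> \oo] --> (0 : R).
    rewrite -[X in _ --> X](subrr (V x * G x)); apply: cvgB; last exact: cvg_cst.
    by apply: cvgM; [exact: cvg_cst|exact: FG].
  by rewrite -[X in _ --> X](mulr0 (0 : R)); under eq_fun do rewrite expr2; exact: cvgM.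
- exact: iV.
- apply: aeW => x n Dx /=; rewrite lee_fin ger0_norm ?sqr_ge0// -mulrBr exprMn mulrC.
  rewrite ler_wpM2r ?sqr_ge0//; have := FB n _ Dx; have := GB _ Dx.
  by have := sqr_ge0 (F n x + G x); nra.
have -> : (\int[mu]_(x in D) (EFin \o (fun=> 0%R)) x)%E = 0%:E by rewrite integral0.
by move=> _ _ /fine_cvg.
Qed.

Context (V : R -> R) (sV : square_integrable V).
Local Notation M := (multiplication_operator V).

Lemma neumann_dom_multiplication u y : A (u, y) -> exists w, M (u, w).
Proof.
move=> Auy; have [F [G [hu [mF mG] b _]]] := neumann_rep Auy.
set B := 6 * _ in b.
have s (H : R -> R) : measurable_fun D H -> (forall x, 0 <= x -> H x ^+ 2 <= B) ->
    square_integrable (fun x => V x * H x).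
  move=> mH HB.
  rewrite (_ : (fun x => _) = (fun x => H x * V x)); last by apply/funext => x; exact: mulrC.
  apply: (square_integrableM_bounded (c := 1 + B)) => // x.
  rewrite /= in_itv/= andbT => /ltW /HB; rewrite -real_normK ?num_real//.
  by have := sqr_ge0 (`|H x| - 1); nra.
have [] := @exists_L2 R (fun x => V x * F x) (fun x => V x * G x).
- by apply: s => // x /b; have := sqr_ge0 (G x); lra.
- by apply: s => // x /b; have := sqr_ge0 (F x); lra.
move=> w hw; exists w; apply: filterS2 hw hu => x e1 e2 Dx; rewrite e1//= e2//.
by apply/eqP; rewrite eq_complex/= !mul0r subr0 addr0 !eqxx.
Qed.

Let I := \int[mu]_(x in D) V x ^+ 2.

Lemma multiplication_form_bound u y w : A (u, y) -> M (u, w) ->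
  rdot w w <= (6 * I + 1) * (rdot u u + rdot y u).
Proof.
move=> Auy Mw; have [F [G [hu [mF mG] b _]]] := neumann_rep Auy.
have y0 := neumann_ge0 Auy; have u0 := rdot_ge0 dot u.
set B := rdot u u + rdot y u in b *.
have hw : {ae mu, forall x, D x -> w x = (V x * F x) +i* (V x * G x)}.
  apply: filterS2 Mw hu => x e1 e2 Dx; rewrite e1//= e2//.
  by apply/eqP; rewrite eq_complex/= !mul0r subr0 addr0 !eqxx.
have mV := sV.1.
rewrite (rdot_ae (measurable_funM mV mF) (measurable_funM mV mG) hw).
have iV := square_integrable_sqr sV.
have B0 : 0 <= B by rewrite addr_ge0.
have i (H : R -> R) : measurable_fun D H -> (forall x, 0 <= x -> H x ^+ 2 <= 6 * B) ->
    itg D (fun x => (V x * H x) ^+ 2).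
  move=> mH HB; rewrite (_ : (fun x => _) = (fun x => V x ^+ 2 * H x ^+ 2)); last first.
    by apply/funext => x; exact: exprMn.
  apply: (itgM_bounded (c := 6 * B)) => //; first exact: measurable_funX.
  by move=> x; rewrite /= in_itv/= andbT => /ltW /HB; rewrite ger0_norm ?sqr_ge0.
have iF : itg D (fun x => (V x * F x) ^+ 2).
  by apply: i => // x /b; have := sqr_ge0 (G x); lra.
have iG : itg D (fun x => (V x * G x) ^+ 2).
  by apply: i => // x /b; have := sqr_ge0 (F x); lra.
rewrite -RintegralD//; apply: (@le_trans _ _ (\int[mu]_(x in D) (6 * B * V x ^+ 2))).
  apply: le_Rintegral => //; [exact: itgD|exact: itgZ|].
  move=> x; rewrite /= in_itv/= andbT => /ltW /b h.
  by rewrite !exprMn -mulrDr mulrC ler_wpM2r ?sqr_ge0.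
by rewrite RintegralZl// -/I; nra.
Qed.

Lemma multiplication_form_compact (u y w : nat -> L2 R) : (forall n, A (u n, y n)) ->
  (forall n, M (u n, w n)) -> (exists c, forall n, hnorm (u n) <= c /\ hnorm (y n) <= c) ->
  exists (phi : nat -> nat) l, {homo phi : m n / (m < n)%N} /\ hcvg dot (w \o phi) l.
Proof.
move=> hA hM [c hc].
have c0 : 0 <= c by have [h _] := hc 0%N; exact: le_trans (hnorm_ge0 _ _) h.
(* 6 (|u|^2 + <y, u>) is at most 6 (c^2 + c^2). *)
pose B := 12 * c ^+ 2.
have /boolp.choice[t ht] : forall n, exists t : (R -> R) * (R -> R),
  [/\ {ae mu, forall x, D x -> u n x = t.1 x +i* t.2 x},
      measurable_fun D t.1 /\ measurable_fun D t.2,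
      forall x, 0 <= x -> t.1 x ^+ 2 + t.2 x ^+ 2 <= B &
      forall x z, 0 <= x -> x <= z -> (t.1 z - t.1 x) ^+ 2 + (t.2 z - t.2 x) ^+ 2 <=
        (z - x) * B].
  move=> n; have [F [G [hu mFG b1 b2]]] := neumann_rep (hA n).
  have bB : 6 * (rdot (u n) (u n) + rdot (y n) (u n)) <= B.
    have [h1 h2] := hc n; have h3 := hnorm_ge0 dot (u n); have h4 := hnorm_ge0 dot (y n).
    have := le_trans (ler_norm _) (abs_rdot_le dot (y n) (u n)).
    have := sqr_hnorm dot (u n); rewrite /B; move: h1 h2 h3 h4.
    by move: (hnorm (u n)) (hnorm (y n)) (rdot (u n) (u n)) (rdot (y n) (u n)) => *; nra.
  exists (F, G); split => //= [x x0|x z x0 xz]; first exact: le_trans (b1 _ x0) bB.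
  by apply: le_trans (b2 _ _ x0 xz) _; rewrite ler_wpM2l// subr_ge0.
pose F n := (t n).1; pose G n := (t n).2.
have bF n x : 0 <= x -> F n x ^+ 2 <= B.
  by have [_ _ h _] := ht n => /h; rewrite -/(F n) -/(G n); have := sqr_ge0 (G n x); lra.
have bG n x : 0 <= x -> G n x ^+ 2 <= B.
  by have [_ _ h _] := ht n => /h; rewrite -/(F n) -/(G n); have := sqr_ge0 (F n x); lra.
have hF n x z : 0 <= x -> x <= z -> (F n z - F n x) ^+ 2 <= (z - x) * B.
  have [_ _ _ h] := ht n => x0 xz; have := h _ _ x0 xz.
  by rewrite -/(F n) -/(G n); have := sqr_ge0 (G n z - G n x); lra.
have hG n x z : 0 <= x -> x <= z -> (G n z - G n x) ^+ 2 <= (z - x) * B.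
  have [_ _ _ h] := ht n => x0 xz; have := h _ _ x0 xz.
  by rewrite -/(F n) -/(G n); have := sqr_ge0 (F n z - F n x); lra.
have [phi1 i1 c1] := holder_subsequence bF hF.
(* The imaginary parts are extracted along the subsequence found for the real parts. *)
have [phi2 i2 c2] := holder_subsequence (fun n => bG (phi1 n)) (fun n => hG (phi1 n)).
pose phi := phi1 \o phi2.
have cF x : D x -> F (phi n) x @[n --> \oo] --> limn (fun n => F (phi n) x).
  rewrite /= in_itv/= andbT => /ltW x0.
  exact: (@cvgn_subseq _ (fun n => F (phi1 n) x) phi2 (fun n => increasing_geq n i2) (c1 _ x0)).
have cG x : D x -> G (phi n) x @[n --> \oo] --> limn (fun n => G (phi n) x).
  by rewrite /= in_itv/= andbT => /ltW x0; exact: c2.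
have D0 x : D x -> 0 <= x by rewrite /= in_itv/= andbT => /ltW.
have mF n : measurable_fun D (F (phi n)) by have [_ []] := ht (phi n).
have mG n : measurable_fun D (G (phi n)) by have [_ []] := ht (phi n).
have [sF lF] := square_integrable_mul_cvg sV mF (fun n x Dx => bF (phi n) x (D0 x Dx)) cF.
have [sG lG] := square_integrable_mul_cvg sV mG (fun n x Dx => bG (phi n) x (D0 x Dx)) cG.
have [l hl] := exists_L2 sF sG.
exists phi, l; split; first by move=> m n mn; apply: i1; exact: i2.
pose r n := Num.sqrt (\int[mu]_(x in D) (V x * F (phi n) x - V x * limn (fun n => F (phi n) x)) ^+ 2 +
  \int[mu]_(x in D) (V x * G (phi n) x - V x * limn (fun n => G (phi n) x)) ^+ 2).
apply: (@hcvg_squeeze _ _ _ _ _ r) => [n|]; last first.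
  rewrite -[X in _ --> X]sqrtr0 -[X in Num.sqrt X](addr0 (0 : R)).
  by apply: (continuous_cvg _ (@sqrt_continuous R _)); exact: cvgD.
have mV := sV.1; have e := L2B_ae (w (phi n)) l; have [hu _ _ _] := ht (phi n).
apply: le_hnorm_sqr; first exact: sqrtr_ge0.
rewrite sqr_sqrtr; last by rewrite addr_ge0// Rintegral_ge0// => x _; exact: sqr_ge0.
rewrite le_eqVlt; apply/orP; left; apply/eqP; apply: rdot_ae.
- by apply: measurable_funB; [exact: measurable_funM|exact: sF.1].
- by apply: measurable_funB; [exact: measurable_funM|exact: sG.1].
have hw := hM (phi n); near=> x => Dx.
rewrite (near e x)// (near hw x)//= (near hl x)// (near hu x)//.
by apply/eqP; rewrite eq_complex/= !mul0r subr0 addr0 !eqxx.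
Unshelve. all: by end_near. Qed.

End SquareIntegrablePerturbation.

(** * Spectrum of the perturbed operator *)

Section NegativeForm.
Context (R : realType).
Local Notation mu := (@lebesgue_measure R).
Local Notation TR := (measurableTypeR R).
Local Notation D := (halfline : set TR).
Local Notation Re := complex.Re.
Local Notation dot := (@L2dot R).
Local Notation rdot u v := (Re (dot u v)).
Implicit Types (u v w y g h f : L2 R) (x : R).

Local Notation psi := (@ground_state R).
Local Notation w0 := (@log_deriv R).
Local Notation q := (@potential R).
Local Notation A := (neumann_operator q).

Hint Extern 0 (measurable [set` _]) => exact: measurable_itvT : core.

Lemma neumann_ground_state : exists p y : L2 R,
  [/\ {ae mu, forall x, D x -> p x = (psi x)%:C}, A (p, y) & rdot y p = 0].
Proof.
have [p hp Lp] := ground_factor_psi R.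
have [u' [wp [du hwp e0]]] := Lp; rewrite /= in du hwp e0.
have [p'' hp''] := exists_potential_mul p.
have u'E : u' = wp by apply/eqP; rewrite -subr_eq0 -e0.
have hu' : {ae mu, forall x, D x -> u' x = (w0 x * psi x) +i* 0}.
  apply: filterS2 hp hwp => x e1 e2 Dx; rewrite u'E e2//= e1//.
  by apply/eqP; rewrite eq_complex/= !mulr0 mul0r subr0 addr0 !eqxx.
have hpp : {ae mu, forall x, D x -> p'' x = (q x * psi x) +i* 0}.
  apply: filterS2 hp hp'' => x e1 e2 Dx; rewrite e2//= e1//.
  by apply/eqP; rewrite eq_complex/= !mulr0 mul0r subr0 addr0 !eqxx.
have sq : square_integrable (fun x => q x * psi x).
  apply: (square_integrableM_bounded (c := 7)).
  - exact: ground_state_square_integrable.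
  - exact: measurable_potential.
  - by move=> x _; exact: potential_bound.
have du' : weak_derivative u' p''.
  exact: rep_weak (@primitive_ground_state' R) (@primitive_cst R 0) hu' hpp.
have tr : trace0 u' 0.
  apply: (rep_trace0 (@primitive_ground_state' R) (@primitive_cst R 0) sq _ hu') => //.
    exact: square_integrable0.
  by rewrite log_deriv0 mul0r.
have Ap := neumann_of_weak_derivative du du' tr hp''.
exists p, (- p'' + p''); split => //.
(* The form at psi pairs L psi with itself, and L psi = 0. *)
have [g Lg hg] := neumann_form Ap; rewrite (hg _ _ Lp).
by have -> : dot g 0 = 0 by exact: (dot0r dot).
Qed.

Lemma Rintegral_mul_gt0 (V h : R -> R) : itg D (fun x => V x * h x) ->
  {ae mu, forall x, D x -> 0 <= V x} -> ~ {ae mu, forall x, D x -> V x = 0} ->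
  (forall x, D x -> 0 < h x) -> 0 < \int[mu]_(x in D) (V x * h x).
Proof.
move=> iV V0 Vn0 h0.
have mV := itg_measurable (measurable_itvT _) iV.
have E : \int[mu]_(x in D) (V x * h x) = \int[mu]_(x in D) `|V x * h x|.
  apply: ae_eq_Rintegral => //; first exact: measurableT_comp.
  by apply: filterS V0 => x V0 Dx; rewrite ger0_norm// mulr_ge0 ?V0// ltW// h0.
rewrite E lt0r Rintegral_ge0// andbT; apply/negP => /eqP i0; apply: Vn0.
have : (\int[mu]_(x in D) `|(V x * h x)%:E| = 0)%E.
  have := Rintegral_EFin (measurable_itvT _) (itg_norm (measurable_itvT _) iV).
  by rewrite i0.
move/(ae_eq_integral_abs mu (measurable_itvT _) (measurable_int mu iV)) => e.
near=> x => Dx; have [/eqP] : (V x * h x)%:E = 0%E by apply: (near e x).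
by rewrite mulf_eq0 => /orP[/eqP//|]; rewrite gt_eqF// h0.
Unshelve. all: by end_near. Qed.

Lemma neumann_negative_form (V : R -> R) (alpha : R) : square_integrable V ->
  {ae mu, forall x, D x -> 0 <= V x} -> ~ {ae mu, forall x, D x -> V x = 0} -> alpha < 0 ->
  exists p y w, [/\ A (p, y), multiplication_operator V (p, w) &
    rdot (y + alpha%:C *: w) p < 0].
Proof.
move=> sV V0 Vn0 a0; have [p [y [hp Ap yp]]] := neumann_ground_state.
have [w Mw] := neumann_dom_multiplication sV Ap.
exists p, y, w; split => //.
have -> : rdot (y + alpha%:C *: w) p = rdot y p + alpha * rdot w p.
  by apply: etrans (rdotDl dot _ _ _) _; congr (_ + _); exact: (rdotZl dot).
rewrite yp add0r nmulr_rlt0//.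
have spsi := @ground_state_square_integrable R.
have mpsi := @measurable_ground_state R.
have hw : {ae mu, forall x, D x -> w x = (V x * psi x) +i* 0}.
  apply: filterS2 hp Mw => x e1 e2 Dx; rewrite e2//= e1//.
  by apply/eqP; rewrite eq_complex/= !mulr0 mul0r subr0 addr0 !eqxx.
rewrite (rdot_ae2 (measurable_funM sV.1 mpsi) (measurable_cst (0 : R)) mpsi (measurable_cst (0 : R)) hw hp).
rewrite [X in _ + X](_ : _ = 0) ?addr0; last first.
  by rewrite /Rintegral integral0_eq// => x _; rewrite mulr0.
have sVp : square_integrable (fun x => psi x * V x).
  apply: (square_integrableM_bounded (c := 1)) => // x _.
  by have /andP[p0 p1] := ground_state_itv x; rewrite gtr0_norm.
have E x : V x * psi x * psi x = V x * psi x ^+ 2 by rewrite expr2 mulrA.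
have -> : (fun x => V x * psi x * psi x) = (fun x => V x * psi x ^+ 2) by apply/funext.
apply: Rintegral_mul_gt0 => //.
- have := itg_mul sVp spsi; congr itg; apply/funext => x; ring.
- by move=> x _; have /andP[p0 _] := ground_state_itv x; exact: exprn_gt0.
Qed.

End NegativeForm.

(** * Weyl sequences for the points of [0, +oo) *)

Section WeylSequence.
Context (R : realType).
Local Notation mu := (@lebesgue_measure R).
Local Notation TR := (measurableTypeR R).
Local Notation D := (halfline : set TR).
Local Notation Re := complex.Re.
Local Notation dot := (@L2dot R).
Local Notation rdot u v := (Re (dot u v)).
Implicit Types (u v w : L2 R) (x s k : R).

Local Notation psi := (@ground_state R).
Local Notation w0 := (@log_deriv R).
Local Notation q := (@potential R).
Local Notation A := (neumann_operator q).

Hint Extern 0 (measurable [set` _]) => exact: measurable_itvT : core.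

Lemma itg_halfline_bounded (h : R -> R) (C : R) : (forall x, 0 <= h x) ->
  (forall b, itg (`]0, b]%classic : set TR) h) ->
  (forall b, 0 <= b -> \int[mu]_(x in `]0, b]) h x <= C) -> itg D h.
Proof.
move=> h0 hi hC.
have mh : measurable_fun D h.
  by apply: measurable_fun_halfline => b; exact: itg_measurable (hi b).
apply/integrableP; split; first exact/measurable_EFinP.
rewrite (_ : (\int[mu]_(x in _) _)%E = (\int[mu]_(x in D) (h x)%:E)%E); last first.
  by apply: eq_integral => x _ /=; rewrite ger0_norm.
have DE : D = \bigcup_n `]0, n%:R]%classic.
  apply/seteqP; split => [x|x [n _]] /=; rewrite !in_itv/= => /andP[x0 _].
    by exists (Num.truncn x).+1 => //=; rewrite in_itv/= x0 ltW// truncnS_gt.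
  by rewrite x0.
have := @ge0_nondecreasing_set_cvg_integral _ _ _ (fun n => `]0, n%:R]%classic : set TR)
  (EFin \o h) mu.
rewrite -DE => c'; apply: (@le_lt_trans _ _ C%:E); last exact: ltry.
have c : ((\int[mu]_(x in `]0%R, n%:R]) (h x)%:E) @[n --> \oo] --> \int[mu]_(x in D) (h x)%:E)%E.
  apply: c' => [|//|n|n x _]; [|by apply/measurable_EFinP; exact: itg_measurable (hi n%:R)|by rewrite lee_fin].
  by apply/nondecreasing_seqP => n; apply/subsetPset; apply: subset_itvl; rewrite bnd_simp ler_nat.
rewrite -(cvg_lim _ c)//; apply: lime_le; first by apply/cvg_ex; eexists; exact: c.
by apply: nearW => n; rewrite /= Rintegral_EFin// lee_fin hC.
Qed.

(** (x psi)' = 2 psi^2 - psi and x psi >= 0, so the integral of psi over []0, b]] is at most twice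
    that of psi^2. This integral will bound the errors of the Weyl sequence. *)
Lemma ground_state_itg : itg D psi.
Proof.
have P : primitive (fun x => x * psi x) (fun x => 2 * psi x ^+ 2 - psi x).
  have := primitiveM (@primitive_id R) (@primitive_ground_state R).
  congr primitive; apply/funext => x; rewrite mul1r /log_deriv.
  have := sqr_ground_state x; move: (psi x) => p h.
  transitivity (p - 2 * (x ^+ 2 * p) * p); [by rewrite /=; ring|by rewrite h; ring].
have s2 := square_integrable_sqr (@ground_state_square_integrable R).
have p0 x : 0 <= psi x by have /andP[/ltW] := ground_state_itv x.
have i b : itg (`]0, b]%classic : set TR) psi by exact: primitive_itg (@primitive_ground_state R).
have i2 b : itg (`]0, b]%classic : set TR) (fun x => psi x ^+ 2).
  by apply: itgS s2 => //; exact: subset_itvl.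
apply: (itg_halfline_bounded (C := 2 * \int[mu]_(x in D) psi x ^+ 2)) => // b b0.
have i3 : itg (`]0, b]%classic : set TR) (fun x => 2 * psi x ^+ 2) by exact: itgZ.
have [_ /(_ b b0)] := P; rewrite mul0r add0r RintegralB//; last exact: i.
rewrite RintegralZl//; last exact: i2.
move=> e.
have : 0 <= b * psi b by rewrite mulr_ge0.
rewrite e subr_ge0 => /le_trans; apply; rewrite ler_wpM2l//.
rewrite -lee_fin -!Rintegral_EFin//; apply: ge0_subset_integral => //.
- by apply/measurable_EFinP; exact: itg_measurable s2.
- by move=> x _; rewrite lee_fin sqr_ge0.
- exact: subset_itvl.
Qed.

Lemma ground_state_dominated (h : R -> R) (C : R) : measurable_fun D h ->
  (forall x, D x -> `|h x| <= C * psi x) -> square_integrable h.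
Proof.
move=> mh hC; split => //.
apply: (@itg_le _ _ _ (fun x => C ^+ 2 * psi x ^+ 2)) => //; first exact: measurable_funX.
  move=> x Dx; rewrite ger0_norm ?sqr_ge0// -exprMn -real_normK ?num_real//.
  by rewrite lerXn2r ?nnegrE// ?(le_trans _ (hC x Dx)) ?hC.
by apply: itgZ => //; exact: square_integrable_sqr (@ground_state_square_integrable R).
Qed.

Lemma potential_le_ground_state x : `|q x| <= 14 * psi x.
Proof.
have -> : q x = 6 * psi x - 8 * psi x ^+ 2.
  rewrite /potential /ground_state; field.
  by rewrite gt_eqF// ltr_wpDl// sqr_ge0.
have /andP[p0 p1] := ground_state_itv x.
by rewrite ler_norml; apply/andP; split; nra.
Qed.

Lemma is_derive_scale k x : is_derive x 1 (fun t : R => k * t) k.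
Proof.
have := @is_deriveZ R R R idfun k x 1 1 (is_derive_id x 1).
by move=> h; apply: (is_derive_eq h); rewrite /GRing.scale/= mulr1.
Qed.

Lemma sin_primitive k : primitive (fun x => sin (k * x)) (fun x => k * cos (k * x)).
Proof.
have d x : is_derive x 1 (fun t : R => sin (k * t)) (k * cos (k * x)).
  have := @is_derive1_comp R sin (fun t => k * t) x _ _ (is_derive_sin (k * x)) (is_derive_scale k x).
  by move=> h; apply: (is_derive_eq h); rewrite /GRing.scale/= mulrC.
have E := derive1_is_derive d.
have := @primitive_C1 R (fun x => sin (k * x)); rewrite E; apply; first by move=> x; have [] := d x.
move=> x; apply: cvgM; first exact: cvg_cst.
apply: continuous_comp; last exact: continuous_cos.
by apply: cvgM; [exact: cvg_cst|exact: cvg_id].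
Qed.

Lemma cos_primitive k : primitive (fun x => cos (k * x)) (fun x => - k * sin (k * x)).
Proof.
have d x : is_derive x 1 (fun t : R => cos (k * t)) (- k * sin (k * x)).
  have := @is_derive1_comp R cos (fun t => k * t) x _ _ (is_derive_cos (k * x)) (is_derive_scale k x).
  by move=> h; apply: (is_derive_eq h); rewrite /GRing.scale/= mulrC mulrN mulNr.
have E := derive1_is_derive d.
have := @primitive_C1 R (fun x => cos (k * x)); rewrite E; apply; first by move=> x; have [] := d x.
move=> x; apply: cvgM; first exact: cvg_cst.
apply: continuous_comp; last exact: continuous_sin.
by apply: cvgM; [exact: cvg_cst|exact: cvg_id].
Qed.

(* As P - P^2 vanishes to second order at 0, its product with exp (i k x) still
   satisfies the Neumann condition. *)
Section Bump.
Variable s : R.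
Hypothesis s_itv : 0 < s <= 1.

(** [P1] and [P2] are the first two derivatives of [P]; the formula for [P2] is psi'' = q psi.
    Likewise [b1] and [b2] below for the bump b = P - P^2. *)
Let P x := psi (s * x).
Let P1 x := - 2 * s ^+ 2 * (x * (P x * P x)).
Let P2 x := s ^+ 2 * (q (s * x) * P x).

Let P_itv x : 0 < P x <= 1. Proof. exact: ground_state_itv. Qed.

Let P_primitive : primitive P P1.
Proof.
have d x : is_derive x 1 P (P1 x).
  have := @is_derive1_comp R psi (fun y => s * y) x _ _ (is_derive_ground_state (s * x)) (is_derive_scale s x).
  move=> h; apply: (is_derive_eq h); rewrite /P1 /P /log_deriv /GRing.scale/=; ring.
have E : derive1 P = P1 by apply: derive1_is_derive.
have := @primitive_C1 R P; rewrite E; apply; first by move=> x; have [] := d x.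
have cP : continuous P by apply: derivable_continuous => x; have [] := d x.
move=> x; apply: cvgM; first exact: cvg_cst.
by apply: cvgM; [exact: cvg_id|apply: cvgM; exact: cP].
Qed.

Let P1_primitive : primitive P1 P2.
Proof.
have := primitiveZ (- 2 * s ^+ 2) (primitiveM (@primitive_id R) (primitiveM P_primitive P_primitive)).
congr primitive; apply/funext => x; rewrite /P2 /P1 /P /potential /ground_state /=; field.
by rewrite gt_eqF// ltr_wpDl// sqr_ge0.
Qed.

Let P1_le x : `|P1 x| <= s * P x.
Proof.
have -> : P1 x = s * (w0 (s * x) * P x) by rewrite /P1 /P /log_deriv; ring.
have /andP[s0 _] := s_itv; have /andP[p0 _] := P_itv x.
rewrite normrM [X in _ * X]normrM (gtr0_norm s0) (gtr0_norm p0) ler_pM2l//.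
by apply: ler_piMl; [exact: ltW|exact: log_deriv_le1].
Qed.

Let P2_le x : `|P2 x| <= 7 * s ^+ 2 * P x.
Proof.
have /andP[s0 _] := s_itv; have /andP[p0 _] := P_itv x.
rewrite /P2 normrM [X in _ * X]normrM (gtr0_norm p0) (gtr0_norm (exprn_gt0 2 s0)) mulrA ler_pM2r//.
by rewrite [leRHS]mulrC ler_pM2l ?exprn_gt0// potential_bound.
Qed.

(** As s <= 1, s^2 (x^2 + 1) <= s^2 x^2 + 1. The factors s^2 gained by differentiating the stretched
    bump are thereby traded for the majorant psi, which does not depend on s. *)
Let P_le x : s ^+ 2 * P x <= psi x.
Proof.
have /andP[s0 s1] := s_itv.
have h (t : R) : 0 < t ^+ 2 + 1 by rewrite ltr_wpDl// sqr_ge0.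
rewrite /P /ground_state ler_pdivrMr// mulrC ler_pdivlMr//.
by have := sqr_ge0 x; nra.
Qed.

Let P_scale x : P x <= s ^- 2 * psi x.
Proof. by have /andP[s0 _] := s_itv; rewrite ler_pdivlMl ?exprn_gt0. Qed.

Let b x := P x * (1 - P x).
Let b1 x := P1 x * (1 - 2 * P x).
Let b2 x := P2 x * (1 - 2 * P x) - 2 * P1 x ^+ 2.

Let b_primitive : primitive b b1.
Proof.
have := primitiveM P_primitive (primitiveD (@primitive_cst R 1) (primitiveN P_primitive)).
by congr primitive; apply/funext => x; rewrite /b1 /=; ring.
Qed.

Let b1_primitive : primitive b1 b2.
Proof.
have := primitiveM P1_primitive (primitiveD (@primitive_cst R 1) (primitiveZ (- 2) P_primitive)).
rewrite (_ : (fun x => P1 x * _) = b1); last by apply/funext => x; rewrite /b1; ring.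
by congr primitive; apply/funext => x; rewrite /b2 /=; ring.
Qed.

Let b_itv x : 0 <= b x <= P x.
Proof.
have /andP[p0 p1] := P_itv x; rewrite /b mulr_ge0 ?subr_ge0 ?(ltW p0)//=.
by rewrite ler_piMr ?(ltW p0)// gerBl ltW.
Qed.

Let b1_le x : `|b1 x| <= s * P x.
Proof.
have /andP[p0 p1] := P_itv x; rewrite normrM; apply: le_trans (P1_le x).
by rewrite ler_piMr// ler_norml; apply/andP; split; lra.
Qed.

Let b2_le x : `|b2 x| <= 9 * s ^+ 2 * P x.
Proof.
have /andP[p0 p1] := P_itv x; rewrite (le_trans (ler_normB _ _))//.
have h1 : `|P2 x * (1 - 2 * P x)| <= 7 * s ^+ 2 * P x.
  rewrite normrM; apply: le_trans (P2_le x).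
  by rewrite ler_piMr// ler_norml; apply/andP; split; lra.
have h2 : `|2 * P1 x ^+ 2| <= 2 * s ^+ 2 * P x.
  rewrite normrM normrX [`|2|]ger0_norm// -mulrA ler_pM2l//.
  apply: (@le_trans _ _ ((s * P x) ^+ 2)).
    by rewrite lerXn2r ?nnegrE// ?(le_trans _ (P1_le x)).
  by rewrite exprMn ler_wpM2l ?sqr_ge0// expr2 ler_piMr// ltW.
by move: h1 h2; lra.
Qed.

Section Wave.
(** [c] stands for cos(k x) or sin(k x) and [d] for its derivative: the real and imaginary parts of
    exp(i k x) b are treated at once. *)
Variables (k : R) (c d : R -> R).
Hypothesis k0 : 0 <= k.
Hypothesis c_primitive : primitive c d.
Hypothesis d_primitive : primitive d (fun x => - k ^+ 2 * c x).
Hypothesis c_le : forall x, `|c x| <= 1.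
Hypothesis d_le : forall x, `|d x| <= k.

Let f x := c x * b x.
Let f1 x := d x * b x + c x * b1 x.
Let f2 x := - k ^+ 2 * f x + 2 * (d x * b1 x) + c x * b2 x.

Lemma wave_primitive : primitive f f1.
Proof.
have := primitiveM c_primitive b_primitive.
by congr primitive; apply/funext => x; rewrite /f1; ring.
Qed.

Lemma wave_primitive' : primitive f1 f2.
Proof.
have := primitiveD (primitiveM d_primitive b_primitive) (primitiveM c_primitive b1_primitive).
by congr primitive; apply/funext => x; rewrite /f2 /f; ring.
Qed.

Lemma wave0 : f1 0 = 0.
Proof.
have e : P 0 = 1 by rewrite /P mulr0 ground_state0.
by rewrite /f1 /b /b1 e /P1 e; ring.
Qed.

Let norm_le2 (x y a a' : R) : `|x| <= a -> `|y| <= a' -> `|x * y| <= a * a'.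
Proof. by move=> xa ya; rewrite normrM ler_pM. Qed.

Let b_norm x : `|b x| <= P x.
Proof. by have /andP[b0 bP] := b_itv x; rewrite ger0_norm. Qed.

Lemma wave_le x : `|f x| <= P x.
Proof. by rewrite -[leRHS]mul1r; exact: norm_le2. Qed.

Let sP x : s * P x <= P x /\ s ^+ 2 * P x <= P x.
Proof.
have /andP[s0 s1] := s_itv; have /andP[p0 p1] := P_itv x.
split; rewrite ler_piMl ?(ltW p0)// expr2; nra.
Qed.

Lemma wave_square_integrable : square_integrable f.
Proof.
apply: (ground_state_dominated (C := s ^- 2)); first exact: primitive_measurable wave_primitive.
by move=> x _; exact: le_trans (wave_le x) (P_scale x).
Qed.

Lemma wave_square_integrable' : square_integrable f1.
Proof.
have /andP[s0 s1] := s_itv.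
apply: (ground_state_dominated (C := (k + 1) * s ^- 2)).
  exact: primitive_measurable wave_primitive'.
move=> x _; rewrite -mulrA; apply: (@le_trans _ _ ((k + 1) * P x)); last first.
  by rewrite ler_wpM2l// addr_ge0.
have h1 := norm_le2 (d_le x) (b_norm x).
have h2 := norm_le2 (c_le x) (le_trans (b1_le x) (sP x).1).
by have := ler_normD (d x * b x) (c x * b1 x); rewrite /f1; lra.
Qed.

Lemma wave_square_integrable'' : square_integrable f2.
Proof.
have /andP[s0 s1] := s_itv.
apply: (ground_state_dominated (C := (k ^+ 2 + 2 * k + 9) * s ^- 2)).
  apply: measurable_fun_halfline => t; have [h _] := wave_primitive'.
  exact: itg_measurable (h t).
move=> x _; rewrite -mulrA; apply: (@le_trans _ _ ((k ^+ 2 + 2 * k + 9) * P x)); last first.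
  by rewrite ler_wpM2l// !addr_ge0// ?mulr_ge0// exprn_ge0.
have [h1 h2] := sP x.
have h3 : `|- k ^+ 2 * f x| <= k ^+ 2 * P x.
  by apply: norm_le2; [rewrite normrN ger0_norm ?sqr_ge0|exact: wave_le].
have h4 : `|2 * (d x * b1 x)| <= 2 * (k * P x).
  apply: norm_le2; first by rewrite ger0_norm.
  by apply: norm_le2 => //; exact: le_trans (b1_le x) h1.
have h5 : `|c x * b2 x| <= 1 * (9 * P x).
  apply: norm_le2 => //; apply: le_trans (b2_le x) _.
  by rewrite -mulrA ler_pM2l.
have h6 := ler_normD (- k ^+ 2 * f x + 2 * (d x * b1 x)) (c x * b2 x).
have h7 := ler_normD (- k ^+ 2 * f x) (2 * (d x * b1 x)).
by rewrite /f2; lra.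
Qed.

(** The terms with k^2 cancel, leaving - 2 d b' - c b'' + q c b. The squares of d b', c b'' and q c
    b are at most k^2 psi, 81 psi and 196 psi, and the square of a sum of three terms is at most
    three times the sum of squares: 3 (4 k^2 + 81 + 196) = 12 k^2 + 831. *)
Lemma wave_error x :
  (- f2 x + q x * f x - k ^+ 2 * f x) ^+ 2 <= (12 * k ^+ 2 + 831) * psi x.
Proof.
have /andP[s0 s1] := s_itv; have /andP[p0 p1] := P_itv x.
have /andP[g0 g1] := ground_state_itv x; have Ppsi := P_le x.
have -> : - f2 x + q x * f x - k ^+ 2 * f x =
    - (2 * (d x * b1 x)) - c x * b2 x + q x * f x by rewrite /f2; ring.
have sq (t a : R) : `|t| <= a -> t ^+ 2 <= a ^+ 2.
  by move=> ta; rewrite -real_normK ?num_real// lerXn2r ?nnegrE// (le_trans _ ta).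
have h1 : (d x * b1 x) ^+ 2 <= k ^+ 2 * psi x.
  apply: le_trans (sq _ _ (norm_le2 (d_le x) (b1_le x))) _.
  rewrite exprMn ler_wpM2l ?sqr_ge0//; apply: le_trans Ppsi.
  by rewrite exprMn ler_wpM2l ?sqr_ge0// expr2 ler_piMr// ltW.
have h2 : (c x * b2 x) ^+ 2 <= 81 * psi x.
  apply: le_trans (sq _ _ (norm_le2 (c_le x) (b2_le x))) _.
  rewrite mul1r -mulrA exprMn (_ : 9 ^+ 2 = 81 :> R); last by ring.
  rewrite ler_pM2l//; apply: le_trans Ppsi; rewrite exprMn.
  apply: ler_pM; rewrite ?sqr_ge0//.
    by rewrite [leLHS]expr2 ler_piMr ?sqr_ge0// expr2; nra.
  by rewrite expr2 ler_piMr// ltW.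
have h3 : (q x * f x) ^+ 2 <= 196 * psi x.
  apply: le_trans (sq _ _ (norm_le2 (potential_le_ground_state x) (wave_le x))) _.
  rewrite -mulrA exprMn (_ : 14 ^+ 2 = 196 :> R); last by ring.
  rewrite ler_pM2l// expr2; apply: (@le_trans _ _ (psi x * P x)).
    by rewrite ler_piMr ?mulr_ge0 ?(ltW g0) ?(ltW p0)//; nra.
  by rewrite ler_piMr// ltW.
move: h1 h2 h3; move: (d x * b1 x) (c x * b2 x) (q x * f x) => t1 t2 t3 h1 h2 h3.
have h4 := sqr_ge0 (2 * t1 - t2); have h5 := sqr_ge0 (2 * t1 + t3); have h6 := sqr_ge0 (t2 + t3).
nra.
Qed.

End Wave.

(** On []1/s, 2/s]], of length 1/s, the argument s x is between 1 and 2, so P is between 1/5 and 1/2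
    and b = P (1 - P) is at least 1/10. *)
Lemma bump_lower : (100 * s)^-1 <= \int[mu]_(x in D) b x ^+ 2.
Proof.
have /andP[s0 s1] := s_itv.
have i : itg D (fun x => b x ^+ 2).
  suff : square_integrable b by exact: square_integrable_sqr.
  apply: (ground_state_dominated (C := s ^- 2)); first exact: primitive_measurable b_primitive.
  by move=> x _; have /andP[b0 bP] := b_itv x; rewrite ger0_norm// (le_trans bP).
have sub : `]s^-1, 2 / s]%classic `<=` (D : set TR).
  by move=> x; rewrite /= !in_itv/= => /andP[+ _]; rewrite andbT; apply: lt_trans; rewrite invr_gt0.
have i' : itg (`]s^-1, 2 / s]%classic : set TR) (fun x => b x ^+ 2) by exact: itgS i.
apply: (@le_trans _ _ (\int[mu]_(x in `]s^-1, 2 / s]) b x ^+ 2)); last first.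
  rewrite -lee_fin -!Rintegral_EFin//; apply: ge0_subset_integral => //.
  - by apply/measurable_EFinP; exact: itg_measurable i.
  - by move=> x _; rewrite lee_fin sqr_ge0.
apply: (@le_trans _ _ (\int[mu]_(x in `]s^-1, 2 / s]) (100^-1 : R))); last first.
  apply: le_Rintegral => //; first exact: itg_cst.
  move=> x; rewrite /= in_itv/= => /andP[h1 h2].
  have {}h1 : 1 < s * x by rewrite -ltr_pdivrMl// mulr1.
  have {}h2 : s * x <= 2 by rewrite mulrC -ler_pdivlMr.
  have e : P x * ((s * x) ^+ 2 + 1) = 1.
    by rewrite /P /ground_state mulVf// gt_eqF// ltr_wpDl// sqr_ge0.
  have /andP[p0 p1] := P_itv x; move: e h1 h2; rewrite /b.
  move: (P x) (s * x) p0 p1 => p y p0 p1 e h1 h2.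
  have h3 : 5^-1 <= p by nra.
  have h4 : p <= 2^-1 by nra.
  have h5 : 10^-1 <= p * (1 - p) by nra.
  by nra.
have m : mu (`]s^-1, 2 / s]%classic : set TR) = (s^-1)%:E.
  rewrite lebesgue_measure_itv/= lte_fin ltr_pdivlMr// mulVf ?gt_eqF// ltr1n -EFinB.
  by congr (_%:E); field; rewrite gt_eqF.
have -> : \int[mu]_(x in `]s^-1, 2 / s]) (100^-1 : R) = 100^-1 * fine (mu (`]s^-1, 2 / s]%classic : set TR)).
  exact: Rintegral_cst.
by rewrite m /= invfM.
Qed.

(** The lower bound blows up as s tends to 0 while the two upper bounds are free of s. By cos^2 +
    sin^2 = 1 the norm of the element is that of b; the factor 2 counts its real and imaginary
    parts. *)
Lemma weyl_element k : 0 <= k -> exists u v,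
  [/\ A (u, v), (100 * s)^-1 <= rdot u u,
      rdot (v - (k ^+ 2)%:C *: u) (v - (k ^+ 2)%:C *: u) <=
        2 * ((12 * k ^+ 2 + 831) * \int[mu]_(x in D) psi x) &
      forall V w, square_integrable V -> multiplication_operator V (u, w) ->
        rdot w w <= \int[mu]_(x in D) V x ^+ 2].
Proof.
move=> k0.
have Pc := cos_primitive k; have Ps := sin_primitive k.
have Pc' : primitive (fun x => - k * sin (k * x)) (fun x => - k ^+ 2 * cos (k * x)).
  by have := primitiveZ (- k) Ps; congr primitive; apply/funext => x; ring.
have Ps' : primitive (fun x => k * cos (k * x)) (fun x => - k ^+ 2 * sin (k * x)).
  by have := primitiveZ k Pc; congr primitive; apply/funext => x; ring.
have c1 x : `|cos (k * x)| <= 1 by rewrite ler_norml cos_geN1 cos_le1.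
have s1 x : `|sin (k * x)| <= 1 by rewrite ler_norml sin_geN1 sin_le1.
have c2 x : `|k * cos (k * x)| <= k by rewrite normrM (ger0_norm k0) ler_piMr.
have s2 x : `|- k * sin (k * x)| <= k by rewrite normrM normrN (ger0_norm k0) ler_piMr.
have [u hu] := exists_L2 (wave_square_integrable Pc c1) (wave_square_integrable Ps s1).
have [u' hu'] := exists_L2 (wave_square_integrable' k0 Pc Pc' c1 s2) (wave_square_integrable' k0 Ps Ps' s1 c2).
have [u'' hu''] := exists_L2 (wave_square_integrable'' k0 Pc Pc' c1 s2) (wave_square_integrable'' k0 Ps Ps' s1 c2).
have du := rep_weak (wave_primitive Pc) (wave_primitive Ps) hu hu'.
have du' := rep_weak (wave_primitive' Pc Pc') (wave_primitive' Ps Ps') hu' hu''.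
have tr : trace0 u' 0.
  by apply: (rep_trace0 (wave_primitive' Pc Pc') (wave_primitive' Ps Ps')
    (wave_square_integrable'' k0 Pc Pc' c1 s2) (wave_square_integrable'' k0 Ps Ps' s1 c2) hu');
    [exact: (wave0 (fun x => cos (k * x)) (fun x => - k * sin (k * x)))|
     exact: (wave0 (fun x => sin (k * x)) (fun x => k * cos (k * x)))].
have [qu hqu] := exists_potential_mul u.
have mu1 := (wave_square_integrable Pc c1).1; have mu2 := (wave_square_integrable Ps s1).1.
exists u, (- u'' + qu); split; first exact: neumann_of_weak_derivative du du' tr hqu.
- apply: (le_trans bump_lower).
  have -> : rdot u u = \int[mu]_(x in D) (cos (k * x) * b x) ^+ 2 +
      \int[mu]_(x in D) (sin (k * x) * b x) ^+ 2 := rdot_ae mu1 mu2 hu.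
  rewrite -RintegralD//; last 2 first.
  + exact: square_integrable_sqr (wave_square_integrable Pc c1).
  + exact: square_integrable_sqr (wave_square_integrable Ps s1).
  rewrite le_eqVlt; apply/orP; left; apply/eqP; apply: eq_Rintegral => x _.
  by rewrite !exprMn -mulrDl cos2Dsin2 mul1r.
- pose e c f2 x := - f2 x + q x * (c x * b x) - k ^+ 2 * (c x * b x) : R.
  pose fc x := - k ^+ 2 * (cos (k * x) * b x) + 2 * (- k * sin (k * x) * b1 x) + cos (k * x) * b2 x.
  pose fs x := - k ^+ 2 * (sin (k * x) * b x) + 2 * (k * cos (k * x) * b1 x) + sin (k * x) * b2 x.
  pose cosk x : R := cos (k * x); pose sink x : R := sin (k * x).
  have mfc : measurable_fun D fc := (wave_square_integrable'' k0 Pc Pc' c1 s2).1.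
  have mfs : measurable_fun D fs := (wave_square_integrable'' k0 Ps Ps' s1 c2).1.
  have me c f2 : measurable_fun D f2 -> measurable_fun D (fun x => c x * b x) ->
      measurable_fun D (e c f2).
    move=> m2 mf; apply: measurable_funB; last by apply: measurable_funM.
    apply: measurable_funD; first exact: measurableT_comp.
    by apply: measurable_funM => //; exact: measurable_potential.
  have mec := me cosk fc mfc mu1; have mes := me sink fs mfs mu2.
  have bc x : e cosk fc x ^+ 2 <= (12 * k ^+ 2 + 831) * psi x.
    by apply: (wave_error (k := k) (c := cosk) (d := fun t => - k * sin (k * t))).
  have bs x : e sink fs x ^+ 2 <= (12 * k ^+ 2 + 831) * psi x.
    by apply: (wave_error (k := k) (c := sink) (d := fun t => k * cos (k * t))).
  set K := 12 * k ^+ 2 + 831 in bc bs *.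
  have iK : itg D (fun x => K * psi x) by apply: itgZ => //; exact: ground_state_itg.
  have ic : itg D (fun x => e cosk fc x ^+ 2).
    apply: itg_le iK => //; first exact: measurable_funX.
    by move=> x _; rewrite ger0_norm ?sqr_ge0//; exact: bc.
  have isn : itg D (fun x => e sink fs x ^+ 2).
    apply: itg_le iK => //; first exact: measurable_funX.
    by move=> x _; rewrite ger0_norm ?sqr_ge0//; exact: bs.
  have h1 := L2B_ae (- u'' + qu) ((k ^+ 2)%:C *: u); have h2 := L2D_ae (- u'') qu.
  have h3 := L2Z_ae (-1) u''; rewrite scaleN1r in h3; have h4 := L2Z_ae (k ^+ 2)%:C u.
  have -> : rdot (- u'' + qu - (k ^+ 2)%:C *: u) (- u'' + qu - (k ^+ 2)%:C *: u) =
      \int[mu]_(x in D) e cosk fc x ^+ 2 + \int[mu]_(x in D) e sink fs x ^+ 2.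
    apply: rdot_ae => //; near=> x => Dx.
    rewrite (near h1 x)// (near h2 x)// (near h3 x)// (near h4 x)// (near hqu x)//=.
    rewrite (near hu x)// (near hu'' x)//.
    by apply/eqP; rewrite eq_complex/=; apply/andP; split; apply/eqP; rewrite /e /fc /fs /cosk /sink; ring.
  have -> : K * \int[mu]_(x in D) psi x = \int[mu]_(x in D) (K * psi x).
    by rewrite RintegralZl//; exact: ground_state_itg.
  rewrite mulr_natl mulr2n.
  by apply: lerD; apply: le_Rintegral.
- move=> V w sV Mw.
  have hw : {ae mu, forall x, D x -> w x = (V x * (cos (k * x) * b x)) +i* (V x * (sin (k * x) * b x))}.
    apply: filterS2 Mw hu => x e1 e2 Dx; rewrite e1//= e2//.
    by apply/eqP; rewrite eq_complex/= !mul0r subr0 addr0 !eqxx.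
  have mV := sV.1; have iV := square_integrable_sqr sV.
  have b_1 x : b x ^+ 2 <= 1.
    have /andP[b0 bP] := b_itv x; have /andP[p0 p1] := P_itv x.
    by rewrite expr_le1// (le_trans bP).
  have -> : rdot w w = \int[mu]_(x in D) (V x * (cos (k * x) * b x)) ^+ 2 +
      \int[mu]_(x in D) (V x * (sin (k * x) * b x)) ^+ 2.
    exact: rdot_ae (measurable_funM mV mu1) (measurable_funM mV mu2) hw.
  have i (h : R -> R) : measurable_fun D (fun x => h x * b x) -> (forall x, `|h x| <= 1) ->
      itg D (fun x => (V x * (h x * b x)) ^+ 2).
    move=> mh h1; apply: itg_le iV => //; first by apply: measurable_funX; exact: measurable_funM.
    move=> x _; rewrite ger0_norm ?sqr_ge0// exprMn ler_piMr ?sqr_ge0//.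
    rewrite exprMn mulr_ile1 ?sqr_ge0//.
    by rewrite -real_normK ?num_real// expr_le1.
  have ic := i (fun x => cos (k * x)) mu1 c1; have isn := i (fun x => sin (k * x)) mu2 s1.
  rewrite -RintegralD//; apply: le_Rintegral => //; first exact: itgD ic isn.
  move=> x _; rewrite !exprMn -mulrDr -mulrDl cos2Dsin2 mul1r.
  by have := b_1 x; rewrite /b exprMn => b_1x; rewrite ler_piMr ?sqr_ge0.
Unshelve. all: by end_near. Qed.

End Bump.

End WeylSequence.

(** * Inclusion of [0, +oo) in the spectrum, and conclusion *)

Section Spectrum.
Context (R : realType) (V : R -> R) (sV : square_integrable V) (alpha : R).
Local Notation mu := (@lebesgue_measure R).
Local Notation Re := complex.Re.
Local Notation dot := (@L2dot R).
Local Notation rdot u v := (Re (dot u v)).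
Local Notation hnorm := (hnorm (@L2dot R)).

Local Notation A := (neumann_operator (@potential R)).
Local Notation M := (multiplication_operator V).
Local Notation T := (op_add A (op_scale alpha%:C M)).

(* The norms of the Weyl sequence blow up while its images under T - z stay
   bounded. *)
Lemma nonneg_spectrum_perturbed (z : R[i]) : 0 <= z -> spectrum dot T z.
Proof.
move=> z0 /resolvent_setE[C C0 hC].
have zE : z = (Re z)%:C by move: z0; case: (z) => a b; rewrite lecE /= => /andP[/eqP -> _].
have r0 : 0 <= Re z by move: z0; rewrite lecE => /andP[].
pose k := Num.sqrt (Re z).
have kz : (k ^+ 2)%:C = z by rewrite sqr_sqrtr.
have [K hK] : exists K, K = 2 * ((12 * k ^+ 2 + 831) * \int[mu]_(x in halfline) @ground_state R x) by eexists.
pose I := \int[mu]_(x in halfline) V x ^+ 2.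
(* [B] is the bound on |u| that a bounded resolvent would force, since [K] and [I] bound the squares
   of |(A - z) u| and |V u|. At s = 1 / (n + 1) the lower bound (n + 1) / 100 of |u|^2 exceeds
   B^2. *)
pose B := C * (Num.sqrt K + `|alpha| * Num.sqrt I).
have [n hn] : exists n : nat, 100 * B ^+ 2 < n.+1%:R.
  by exists (Num.truncn (100 * B ^+ 2)); exact: truncnS_gt.
have s_itv : 0 < (n.+1%:R^-1 : R) <= 1 by rewrite invr_gt0 ltr0n invf_le1 ?ltr0n// ler1n.
have [u [v [Auv lo hi hV]]] := weyl_element s_itv (sqrtr_ge0 (Re z)).
rewrite -/k kz -hK in hi.

have [w Mw] := neumann_dom_multiplication sV Auv.
have bw := hV _ _ sV Mw; rewrite -/I in bw.
have Tuv : T (u, v + alpha%:C *: w) by exists v, (alpha%:C *: w); split => //; exists w.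
have := hC _ _ Tuv.
have -> : v + alpha%:C *: w - z *: u = (v - z *: u) + alpha%:C *: w by rewrite addrAC.
have h1 : hnorm (v - z *: u) <= Num.sqrt K by exact: ler_wsqrtr.
have h2 : hnorm w <= Num.sqrt I by exact: ler_wsqrtr.
have h3 := le_hnormD dot (v - z *: u) (alpha%:C *: w).
have h4 : hnorm (alpha%:C *: w) = `|alpha| * hnorm w by exact: (hnormZr dot).
move=> h5; have {}h5 : hnorm u <= B.
  apply: le_trans h5 _; rewrite ler_pM2l//; apply: le_trans h3 _.
  by rewrite h4 lerD// ler_wpM2l.
have : rdot u u <= B ^+ 2.
  rewrite -(sqr_hnorm dot) lerXn2r// nnegrE; first exact: hnorm_ge0.
  exact: le_trans (hnorm_ge0 _ _) h5.
move=> h6; have := le_trans lo h6; rewrite invfM invrK ler_pdivrMl// leNgt hn//.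
Qed.

End Spectrum.

(* In the partial order of R[i], 0 <= z (resp. z < 0) means that z is real and
   nonnegative (resp. negative). *)
Theorem corollary3p5 (R : realType) (V : R -> R)
  (V_ge0 : \forall x \ae (@lebesgue_measure R), halfline x -> 0 <= V x)
  (V_L2 : square_integrable V)
  (V_neq0 : ~ V = cst 0 %[ae (@lebesgue_measure R) in halfline]) :
  let A := neumann_operator (@potential R) in
  let AV (alpha : R) :=
    op_add A (op_scale alpha%:C (multiplication_operator V)) in
  [/\ op_dom A = @neumann_domain R,
      forall alpha : R, op_dom (AV alpha) = op_dom A /\
        self_adjoint (@L2dot R) (AV alpha),
      forall z : R[i], resolvent_set (@L2dot R) A z ->
        compact_operator (@L2dot R)
          (op_comp (multiplication_operator V) (resolvent A z)),
      forall alpha : R,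
        essential_spectrum (@L2dot R) (AV alpha) =
          essential_spectrum (@L2dot R) A /\
        essential_spectrum (@L2dot R) A = [set z : R[i] | 0 <= z] &
      forall alpha : R, alpha < 0 ->
        spectrum (@L2dot R) (AV alpha) `&` [set z : R[i] | z < 0] !=set0].
Proof.
move=> A AV.
have sV := symmetric_multiplication V_L2.1.
have lV := linear_multiplication V.
have I0 : 0 <= \int[@lebesgue_measure R]_(x in halfline) V x ^+ 2.
  by apply: Rintegral_ge0 => x _; exact: sqr_ge0.
have K_gt0 : 0 < 6 * (\int[@lebesgue_measure R]_(x in halfline) V x ^+ 2) + 1.
  by rewrite ltr_wpDl// mulr_ge0.
have domV u y := @neumann_dom_multiplication R V V_L2 u y.
have bndV u y w := @multiplication_form_bound R V V_L2 u y w.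
have cptV := @multiplication_form_compact R V V_L2.
(* As V is defined on the whole domain of A, the unperturbed operator is the member alpha = 0 of the
   family, and its essential spectrum is an instance of the same result. *)
have AV0 : AV 0 = A.
  rewrite /AV; apply/seteqP; split => [[u y]|[u y] Auy].
    by move=> [v [w [/= Auv [w' _ /= ->] ->]]]; rewrite scale0r addr0.
  have [w Mw] := domV _ _ Auy.
  by exists y, 0; split => //=; [exists w => //; rewrite scale0r|rewrite addr0].
have ess alpha : essential_spectrum (@L2dot R) (AV alpha) = [set z : R[i] | 0 <= z].
  apply: (perturbed_essential_spectrum (@L2_complete R) (@linear_neumann R)
    (@neumann_symmetric R) (@neumann_ge0 R) (@neumann_onto R) lV sV domV K_gt0 bndV cptV).
  exact: nonneg_spectrum_perturbed.
split.
- exact: op_dom_neumann.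
- move=> alpha; split.
    exact: dom_perturbed domV alpha.
  exact: (perturbed_self_adjoint (@L2_complete R) (@linear_neumann R)
    (@neumann_symmetric R) (@neumann_ge0 R) (@neumann_onto R) lV sV domV K_gt0 bndV).
- move=> z zA; exact: (compact_op_comp_resolvent lV domV cptV zA).
- by move=> alpha; rewrite ess -AV0 ess.
- move=> alpha a0.
  have [p [y [w [Ap Mw neg]]]] := neumann_negative_form V_L2 V_ge0 V_neq0 a0.
  have Tp : AV alpha (p, y + alpha%:C *: w) by exists y, (alpha%:C *: w); split => //; exists w.
  have [z sz z0] := negative_perturbed_spectrum (@linear_neumann R) (@neumann_symmetric R)
    lV sV K_gt0 bndV Tp neg.
  by exists z.
Qed.
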